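(* Fix $b\in(0,1)$, an integer $N>0$ and $t>0$. Let $N$ particles start at $\vec y=(y_1<\dots<y_N)\in X^N$ and evolve as HL-PushTASEP on $\mathbb{Z}_{\geq0}$ with parameter $b$. Then for $1\le m\le N$ and $x\in\mathbb{Z}$, \begin{align*} P_{\vec y}(x_m(t)=x)&=(-1)^{m-1}b^{m(m-1)/2}\sum_{k=m}^N\sum_{S\subset\{1,\dots,N\},|S|=k}b^{\kappa(S)-mk-k(k-1)/2}\binom{k-1}{m-1}_b\\ &\quad\times\frac{1}{(2\pi i)^k}\oint\cdots\oint\prod_{i,j\in S,i<j}\frac{z_j-z_i}{1-(1+b^{-1})z_i+b^{-1}z_iz_j}\cdot\frac{1-\prod_{i\in S}z_i}{\prod_{i\in S}(1-z_i)}\prod_{i\in S}z_i^{x-y_i-1}\exp\left(-t\frac{1-z_i^{-1}}{1-bz_i^{-1}}\right)dz_i, \end{align*} where $\kappa(S)$ is the sum of the elements of $S$ and the contours are positively oriented circles of equal large radius containing all singularities of the integrand.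
   Context: $X^N=\{(x_1<\dots<x_N):x_i\in\mathbb{Z}_{\geq0}\}$. HL-PushTASEP on $\mathbb{Z}_{\geq 0}$ with parameter $b$: each particle has an independent rate-$1$ exponential clock; when the clock of the particle at $x_m$ rings, it jumps $j$ steps to the right with probability $(1-b)b^{j-1}$ for $1\leq j<x_{m+1}-x_m$, and with probability $b^{x_{m+1}-x_m-1}$ it reaches $x_{m+1}$, occupies it, and the particle previously at $x_{m+1}$ is instantaneously activated and moves by the same rule. $x_m(t)$ is the position of the $m$-th particle from the left at time $t$. $\binom{n}{k}_q=\frac{(q^{n-k+1};q)_k}{(q;q)_k}$ with $(a;q)_k=\prod_{j=1}^k(1-aq^{j-1})$. *)

(* Defs.v *)
From Stdlib Require Import Reals Lra Lia ZArith Arith List.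
From Coquelicot Require Import Coquelicot.
Import ListNotations.
Open Scope R_scope.

(* Configurations: lists of N particle positions (0-based indices;    *)
(* the m-th particle from the left, 1 <= m <= N, is  nth (m-1) y 0).   *)

Fixpoint strictly_increasing (l : list nat) : Prop :=
  match l with
  | a :: ((c :: _) as r) => (a < c)%nat /\ strictly_increasing r
  | _ => True
  end.

(* [casc b y y'] : probability that, when the clock of the head particle
   of the (suffix) configuration y rings, the resulting suffix
   configuration is y'  (including the cascade of pushes).           *)
Fixpoint casc (b : R) (y y' : list nat) {struct y} : R :=
  match y, y' with
  | [a], [a'] => if Nat.ltb a a' then (1 - b) * b ^ (a' - a - 1) else 0
  | a :: ((c :: _) as yr), a' :: yr' =>
      if (Nat.ltb a a' && Nat.ltb a' c)%bool then
        (if list_eq_dec Nat.eq_dec yr yr' then (1 - b) * b ^ (a' - a - 1) else 0)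
      else if Nat.eqb a' c then b ^ (c - a - 1) * casc b yr yr'
      else 0
  | _, _ => 0
  end.

(* [act b y y'] = sum over particles m of P(y -> y' | clock of m rings). *)
Fixpoint act (b : R) (y y' : list nat) {struct y} : R :=
  match y, y' with
  | a :: yr, a' :: yr' =>
      casc b y y' + (if Nat.eq_dec a a' then act b yr yr' else 0)
  | _, _ => 0
  end.

(* one-step kernel of the uniformized chain (total clock rate N) *)
Definition kern (b : R) (N : nat) (y y' : list nat) : R := act b y y' / INR N.

Fixpoint box (bnd : list nat) : list (list nat) :=
  match bnd with
  | [] => [[]]
  | a :: r => flat_map (fun v => map (cons v) (box r)) (seq 0 (S a))
  end.

Definition sumR {A : Type} (f : A -> R) (l : list A) : R :=
  fold_right (fun a s => f a + s) 0 l.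

(* n-step transition probabilities.  Particles only move to the right,
   so every predecessor z of x with kern z x <> 0 satisfies z <= x
   componentwise; the sum over [box x] is the full (finite) sum. *)
Fixpoint kern_pow (b : R) (N : nat) (n : nat) (y x : list nat) : R :=
  match n with
  | O => if list_eq_dec Nat.eq_dec y x then 1 else 0
  | S n' => sumR (fun z => kern_pow b N n' y z * kern b N z x) (box x)
  end.

(* continuous-time transition probability P_y(X(t) = x), by uniformization *)
Definition trans_prob (b : R) (N : nat) (t : R) (y x : list nat) : R :=
  Series (fun n => exp (- (INR N * t)) * (INR N * t) ^ n / INR (fact n)
                   * kern_pow b N n y x).

(* P_y(x_m(t) = x): countable sum of trans_prob over configurations whose
   m-th particle is at x, as the limit of sums over configurations with
   all coordinates <= L. *)
Definition prob_pos (b : R) (N : nat) (t : R) (y : list nat) (m : nat) (x : Z) : R :=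
  real (Lim_seq (fun L =>
    sumR (fun x' => if Z.eq_dec (Z.of_nat (nth (m - 1) x' 0%nat)) x
                    then trans_prob b N t y x' else 0)
         (box (repeat L N)))).

Definition Cexp (w : C) : C :=
  (exp (Re w) * cos (Im w), exp (Re w) * sin (Im w)).

Definition Cpowz (z : C) (n : Z) : C :=
  match n with
  | Z0 => 1%C
  | Zpos p => Cpow z (Pos.to_nat p)
  | Zneg p => Cinv (Cpow z (Pos.to_nat p))
  end.

Definition circ_int (r : R) (g : C -> C) : C :=
  Cdiv (RInt (V := C_R_CompleteNormedModule)
          (fun th => Cmult (g (Cmult (RtoC r) (Cexp (0, th))))
                           (Cmult (0, 1) (Cmult (RtoC r) (Cexp (0, th)))))
          0 (2 * PI))
       (Cmult (RtoC (2 * PI)) (0, 1)).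

Fixpoint multi_circ_int (r : R) (k : nat) (F : list C -> C) : C :=
  match k with
  | O => F []
  | S k' => circ_int r (fun z => multi_circ_int r k' (fun zs => F (z :: zs)))
  end.

Definition prodC {A : Type} (f : A -> C) (l : list A) : C :=
  fold_right (fun a s => Cmult (f a) s) 1%C l.

Definition sumC {A : Type} (f : A -> C) (l : list A) : C :=
  fold_right (fun a s => Cplus (f a) s) 0%C l.

Fixpoint qpoch (a q : R) (k : nat) : R :=
  match k with
  | O => 1
  | S k' => qpoch a q k' * (1 - a * q ^ k')
  end.

Definition qbinom (n k : nat) (q : R) : R :=
  qpoch (q ^ (n - k + 1)) q k / qpoch q q k.

(* all sublists of l (for l = [1;...;N] these are the subsets S as
   increasing lists) *)
Fixpoint sublists (l : list nat) : list (list nat) :=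
  match l with
  | [] => [[]]
  | a :: r => map (cons a) (sublists r) ++ sublists r
  end.

Definition subsets_of_size (N k : nat) : list (list nat) :=
  filter (fun S => Nat.eqb (length S) k) (sublists (seq 1 N)).

Fixpoint pair_prod (b : R) (zs : list C) : C :=
  match zs with
  | [] => 1%C
  | zi :: rest =>
      Cmult (prodC (fun zj => Cdiv (Cminus zj zi)
                          (Cplus (Cminus 1%C (Cmult (RtoC (1 + / b)) zi))
                                 (Cmult (RtoC (/ b)) (Cmult zi zj)))) rest)
            (pair_prod b rest)
  end.

Definition integrand (b t : R) (y : list nat) (x : Z) (S : list nat) (zs : list C) : C :=
  Cmult (pair_prod b zs)
  (Cmult (Cdiv (Cminus 1%C (prodC (fun z => z) zs))
               (prodC (fun z => Cminus 1%C z) zs))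
         (prodC (fun p : nat * C =>
                   let (s, z) := p in
                   Cmult (Cpowz z (x - Z.of_nat (nth (s - 1) y 0%nat) - 1)%Z)
                         (Cexp (Cmult (RtoC (- t))
                                 (Cdiv (Cminus 1%C (Cinv z))
                                       (Cminus 1%C (Cmult (RtoC b) (Cinv z)))))))
                (combine S zs))).

Definition kappa (S : list nat) : nat := fold_right Nat.add 0%nat S.

Definition rhs (b t : R) (N : nat) (y : list nat) (m : nat) (x : Z) (r : R) : C :=
  Cmult (RtoC ((-1) ^ (m - 1) * b ^ (m * (m - 1) / 2)))
   (sumC (fun k =>
      sumC (fun S =>
        Cmult (RtoC (powerRZ b (Z.of_nat (kappa S) - Z.of_nat (m * k)
                                 - Z.of_nat (k * (k - 1) / 2))%Z
                     * qbinom (k - 1) (m - 1) b))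
              (multi_circ_int r k (integrand b t y x S)))
        (subsets_of_size N k))
      (seq m (N - m + 1))).

(* Main.v *)
(* The probability is computed by uniformization: with [f_n y] the probability
   that the m-th particle sits at [x] after [n] steps of the jump chain started
   from [y], it suffices to show that [f_n] is given by the formula in which the
   exponential factor is replaced by [rate_symbol ^ n].

   As a function of [y], the formula is a superposition, over the subsets [S], of
   plane waves [prod z_i ^ (- y_i)], the particles outside [S] carrying the wave
   number [z = 1].  Each particle jumping freely multiplies a wave by
   [jump_symbol (z_i)].  The interaction is equivalent to free evolution under a
   boundary condition at neighbouring particles [i, i + 1]: for subsets that contain
   both, the resulting integrand is antisymmetric in [z_i, z_(i+1)]; the subsets that
   contain one of them cancel in pairs because of the weight [b ^ kappa].

   For [n = 0] one uses the variables [1 / z_i], in which the integrals extract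
   power series coefficients.  Partial fractions in the first variable show that
   the integral without the factor [1 - prod z_i] is [(-1) ^ k b ^ (k (k - 1) / 2)] if
   all [y_i < x] and [0] otherwise, so that only the subsets whose largest particle is
   at [x] survive.  The remaining sum splits into products [prod (1 - b ^ (i - s))], which
   vanish unless that particle is the m-th one. *)

Require Import Defs.
From Stdlib Require Import Reals Lra Lia Psatz ZArith Arith List ClassicalEpsilon FinFun.
From Coquelicot Require Import Coquelicot.
Import List ListNotations.
Open Scope R_scope.

(** * Circle integrals of Laurent polynomials *)

(** No contour is deformed and no residue theorem is invoked. On a torus of radius at least 4 all
    integrands are uniform limits of Laurent polynomials, because every denominator is a monomial
    times [1 - s] with [s] small, and the iterated integral of a Laurent polynomial is the
    coefficient of the product of the [z_i ^ (-1)]. Analytic steps thereby become statements about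
    exponents: sending a contour to infinity is a bound on the exponents that occur, changing the
    order of integration is the symmetry of that coefficient. The state space is infinite whereas
    kernel sums run over finite cubes, so the one-step recursion holds only in the limit of large
    cubes. The boundary condition evaluates observables at lists that are not ordered; hence
    boundedness is required on all lists, uniformly in the positions and in the number of particles.
    Probabilities and their limits are real, the waves complex: a real-linear functional [ell],
    finally the real and the imaginary part, connects the two. *)

Lemma Cmult_cancel_l (u v w : C) : u <> 0%C -> (u * v = u * w)%C -> v = w.
Proof.
  intros Hu H. replace v with (/ u * (u * v))%C by (field; auto). rewrite H. field; auto.
Qed.

Ltac Cring := match goal with |- @eq _ ?u ?v => change (@eq C u v) end; ring.

Definition cis (th : R) : C := Cexp (0, th).

Lemma cis_pair (th : R) : cis th = (cos th, sin th).
Proof. unfold cis, Cexp; simpl; rewrite exp_0; f_equal; ring. Qed.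

Lemma Cexp_plus (u v : C) : Cexp (u + v) = (Cexp u * Cexp v)%C.
Proof.
  destruct u as [a c], v as [d e]; unfold Cexp, Cmult, Cplus; simpl.
  rewrite exp_plus, cos_plus, sin_plus; f_equal; ring.
Qed.

Lemma cis_plus (a c : R) : cis (a + c) = (cis a * cis c)%C.
Proof.
  unfold cis; rewrite <- Cexp_plus; f_equal; unfold Cplus; simpl; f_equal; ring.
Qed.

Lemma cis_0 : cis 0 = 1%C.
Proof. rewrite cis_pair, cos_0, sin_0; reflexivity. Qed.

Lemma Cmod_cis (th : R) : Cmod (cis th) = 1.
Proof.
  rewrite cis_pair; unfold Cmod; simpl.
  replace (cos th * (cos th * 1) + sin th * (sin th * 1)) with 1.
  - apply sqrt_1.
  - generalize (sin2_cos2 th); unfold Rsqr; lra.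
Qed.

Lemma cis_neq_0 (th : R) : cis th <> 0%C.
Proof. apply Cmod_gt_0; rewrite Cmod_cis; lra. Qed.

Lemma Cpowz_of_nat (z : C) (n : nat) : Cpowz z (Z.of_nat n) = Cpow z n.
Proof.
  destruct n; [reflexivity|].
  change (Cpow z (Pos.to_nat (Pos.of_succ_nat n)) = Cpow z (S n)).
  rewrite SuccNat2Pos.id_succ. reflexivity.
Qed.

Lemma Cpowz_opp_nat (z : C) (n : nat) : z <> 0%C -> Cpowz z (- Z.of_nat n) = (/ Cpow z n)%C.
Proof.
  intros Hz. destruct n.
  - simpl. field.
  - change (/ Cpow z (Pos.to_nat (Pos.of_succ_nat n)) = / Cpow z (S n))%C.
    rewrite SuccNat2Pos.id_succ. reflexivity.
Qed.

Lemma Cpowz_succ (z : C) (p : Z) : z <> 0%C -> Cpowz z (p + 1) = (z * Cpowz z p)%C.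
Proof.
  intros Hz. destruct (Z_lt_le_dec p 0) as [Hp|Hp].
  - replace p with (- Z.of_nat (S (Z.to_nat (- p - 1))))%Z by lia.
    set (n := Z.to_nat (- p - 1)).
    rewrite (Cpowz_opp_nat z (S n)) by auto.
    replace (- Z.of_nat (S n) + 1)%Z with (- Z.of_nat n)%Z by lia.
    rewrite Cpowz_opp_nat, Cpow_S by auto. field. split; auto. apply Cpow_nz; auto.
  - replace p with (Z.of_nat (Z.to_nat p)) by lia.
    set (n := Z.to_nat p). replace (Z.of_nat n + 1)%Z with (Z.of_nat (S n)) by lia.
    rewrite !Cpowz_of_nat. reflexivity.
Qed.

Lemma Cpowz_add (z : C) (p q : Z) : z <> 0%C -> Cpowz z (p + q) = (Cpowz z p * Cpowz z q)%C.
Proof.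
  intros Hz. pattern q. apply Z.bi_induction.
  - intros ? ? ->; tauto.
  - rewrite Z.add_0_r; simpl; ring.
  - intros n; unfold Z.succ.
    rewrite Z.add_assoc, !Cpowz_succ by auto. split; intros H.
    + rewrite H; ring.
    + apply (Cmult_cancel_l z); auto. rewrite H; ring.
Qed.

Lemma Cpowz_1 (z : C) : Cpowz z 1 = z.
Proof. simpl. ring. Qed.

Lemma Cpowz_m1 (z : C) : Cpowz z (-1) = (/ z)%C.
Proof. simpl. f_equal; ring. Qed.

Lemma Cpowz_mult_l (u v : C) (p : Z) : u <> 0%C -> v <> 0%C ->
  Cpowz (u * v) p = (Cpowz u p * Cpowz v p)%C.
Proof.
  intros Hu Hv. destruct p; simpl.
  - ring.
  - apply Cpow_mult_l.
  - rewrite Cpow_mult_l. field. split; apply Cpow_nz; auto.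
Qed.

Lemma Cpowz_RtoC (r : R) (p : Z) : r <> 0 -> Cpowz (RtoC r) p = RtoC (powerRZ r p).
Proof.
  intros Hr. destruct p; simpl.
  - reflexivity.
  - rewrite RtoC_pow. reflexivity.
  - rewrite RtoC_inv by (apply pow_nonzero; auto). rewrite RtoC_pow. reflexivity.
Qed.

Lemma cis_Z_mult (q : Z) (th : R) : cis (IZR q * th) = Cpowz (cis th) q.
Proof.
  pattern q. apply Z.bi_induction.
  - intros ? ? ->; tauto.
  - rewrite Rmult_0_l. apply cis_0.
  - intros n; unfold Z.succ. rewrite Cpowz_succ by apply cis_neq_0.
    replace (IZR (n + 1) * th) with (th + IZR n * th) by (rewrite plus_IZR; ring).
    rewrite cis_plus. split; intros H.
    + rewrite H; ring.
    + apply (Cmult_cancel_l (cis th)); auto. apply cis_neq_0.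
Qed.

Lemma Cpowz_1_l (q : Z) : Cpowz 1 q = 1%C.
Proof. destruct q; simpl; rewrite ?Cpow_1_l; auto. field. Qed.

Lemma Cmod_Cpowz (z : C) (p : Z) : z <> 0%C -> Cmod (Cpowz z p) = powerRZ (Cmod z) p.
Proof.
  intros Hz. destruct p; simpl.
  - apply Cmod_1.
  - apply Cmod_pow.
  - rewrite Cmod_inv, Cmod_pow; auto. apply Cpow_nz; auto.
Qed.

Lemma Cmod_minus_triangle (u v w : C) : Cmod (u - w) <= Cmod (u - v) + Cmod (v - w).
Proof. replace (u - w)%C with ((u - v) + (v - w))%C by ring. apply Cmod_triangle. Qed.

Lemma Cmod_minus_sym (u v : C) : Cmod (u - v) = Cmod (v - u).
Proof. rewrite <- Cmod_opp. f_equal. ring. Qed.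

(** The constant [K] absorbs the factor [r ^ k] by which integration over the torus multiplies a
    uniform error. *)
Lemma Ceq_of_arbitrarily_close (u v : C) (K : R) :
  (forall eps, 0 < eps -> Cmod (u - v) <= K * eps) -> u = v.
Proof.
  intros H. replace u with ((u - v) + v)%C by ring.
  rewrite (Cmod_eq_0 (u - v)); [ring|].
  apply Rle_antisym; [|apply Cmod_ge_0].
  apply Rnot_lt_le. intros Hp.
  assert (HK : 0 < K * 1) by (eapply Rlt_le_trans; [apply Hp|]; apply H; lra).
  assert (He : 0 < Cmod (u - v) / (2 * K)).
  { apply Rdiv_lt_0_compat; lra. }
  specialize (H _ He).
  replace (K * (Cmod (u - v) / (2 * K))) with (Cmod (u - v) / 2) in H by (field; lra). lra.
Qed.

(** The product norm is Euclidean, so the general bound on integrals of vector-valued functions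
    becomes a bound in terms of [Cmod]. *)
Lemma Cnorm_R (u : C_R_NormedModule) : norm u = Cmod u.
Proof.
  destruct u as [a c]. unfold Cmod. simpl.
  change (prod_norm (a, c) = sqrt (a * (a * 1) + c * (c * 1))).
  unfold prod_norm; simpl. f_equal.
  unfold norm; simpl. unfold abs; simpl.
  replace (Rabs a * (Rabs a * 1)) with (Rabs a ^ 2) by (simpl; ring).
  replace (Rabs c * (Rabs c * 1)) with (Rabs c ^ 2) by (simpl; ring).
  rewrite !pow2_abs. simpl; ring.
Qed.

Definition cint_fun (r : R) (g : C -> C) (th : R) : C :=
  (g (RtoC r * cis th) * (Ci * (RtoC r * cis th)))%C.

(** A relational form that carries integrability: [circ_int] rests on the total [RInt], whose value
    means nothing for a function that is not integrable. *)
Definition is_cint (r : R) (g : C -> C) (v : C) : Prop :=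
  is_RInt (V := C_R_NormedModule) (cint_fun r g) 0 (2 * PI) (v * (RtoC (2 * PI) * Ci))%C.

Lemma two_PI_Ci_neq_0 : (RtoC (2 * PI) * Ci)%C <> 0%C.
Proof.
  apply Cmod_gt_0. rewrite Cmod_mult, Cmod_R, Cmod_Ci.
  rewrite Rabs_right; generalize PI_RGT_0; lra.
Qed.

Lemma is_cint_unique (r : R) (g : C -> C) (v : C) : is_cint r g v -> circ_int r g = v.
Proof.
  intros H. unfold circ_int.
  match goal with |- Cdiv ?X _ = _ => replace X with (v * (RtoC (2 * PI) * Ci))%C end.
  2: symmetry; exact (is_RInt_unique (V := C_R_CompleteNormedModule) _ _ _ _ H).
  unfold Cdiv. change (0, 1)%R with Ci. rewrite <- Cmult_assoc, Cinv_r, Cmult_1_r; auto.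
  apply two_PI_Ci_neq_0.
Qed.

Lemma circ_int_ext (r : R) (g h : C -> C) : 0 <= r ->
  (forall z, Cmod z = r -> g z = h z) -> circ_int r g = circ_int r h.
Proof.
  intros Hr He. unfold circ_int. f_equal. apply RInt_ext. intros th _.
  rewrite He; auto. fold (cis th).
  rewrite Cmod_mult, Cmod_cis, Cmod_R, Rabs_right; lra.
Qed.

Lemma is_cint_plus (r : R) (g h : C -> C) (u v : C) :
  is_cint r g u -> is_cint r h v -> is_cint r (fun z => (g z + h z)%C) (u + v)%C.
Proof.
  intros Hg Hh. unfold is_cint.
  replace ((u + v) * (RtoC (2 * PI) * Ci))%C
    with (@plus C_R_NormedModule (u * (RtoC (2 * PI) * Ci))%C (v * (RtoC (2 * PI) * Ci))%C)
    by (change (u * (RtoC (2 * PI) * Ci) + v * (RtoC (2 * PI) * Ci) = (u + v) * (RtoC (2 * PI) * Ci))%C; ring).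
  eapply is_RInt_ext; [|apply is_RInt_plus; [apply Hg|apply Hh]].
  intros th _. unfold cint_fun.
  match goal with |- plus ?a ?c = _ => change (Cplus a c = ((g (RtoC r * cis th) + h (RtoC r * cis th)) * (Ci * (RtoC r * cis th)))%C) end. ring.
Qed.

(** A complex factor is not a scalar of the real module [C], so the product is integrated component
    by component. *)
Lemma is_RInt_Cmult_l (f : R -> C) (a c : R) (k l : C) :
  is_RInt (V := C_R_NormedModule) f a c l ->
  is_RInt (V := C_R_NormedModule) (fun t => (k * f t)%C) a c (k * l)%C.
Proof.
  intros H. destruct k as [k1 k2], l as [l1 l2].
  pose proof (is_RInt_fct_extend_fst (U := R_NormedModule) (V := R_NormedModule) f a c (l1, l2) H) as H1.
  pose proof (is_RInt_fct_extend_snd (U := R_NormedModule) (V := R_NormedModule) f a c (l1, l2) H) as H2.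
  simpl in H1, H2.
  apply (is_RInt_fct_extend_pair (U := R_NormedModule) (V := R_NormedModule)
    (fun t => ((k1, k2) * f t)%C) a c (k1 * l1 - k2 * l2) (k1 * l2 + k2 * l1)).
  - eapply is_RInt_ext; [|apply (is_RInt_minus (V := R_NormedModule));
      [apply (is_RInt_scal _ _ _ k1 _ H1)|apply (is_RInt_scal _ _ _ k2 _ H2)]].
    intros t _. reflexivity.
  - eapply is_RInt_ext; [|apply (is_RInt_plus (V := R_NormedModule));
      [apply (is_RInt_scal _ _ _ k1 _ H2)|apply (is_RInt_scal _ _ _ k2 _ H1)]].
    intros t _. reflexivity.
Qed.

Lemma is_cint_scal (r : R) (g : C -> C) (k u : C) :
  is_cint r g u -> is_cint r (fun z => (k * g z)%C) (k * u)%C.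
Proof.
  intros Hg. unfold is_cint. rewrite <- Cmult_assoc.
  eapply is_RInt_ext; [|apply is_RInt_Cmult_l, Hg].
  intros th _. unfold cint_fun. Cring.
Qed.

Lemma is_RInt_cos_Z (q : Z) : q <> 0%Z ->
  is_RInt (fun th => cos (IZR q * th)) 0 (2 * PI) 0 /\
  is_RInt (fun th => sin (IZR q * th)) 0 (2 * PI) 0.
Proof.
  intros Hq. assert (Hq' : IZR q <> 0) by (apply not_0_IZR; auto).
  assert (H1 : cis (IZR q * (2 * PI)) = 1%C).
  { rewrite cis_Z_mult, cis_pair, cos_2PI, sin_2PI. apply Cpowz_1_l. }
  rewrite cis_pair in H1. injection H1; intros Hs Hc.
  split.
  - replace 0 with (minus (sin (IZR q * (2 * PI)) / IZR q) (sin (IZR q * 0) / IZR q)) at 2.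
    + apply (is_RInt_derive (V := R_CompleteNormedModule) (fun th => sin (IZR q * th) / IZR q)).
      * intros x _. auto_derive; auto. field; auto.
      * intros x _. apply (ex_derive_continuous (V := R_NormedModule)). auto_derive; auto.
    + rewrite Hs, Rmult_0_r, sin_0. unfold minus, plus, opp; simpl. field; auto.
  - replace 0 with (minus (- cos (IZR q * (2 * PI)) / IZR q) (- cos (IZR q * 0) / IZR q)) at 2.
    + apply (is_RInt_derive (V := R_CompleteNormedModule) (fun th => - cos (IZR q * th) / IZR q)).
      * intros x _. auto_derive; auto. field; auto.
      * intros x _. apply (ex_derive_continuous (V := R_NormedModule)). auto_derive; auto.
    + rewrite Hc, Rmult_0_r, cos_0. unfold minus, plus, opp; simpl. field; auto.
Qed.

(** With the factor [Ci * z] from the parametrization the integrand is a constant times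
    [cis ((p + 1) * th)], which has mean zero unless [p = -1]. *)
Lemma is_cint_Cpowz (r : R) (p : Z) : 0 < r ->
  is_cint r (fun z => Cpowz z p) (if Z.eqb p (-1) then 1%C else 0%C).
Proof.
  intros Hr.
  assert (Hrc : RtoC r <> 0%C) by (intros H; injection H; lra).
  assert (E : forall th, cint_fun r (fun z => Cpowz z p) th =
     ((Ci * RtoC (powerRZ r (p + 1))) * cis (IZR (p + 1) * th))%C).
  { intros th. unfold cint_fun. rewrite cis_Z_mult, <- Cpowz_RtoC by lra.
    assert (Hz : (RtoC r * cis th)%C <> 0%C) by (apply Cmult_neq_0; auto; apply cis_neq_0).
    transitivity (Ci * ((RtoC r * cis th) * Cpowz (RtoC r * cis th) p))%C; [ring|].
    rewrite <- Cpowz_succ by auto. rewrite Cpowz_mult_l; auto using cis_neq_0. ring. }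
  unfold is_cint.
  eapply is_RInt_ext; [intros th _; symmetry; apply E|].
  destruct (Z.eqb_spec p (-1)) as [->|Hp].
  - change (-1 + 1)%Z with 0%Z. simpl powerRZ.
    replace (1 * (RtoC (2 * PI) * Ci))%C with (@scal R_AbsRing C_R_NormedModule (2 * PI - 0) Ci).
    + eapply is_RInt_ext; [|apply is_RInt_const].
      intros th _. simpl. rewrite Rmult_0_l, cis_0. ring.
    + unfold scal; simpl. unfold prod_scal, scal, RtoC, Cmult; simpl. unfold mult; simpl. f_equal; ring.
  - replace (0 * (RtoC (2 * PI) * Ci))%C with (Ci * RtoC (powerRZ r (p + 1)) * 0)%C by ring.
    apply is_RInt_Cmult_l.
    destruct (is_RInt_cos_Z (p + 1)) as [H1 H2]; [lia|].
    apply (is_RInt_fct_extend_pair (U := R_NormedModule) (V := R_NormedModule)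
      (fun th => cis (IZR (p + 1) * th)) 0 (2 * PI) 0 0).
    + eapply is_RInt_ext; [|apply H1]. intros th _. rewrite cis_pair. reflexivity.
    + eapply is_RInt_ext; [|apply H2]. intros th _. rewrite cis_pair. reflexivity.
Qed.

Definition lev1 (q : list (C * Z)) (z : C) : C := sumC (fun ce => (fst ce * Cpowz z (snd ce))%C) q.
(** The residue at 0 of the Laurent polynomial with terms [q], whose value is [lev1 q]. *)
Definition lres1 (q : list (C * Z)) : C := sumC (fun ce => if Z.eqb (snd ce) (-1) then fst ce else 0%C) q.

Lemma is_cint_zero (r : R) : is_cint r (fun _ => 0%C) 0%C.
Proof.
  unfold is_cint. replace (0 * (RtoC (2 * PI) * Ci))%C with (0 * 0)%C by ring.
  eapply is_RInt_ext; [|apply (is_RInt_Cmult_l (fun _ => 0%C) 0 (2 * PI) 0%C 0%C)].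
  - intros th _. unfold cint_fun. simpl. ring.
  - pose proof (is_RInt_const (V := C_R_NormedModule) 0 (2 * PI) (RtoC 0)) as H.
    refine (eq_ind _ (fun l => is_RInt (V := C_R_NormedModule) _ 0 (2 * PI) l) H _ _).
    unfold scal; simpl. unfold prod_scal, scal, RtoC; simpl. unfold mult; simpl. f_equal; ring.
Qed.

Lemma is_cint_lev1 (r : R) (q : list (C * Z)) : 0 < r -> is_cint r (lev1 q) (lres1 q).
Proof.
  intros Hr. induction q as [|[c p] q IH].
  - apply is_cint_zero.
  - unfold lres1; simpl.
    apply (is_cint_plus r (fun z => (c * Cpowz z p)%C) (lev1 q)); auto.
    replace (if (p =? -1)%Z then c else 0%C) with (c * (if (p =? -1)%Z then 1 else 0))%C
      by (destruct (p =? -1)%Z; ring).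
    apply is_cint_scal, is_cint_Cpowz; auto.
Qed.

(** A uniform limit of integrable functions is integrable. The limit theorem asks for a family
    indexed by a filter, so a sequence of approximants with errors [/ (INR n + 1)] is chosen. *)
Lemma ex_cint_of_approx (r : R) (g : C -> C) : 0 < r ->
  (forall eps, 0 < eps -> exists q, forall z, Cmod z = r -> Cmod (g z - lev1 q z) <= eps) ->
  exists v, is_cint r g v.
Proof.
  intros Hr Ha.
  assert (Hch : forall n : nat, exists q, forall z, Cmod z = r ->
            Cmod (g z - lev1 q z) <= / (INR n + 1)).
  { intros n. apply Ha. apply Rinv_0_lt_compat. generalize (pos_INR n); lra. }
  set (Q := fun n => proj1_sig (constructive_indefinite_description _ (Hch n))).
  assert (HQ : forall n z, Cmod z = r -> Cmod (g z - lev1 (Q n) z) <= / (INR n + 1))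
    by (intros n; exact (proj2_sig (constructive_indefinite_description _ (Hch n)))).
  clearbody Q.
  destruct (filterlim_RInt (V := C_R_CompleteNormedModule)
     (fun n => cint_fun r (lev1 (Q n))) 0 (2 * PI) eventually _ (cint_fun r g)
     (fun n => (lres1 (Q n) * (RtoC (2 * PI) * Ci))%C)) as [If [_ HI]].
  - intros n. apply is_cint_lev1; auto.
  - intros P [eps HP].
    destruct (archimed_cor1 (eps / r)) as [n0 [Hn0 Hn0p]].
    { apply Rdiv_lt_0_compat; auto. apply cond_pos. }
    exists n0. intros n Hn. apply HP. intros th.
    assert (Hm : Cmod (RtoC r * cis th) = r)
      by (rewrite Cmod_mult, Cmod_cis, Cmod_R, Rabs_right; lra).
    assert (Hb : Cmod (cint_fun r (lev1 (Q n)) th - cint_fun r g th) < eps).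
    { unfold cint_fun.
      replace (lev1 (Q n) (RtoC r * cis th) * (Ci * (RtoC r * cis th)) -
        g (RtoC r * cis th) * (Ci * (RtoC r * cis th)))%C
       with ((lev1 (Q n) (RtoC r * cis th) - g (RtoC r * cis th)) * (Ci * (RtoC r * cis th)))%C by ring.
      rewrite Cmod_mult, Cmod_minus_sym, Cmod_mult, Hm, Cmod_Ci, Rmult_1_l.
      assert (H1 : / (INR n + 1) < eps / r).
      { eapply Rle_lt_trans; [|apply Hn0]. apply Rinv_le_contravar.
        - apply lt_0_INR; auto.
        - apply le_INR in Hn. lra. }
      apply Rle_lt_trans with (/ (INR n + 1) * r).
      - apply Rmult_le_compat_r; [lra|]. apply HQ; auto.
      - apply Rmult_lt_reg_r with (/ r); [apply Rinv_0_lt_compat; auto|].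
        unfold Rdiv in H1. rewrite Rmult_assoc, Rinv_r; lra. }
    (* Balls in the product module are products of balls, so the bound on the modulus is passed to
       both components. *)
    pose proof (Rmax_Cmod (cint_fun r (lev1 (Q n)) th - cint_fun r g th)%C) as Hmx.
    pose proof (Rmax_l (Rabs (fst (cint_fun r (lev1 (Q n)) th - cint_fun r g th)%C))
                       (Rabs (snd (cint_fun r (lev1 (Q n)) th - cint_fun r g th)%C))).
    pose proof (Rmax_r (Rabs (fst (cint_fun r (lev1 (Q n)) th - cint_fun r g th)%C))
                       (Rabs (snd (cint_fun r (lev1 (Q n)) th - cint_fun r g th)%C))).
    split.
    + change (Rabs (fst (cint_fun r (lev1 (Q n)) th - cint_fun r g th)%C) < eps). lra.
    + change (Rabs (snd (cint_fun r (lev1 (Q n)) th - cint_fun r g th)%C) < eps). lra.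
  - exists (If / (RtoC (2 * PI) * Ci))%C. unfold is_cint.
    replace (If / (RtoC (2 * PI) * Ci) * (RtoC (2 * PI) * Ci))%C with If; auto.
    generalize two_PI_Ci_neq_0; intros. change C in If.
    unfold Cdiv. rewrite <- Cmult_assoc, Cinv_l, Cmult_1_r; auto.
Qed.

Lemma is_cint_bound (r : R) (g : C -> C) (v : C) (M : R) : 0 < r ->
  (forall z, Cmod z = r -> Cmod (g z) <= M) -> is_cint r g v -> Cmod v <= r * M.
Proof.
  intros Hr HM Hi.
  assert (H : Cmod (v * (RtoC (2 * PI) * Ci)) <= (2 * PI - 0) * (r * M)).
  { rewrite <- (Cnorm_R (v * (RtoC (2 * PI) * Ci))%C).
    apply (norm_RInt_le_const (V := C_R_NormedModule) (cint_fun r g) 0 (2 * PI)).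
    - generalize PI_RGT_0; lra.
    - intros th _. rewrite Cnorm_R. unfold cint_fun.
      assert (Hm : Cmod (RtoC r * cis th) = r)
        by (rewrite Cmod_mult, Cmod_cis, Cmod_R, Rabs_right; lra).
      rewrite Cmod_mult, Cmod_mult, Hm, Cmod_Ci.
      rewrite Rmult_1_l, (Rmult_comm r). apply Rmult_le_compat_r; [lra|auto].
    - exact Hi. }
  rewrite !Cmod_mult, Cmod_R, Cmod_Ci, Rabs_right in H by (generalize PI_RGT_0; lra).
  apply Rmult_le_reg_r with (2 * PI); generalize PI_RGT_0; lra.
Qed.

(** Approximability to every precision only makes the integral exist; the estimate itself concerns
    the one approximant [q]. *)
Lemma circ_int_approx (r : R) (g : C -> C) : 0 < r ->
  (forall eps, 0 < eps -> exists q, forall z, Cmod z = r -> Cmod (g z - lev1 q z) <= eps) ->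
  forall q eps, (forall z, Cmod z = r -> Cmod (g z - lev1 q z) <= eps) ->
  Cmod (circ_int r g - lres1 q) <= r * eps.
Proof.
  intros Hr Ha q eps Hq.
  destruct (ex_cint_of_approx r g Hr Ha) as [v Hv].
  rewrite (is_cint_unique _ _ _ Hv).
  apply (is_cint_bound r (fun z => (g z + (-1) * lev1 q z)%C)); auto.
  - intros z Hz. replace (g z + -1 * lev1 q z)%C with (g z - lev1 q z)%C by ring. auto.
  - replace (v - lres1 q)%C with (v + (-1) * lres1 q)%C by ring.
    apply is_cint_plus; auto. apply is_cint_scal, is_cint_lev1; auto.
Qed.

(** * Uniform limits of Laurent polynomials on the torus *)

Definition torus (r : R) (k : nat) (zs : list C) : Prop :=
  length zs = k /\ Forall (fun z => Cmod z = r) zs.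

Lemma torus_cons (r : R) (k : nat) (z : C) (zs : list C) :
  Cmod z = r -> torus r k zs -> torus r (S k) (z :: zs).
Proof. intros Hz [H1 H2]; split; simpl; auto. Qed.

Lemma torus_nil (r : R) (zs : list C) : torus r 0 zs -> zs = [].
Proof. intros [H _]. destruct zs; simpl in H; congruence. Qed.

Lemma torus_inv (r : R) (k : nat) (zs : list C) : torus r (S k) zs ->
  exists z t, zs = z :: t /\ Cmod z = r /\ torus r k t.
Proof.
  intros [H1 H2]. destruct zs as [|z t]; simpl in H1; [lia|].
  inversion H2; subst. exists z, t. repeat split; auto; lia.
Qed.

Lemma torus_nth (r : R) (k m : nat) (zs : list C) :
  torus r k zs -> (m < k)%nat -> Cmod (nth m zs 0%C) = r.
Proof.
  intros [H1 H2] Hm. rewrite Forall_forall in H2. apply H2, nth_In. lia.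
Qed.

Lemma torus_neq_0 (r : R) (k : nat) (zs : list C) :
  0 < r -> torus r k zs -> Forall (fun z : C => z <> 0%C) zs.
Proof.
  intros Hr [_ H]. eapply Forall_impl; [|apply H]. intros z Hz. apply Cmod_gt_0. simpl in Hz. lra.
Qed.

Lemma torus_sup (r : R) (k : nat) : 0 < r -> exists zs, torus r k zs.
Proof.
  intros Hr. exists (repeat (RtoC r) k). split; [apply repeat_length|].
  apply Forall_forall. intros z Hz. apply repeat_spec in Hz. subst.
  rewrite Cmod_R, Rabs_right; lra.
Qed.

Fixpoint mono (e : nat -> Z) (zs : list C) : C :=
  match zs with
  | [] => 1%C
  | z :: t => (Cpowz z (e 0%nat) * mono (fun n => e (S n)) t)%C
  end.

(** Exponents are functions on all of [nat], of which only the first [k] values matter: dropping a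
    variable or exchanging two of them is then a composition of functions. *)
Definition lpoly : Type := list (C * (nat -> Z)).

Definition lev (p : lpoly) (zs : list C) : C := sumC (fun ce => (fst ce * mono (snd ce) zs)%C) p.

Fixpoint isres (k : nat) (e : nat -> Z) : bool :=
  match k with
  | O => true
  | S k' => (Z.eqb (e 0%nat) (-1) && isres k' (fun n => e (S n)))%bool
  end.

Definition lres (k : nat) (p : lpoly) : C :=
  sumC (fun ce => if isres k (snd ce) then fst ce else 0%C) p.

Lemma lev_cons (ce : C * (nat -> Z)) (p : lpoly) (zs : list C) :
  lev (ce :: p) zs = (fst ce * mono (snd ce) zs + lev p zs)%C.
Proof. reflexivity. Qed.

Lemma lres_cons (k : nat) (ce : C * (nat -> Z)) (p : lpoly) :
  lres k (ce :: p) = ((if isres k (snd ce) then fst ce else 0%C) + lres k p)%C.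
Proof. reflexivity. Qed.

Lemma lev1_cons (ce : C * Z) (p : list (C * Z)) (z : C) :
  lev1 (ce :: p) z = (fst ce * Cpowz z (snd ce) + lev1 p z)%C.
Proof. reflexivity. Qed.

Lemma lres1_cons (ce : C * Z) (p : list (C * Z)) :
  lres1 (ce :: p) = ((if Z.eqb (snd ce) (-1) then fst ce else 0%C) + lres1 p)%C.
Proof. reflexivity. Qed.

(* The weight [W] is additive in the exponents; taking [W e = - e i] bounds the
   growth in one variable, [W e = e i - e j] compares the growth in two. *)
Definition apx (r : R) (k : nat) (W : (nat -> Z) -> Z) (c : Z) (F : list C -> C) : Prop :=
  forall eps, 0 < eps -> exists p : lpoly,
    Forall (fun ce => (c <= W (snd ce))%Z) p /\
    forall zs, torus r k zs -> Cmod (F zs - lev p zs) <= eps.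

Definition lau (r : R) (k : nat) (F : list C -> C) : Prop := apx r k (fun _ => 0%Z) 0 F.

Definition additive (W : (nat -> Z) -> Z) : Prop :=
  W (fun _ => 0%Z) = 0%Z /\
  forall e e', W (fun n => (e n + e' n)%Z) = (W e + W e')%Z.

Lemma additive_zero : additive (fun _ => 0%Z).
Proof. split; auto. Qed.

Lemma apx_lau (r : R) (k : nat) W c F : apx r k W c F -> lau r k F.
Proof.
  intros H eps He. destruct (H eps He) as [p [_ Hp]]. exists p. split; auto.
  apply Forall_forall. intros; lia.
Qed.

Lemma lau_slice (r : R) (k : nat) (F : list C -> C) (z : C) :
  Cmod z = r -> lau r (S k) F -> lau r k (fun zs => F (z :: zs)).
Proof.
  intros Hz H eps He. destruct (H eps He) as [p [_ Hp]].
  exists (map (fun ce => ((fst ce * Cpowz z (snd ce 0%nat))%C, fun n => snd ce (S n))) p).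
  split; [apply Forall_forall; intros; lia|].
  intros zs Hzs.
  replace (lev (map (fun ce => ((fst ce * Cpowz z (snd ce 0%nat))%C, fun n => snd ce (S n))) p) zs)
    with (lev p (z :: zs)).
  - apply Hp, torus_cons; auto.
  - clear. induction p as [|[c e] p IH]; [reflexivity|]. simpl map. rewrite !lev_cons, IH. simpl. ring.
Qed.

(** The basic estimate: the integral differs from the residue of an approximant by at most the
    uniform error times [r ^ k]. Each integration takes the residue in one variable and multiplies
    the error by [r]. *)
Lemma mci_approx (r : R) (k : nat) : 0 < r -> forall F, lau r k F ->
  forall p eps, (forall zs, torus r k zs -> Cmod (F zs - lev p zs) <= eps) ->
  Cmod (multi_circ_int r k F - lres k p) <= r ^ k * eps.
Proof.
  intros Hr. induction k as [|k IH]; intros F HF p eps Hp.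
  - simpl. replace (lres 0 p) with (lev p []).
    + rewrite Rmult_1_l. apply Hp. split; auto.
    + clear. induction p as [|[c e] p IH]; [reflexivity|]. rewrite lev_cons, lres_cons, IH. simpl. ring.
  (* [sl z p] freezes the first variable at [z]; [q1 p] takes the residue in all the others and is a
     Laurent polynomial in the first. By induction [q1 p] approximates the inner integral, uniformly
     in [z]. *)
  - set (sl := fun (z : C) (p : lpoly) =>
      map (fun ce => ((fst ce * Cpowz z (snd ce 0%nat))%C, fun n => snd ce (S n))) p : lpoly).
    set (q1 := fun p : lpoly => map (fun ce : C * (nat -> Z) => (if isres k (fun n => snd ce (S n)) then fst ce else RtoC 0,
                               snd ce 0%nat)) p).
    assert (Hsl : forall p z zs, lev p (z :: zs) = lev (sl z p) zs).
    { clear. intros p z zs. induction p as [|[c e] p IH]; [reflexivity|]. unfold sl in *. simpl map. rewrite !lev_cons, IH. simpl. ring. }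
    assert (Hq : forall p z, lres k (sl z p) = lev1 (q1 p) z).
    { clear. intros p z. induction p as [|[c e] p IH]; [reflexivity|]. unfold sl, q1 in *. simpl map.
      rewrite lres_cons, lev1_cons, IH. simpl. destruct (isres k _); ring. }
    assert (Hr1 : forall p, lres1 (q1 p) = lres (S k) p).
    { clear. intros p. induction p as [|[c e] p IH]; [reflexivity|]. unfold q1 in *. simpl map.
      rewrite lres_cons, lres1_cons, IH. simpl. destruct (e 0%nat =? -1)%Z, (isres k _); simpl; auto. }
    assert (Hmain : forall p eps, (forall zs, torus r (S k) zs -> Cmod (F zs - lev p zs) <= eps) ->
       forall z, Cmod z = r ->
       Cmod (multi_circ_int r k (fun zs => F (z :: zs)) - lev1 (q1 p) z) <= r ^ k * eps).
    { intros p' eps' Hp' z Hz. rewrite <- Hq. apply IH.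
      - apply lau_slice; auto.
      - intros zs Hzs. rewrite <- Hsl. apply Hp', torus_cons; auto. }
    rewrite <- Hr1. simpl multi_circ_int. replace (r ^ S k * eps) with (r * (r ^ k * eps)) by (simpl; ring).
    apply circ_int_approx; auto.
    intros eps' He'. destruct (HF (eps' / r ^ k)) as [p' [_ Hp']].
    { apply Rdiv_lt_0_compat; auto. apply pow_lt; auto. }
    exists (q1 p'). intros z Hz.
    replace eps' with (r ^ k * (eps' / r ^ k)) by (field; apply pow_nonzero; lra).
    apply Hmain; auto.
Qed.

Lemma mci_ext (r : R) (k : nat) : 0 <= r -> forall F G,
  (forall zs, torus r k zs -> F zs = G zs) ->
  multi_circ_int r k F = multi_circ_int r k G.
Proof.
  intros Hr. induction k as [|k IH]; intros F G H; simpl.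
  - apply H. split; auto.
  - apply circ_int_ext; auto. intros z Hz. apply IH. intros zs Hzs. apply H, torus_cons; auto.
Qed.

(** The basic estimate with the zero polynomial as approximant. *)
Lemma mci_bound (r : R) (k : nat) (F : list C -> C) (B : R) : 0 < r -> lau r k F ->
  (forall zs, torus r k zs -> Cmod (F zs) <= B) ->
  Cmod (multi_circ_int r k F) <= r ^ k * B.
Proof.
  intros Hr HF HB. replace (multi_circ_int r k F) with (multi_circ_int r k F - lres k [])%C
    by (unfold lres; simpl; ring).
  apply mci_approx; auto. intros zs Hzs. unfold lev; simpl.
  replace (F zs - 0)%C with (F zs) by ring. auto.
Qed.

Lemma lev_app (p q : lpoly) (zs : list C) : lev (p ++ q) zs = (lev p zs + lev q zs)%C.
Proof.
  induction p as [|a p IH]; [unfold lev; simpl; ring|].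
  simpl app. rewrite !lev_cons, IH; ring.
Qed.

Lemma lres_app (k : nat) (p q : lpoly) : lres k (p ++ q) = (lres k p + lres k q)%C.
Proof.
  induction p as [|a p IH]; [unfold lres; simpl; ring|].
  simpl app. rewrite !lres_cons, IH; ring.
Qed.

Definition lscal (c : C) (p : lpoly) : lpoly := map (fun ce => ((c * fst ce)%C, snd ce)) p.

Lemma lev_scal (c : C) (p : lpoly) (zs : list C) : lev (lscal c p) zs = (c * lev p zs)%C.
Proof.
  induction p as [|a p IH]; [unfold lev; simpl; ring|].
  simpl lscal. rewrite !lev_cons, IH; simpl; ring.
Qed.

Lemma lres_scal (k : nat) (c : C) (p : lpoly) : lres k (lscal c p) = (c * lres k p)%C.
Proof.
  induction p as [|a p IH]; [unfold lres; simpl; ring|].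
  simpl lscal. rewrite !lres_cons, IH; simpl. destruct (isres k _); ring.
Qed.

(** * Closure of the approximable functions under ring operations, uniform limits and geometric
    series *)

Section Closure.

Context (r : R) (Hr : 0 < r) (k : nat) (W : (nat -> Z) -> Z) (HW : additive W).

Lemma apx_ext (c : Z) (F G : list C -> C) :
  (forall zs, torus r k zs -> F zs = G zs) -> apx r k W c F -> apx r k W c G.
Proof.
  intros He H eps Heps. destruct (H eps Heps) as [p [H1 H2]]. exists p; split; auto.
  intros zs Hzs. rewrite <- He; auto.
Qed.

Lemma apx_weaken (c c' : Z) (F : list C -> C) : (c' <= c)%Z -> apx r k W c F -> apx r k W c' F.
Proof.
  intros Hc H eps Heps. destruct (H eps Heps) as [p [H1 H2]]. exists p; split; auto.
  eapply Forall_impl; [|apply H1]. simpl; intros; lia.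
Qed.

Lemma apx_plus (c : Z) (F G : list C -> C) :
  apx r k W c F -> apx r k W c G -> apx r k W c (fun zs => (F zs + G zs)%C).
Proof.
  intros HF HG eps Heps.
  destruct (HF (eps / 2)) as [p [H1 H2]]; [lra|].
  destruct (HG (eps / 2)) as [q [H3 H4]]; [lra|].
  exists (p ++ q). split; [apply Forall_app; auto|].
  intros zs Hzs. rewrite lev_app.
  replace (F zs + G zs - (lev p zs + lev q zs))%C with ((F zs - lev p zs) + (G zs - lev q zs))%C by ring.
  eapply Rle_trans; [apply Cmod_triangle|]. specialize (H2 zs Hzs). specialize (H4 zs Hzs). lra.
Qed.

Lemma apx_const (a : C) : apx r k W 0 (fun _ => a).
Proof.
  intros eps Heps. exists [(a, fun _ => 0%Z)]. split.
  - constructor; auto. simpl. destruct HW as [-> _]. lia.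
  - intros zs _. unfold lev; simpl.
    assert (E : forall l, mono (fun _ => 0%Z) l = 1%C) by (induction l as [|z l IH]; simpl; [auto|rewrite IH; ring]).
    rewrite E. replace (a - (a * 1 + 0))%C with (RtoC 0) by ring. rewrite Cmod_0. lra.
Qed.

Lemma apx_coord (m : nat) (p : Z) : (m < k)%nat ->
  apx r k W (W (fun n => if Nat.eqb n m then p else 0%Z)) (fun zs => Cpowz (nth m zs 0%C) p).
Proof.
  intros Hm eps Heps. exists [(RtoC 1, fun n => if Nat.eqb n m then p else 0%Z)]. split.
  - constructor; auto. simpl. lia.
  - intros zs [Hl _]. unfold lev; simpl.
    assert (E : mono (fun n => if Nat.eqb n m then p else 0%Z) zs = Cpowz (nth m zs 0%C) p).
    { assert (E0 : forall l, mono (fun _ => 0%Z) l = 1%C) by (induction l as [|z l IH]; simpl; [auto|rewrite IH; ring]).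
      rewrite <- Hl in Hm. clear Hl Heps. revert m Hm. induction zs as [|z t IH]; simpl; intros m Hm; [lia|].
      destruct m as [|m]; simpl.
      - rewrite E0. ring.
      - rewrite IH by lia. ring. }
    rewrite E. replace (Cpowz (nth m zs 0%C) p - (1 * Cpowz (nth m zs 0%C) p + 0))%C with (RtoC 0) by ring. rewrite Cmod_0. lra.
Qed.

Lemma mono_plus (e e' : nat -> Z) (zs : list C) : Forall (fun z : C => z <> 0%C) zs ->
  mono (fun n => (e n + e' n)%Z) zs = (mono e zs * mono e' zs)%C.
Proof.
  intros H. revert e e'. induction H as [|z t Hz _ IH]; intros e e'; simpl; [ring|].
  rewrite Cpowz_add, (IH (fun n => e (S n)) (fun n => e' (S n))) by auto. ring.
Qed.

Lemma lev_bounded (p : lpoly) : exists B, 0 <= B /\ forall zs, torus r k zs -> Cmod (lev p zs) <= B.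
Proof.
  assert (Hm : forall k' e, exists B, 0 <= B /\ forall zs, torus r k' zs -> Cmod (mono e zs) <= B).
  { clear - Hr. induction k' as [|k' IH]; intros e.
    - exists 1. split; [lra|]. intros zs Hz. apply torus_nil in Hz. subst. simpl. rewrite Cmod_1; lra.
    - destruct (IH (fun n => e (S n))) as [B [HB0 HB]].
      exists (powerRZ r (e 0%nat) * B). assert (0 < powerRZ r (e 0%nat)) by (apply powerRZ_lt; auto).
      split; [apply Rmult_le_pos; lra|].
      intros zs Hz. apply torus_inv in Hz. destruct Hz as [z [t [-> [Hz Ht]]]]. simpl.
      rewrite Cmod_mult, Cmod_Cpowz by (apply Cmod_gt_0; lra). rewrite Hz.
      apply Rmult_le_compat_l; [lra|auto]. }
  induction p as [|[c e] p IH].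
  - exists 0. split; [lra|]. intros zs _. unfold lev; simpl. rewrite Cmod_0; lra.
  - destruct IH as [B [HB0 HB]]. destruct (Hm k e) as [B' [HB0' HB']].
    exists (Cmod c * B' + B). pose proof (Cmod_ge_0 c).
    split; [apply Rplus_le_le_0_compat; auto; apply Rmult_le_pos; auto|].
    intros zs Hz. unfold lev; simpl. eapply Rle_trans; [apply Cmod_triangle|].
    apply Rplus_le_compat; [|apply HB; auto].
    rewrite Cmod_mult. apply Rmult_le_compat_l; auto.
Qed.

Lemma apx_bounded (c : Z) (F : list C -> C) : apx r k W c F ->
  exists B, 0 <= B /\ forall zs, torus r k zs -> Cmod (F zs) <= B.
Proof.
  intros H. destruct (H 1) as [p [_ Hp]]; [lra|]. destruct (lev_bounded p) as [B [HB0 HB]].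
  exists (1 + B). split; [lra|]. intros zs Hz.
  replace (F zs) with ((F zs - lev p zs) + lev p zs)%C by ring.
  eapply Rle_trans; [apply Cmod_triangle|]. apply Rplus_le_compat; auto.
Qed.

Lemma apx_mult (c c' : Z) (F G : list C -> C) :
  apx r k W c F -> apx r k W c' G -> apx r k W (c + c') (fun zs => (F zs * G zs)%C).
Proof.
  intros HF HG eps Heps.
  destruct (apx_bounded _ _ HF) as [BF [HBF0 HBF]].
  destruct (apx_bounded _ _ HG) as [BG [HBG0 HBG]].
  destruct (HF (eps / (2 * (BG + 1)))) as [p [H1 H2]]; [apply Rdiv_lt_0_compat; lra|].
  assert (Hd : 0 < eps / (2 * (BF + 1))) by (apply Rdiv_lt_0_compat; lra).
  (* The minimum with 1 keeps [lev q] below [BG + 1], the bound already used in the precision asked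
     of [p]. *)
  destruct (HG (Rmin 1 (eps / (2 * (BF + 1))))) as [q [H3 H4]]; [apply Rmin_pos; lra|].
  exists (flat_map (fun a => map (fun d => ((fst a * fst d)%C, fun n => (snd a n + snd d n)%Z)) q) p).
  split.
  - apply Forall_flat_map. eapply Forall_impl; [|apply H1]. intros a Ha.
    apply Forall_map. eapply Forall_impl; [|apply H3]. intros d Hd'. simpl in *.
    destruct HW as [_ HW']. rewrite HW'. lia.
  - intros zs Hzs.
    replace (lev (flat_map (fun a => map (fun d => ((fst a * fst d)%C, fun n => (snd a n + snd d n)%Z)) q) p) zs)
      with (lev p zs * lev q zs)%C.
    2:{ pose proof (torus_neq_0 r k zs Hr Hzs) as Hnz. clear - Hnz.
        induction p as [|[a e] p IH]; [unfold lev; simpl; ring|].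
        simpl flat_map. rewrite lev_app, <- IH, lev_cons.
        rewrite Cmult_plus_distr_r. f_equal. clear IH.
        induction q as [|[d e'] q IH]; [unfold lev; simpl; ring|].
        simpl map. rewrite !lev_cons, <- IH. simpl. rewrite mono_plus by auto. ring. }
    replace (F zs * G zs - lev p zs * lev q zs)%C
      with (F zs * (G zs - lev q zs) + lev q zs * (F zs - lev p zs))%C by ring.
    eapply Rle_trans; [apply Cmod_triangle|]. rewrite !Cmod_mult.
    specialize (H2 zs Hzs). specialize (H4 zs Hzs).
    pose proof (Rmin_l 1 (eps / (2 * (BF + 1)))). pose proof (Rmin_r 1 (eps / (2 * (BF + 1)))).
    assert (Hq : Cmod (lev q zs) <= BG + 1).
    { replace (lev q zs) with (G zs + - (G zs - lev q zs))%C by ring.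
      eapply Rle_trans; [apply Cmod_triangle|]. rewrite Cmod_opp.
      specialize (HBG zs Hzs). lra. }
    assert (A1 : Cmod (F zs) * Cmod (G zs - lev q zs) <= (BF + 1) * (eps / (2 * (BF + 1)))).
    { apply Rmult_le_compat; try apply Cmod_ge_0; [specialize (HBF zs Hzs)|]; lra. }
    assert (A2 : Cmod (lev q zs) * Cmod (F zs - lev p zs) <= (BG + 1) * (eps / (2 * (BG + 1)))).
    { apply Rmult_le_compat; try apply Cmod_ge_0; auto. }
    replace ((BF + 1) * (eps / (2 * (BF + 1)))) with (eps / 2) in A1 by (field; lra).
    replace ((BG + 1) * (eps / (2 * (BG + 1)))) with (eps / 2) in A2 by (field; lra). lra.
Qed.

Lemma apx_lim (c : Z) (F : list C -> C) :
  (forall eps, 0 < eps -> exists G, apx r k W c G /\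
     forall zs, torus r k zs -> Cmod (F zs - G zs) <= eps) -> apx r k W c F.
Proof.
  intros H eps Heps. destruct (H (eps / 2)) as [G [HG HFG]]; [lra|].
  destruct (HG (eps / 2)) as [p [H1 H2]]; [lra|]. exists p; split; auto.
  intros zs Hzs. eapply Rle_trans; [apply (Cmod_minus_triangle _ (G zs))|].
  specialize (HFG zs Hzs). specialize (H2 zs Hzs). lra.
Qed.

Lemma apx_scal (c : Z) (a : C) (F : list C -> C) :
  apx r k W c F -> apx r k W c (fun zs => (a * F zs)%C).
Proof. intros H. apply (apx_mult 0 c (fun _ => a)); auto. apply apx_const. Qed.

Lemma apx_minus (c : Z) (F G : list C -> C) :
  apx r k W c F -> apx r k W c G -> apx r k W c (fun zs => (F zs - G zs)%C).
Proof.
  intros HF HG. apply (apx_ext c (fun zs => (F zs + (-1) * G zs)%C)); [intros; ring|].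
  apply apx_plus; auto. apply apx_scal; auto.
Qed.

Lemma apx_pow (n : nat) (F : list C -> C) : apx r k W 0 F -> apx r k W 0 (fun zs => Cpow (F zs) n).
Proof.
  intros H. induction n as [|n IH]; simpl; [apply apx_const|].
  apply (apx_mult 0 0); auto.
Qed.

Lemma Cgeom (s : C) (n : nat) :
  ((1 - s) * sumC (fun j => Cpow s j) (seq 0 n) = 1 - Cpow s n)%C.
Proof.
  assert (E : forall (f : nat -> C) m i, sumC f (seq i (S m)) = (sumC f (seq i m) + f (i + m)%nat)%C).
  { intros f m; induction m as [|m IH]; intros i.
    - simpl. rewrite Nat.add_0_r. ring.
    - change (seq i (S (S m))) with (i :: seq (S i) (S m)). simpl sumC at 1.
      change (seq i (S m)) with (i :: seq (S i) m). simpl sumC at 2.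
      pose proof (IH (S i)) as E. simpl sumC in E |- *. rewrite E.
      replace (S i + m)%nat with (i + S m)%nat by lia. ring. }
  induction n as [|n IH]; [simpl; ring|].
  rewrite E. simpl. rewrite Cmult_plus_distr_l, IH. ring.
Qed.

Lemma apx_sumC {A : Type} (c : Z) (F : A -> list C -> C) (l : list A) :
  (c <= 0)%Z -> (forall a, In a l -> apx r k W c (F a)) -> apx r k W c (fun zs => sumC (fun a => F a zs) l).
Proof.
  intros Hc. induction l as [|a l IH]; intros H; simpl.
  - apply (apx_weaken 0); auto. apply apx_const.
  - apply apx_plus; [apply H; left; auto|]. apply IH. intros; apply H; right; auto.
Qed.

(** The partial sums of the geometric series converge uniformly, with error at most
    [th ^ n / (1 - th)]. The weight bound has to be 0: powers of [s] then keep it, whereas a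
    negative bound would deteriorate with the power. *)
Lemma apx_geom (s : list C -> C) (th : R) : th < 1 ->
  (forall zs, torus r k zs -> Cmod (s zs) <= th) ->
  apx r k W 0 s -> apx r k W 0 (fun zs => / (1 - s zs))%C.
Proof.
  intros Hth Hs Ha. apply apx_lim. intros eps Heps.
  assert (Hth0 : 0 <= th).
  { destruct (torus_sup r k Hr) as [zs Hz]. eapply Rle_trans; [apply Cmod_ge_0|apply (Hs zs Hz)]. }
  assert (He : 0 < eps * (1 - th)) by (apply Rmult_lt_0_compat; lra).
  destruct (pow_lt_1_zero th) with (y := eps * (1 - th)) as [n Hn]; auto.
  { rewrite Rabs_right; lra. }
  specialize (Hn n (Nat.le_refl n)).
  exists (fun zs => sumC (fun j => Cpow (s zs) j) (seq 0 n)). split.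
  - apply (apx_sumC 0 (fun j zs => Cpow (s zs) j)); [lia|]. intros; apply apx_pow; auto.
  - intros zs Hz. specialize (Hs zs Hz).
    assert (H1 : 1 - th <= Cmod (1 - s zs)).
    { pose proof (Cmod_triangle (1 - s zs) (s zs)) as H1.
      replace (1 - s zs + s zs)%C with (RtoC 1) in H1 by ring. rewrite Cmod_1 in H1. lra. }
    assert (Hnz : (1 - s zs)%C <> 0%C) by (apply Cmod_gt_0; lra).
    replace (/ (1 - s zs) - sumC (fun j => Cpow (s zs) j) (seq 0 n))%C
      with (Cpow (s zs) n / (1 - s zs))%C.
    2:{ set (S := sumC (fun j => Cpow (s zs) j) (seq 0 n)).
        assert (HS : ((1 - s zs) * S = 1 - Cpow (s zs) n)%C) by apply Cgeom.
        replace (Cpow (s zs) n) with (1 - (1 - s zs) * S)%C by (rewrite HS; ring).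
        field; auto. }
    rewrite Cmod_div, Cmod_pow by auto.
    apply Rmult_le_reg_r with (Cmod (1 - s zs)); [lra|].
    unfold Rdiv. rewrite Rmult_assoc, Rinv_l, Rmult_1_r by lra.
    apply Rle_trans with (th ^ n).
    + apply pow_incr. split; auto. apply Cmod_ge_0.
    + rewrite Rabs_right in Hn by (apply Rle_ge, pow_le; auto).
      apply Rle_trans with (eps * (1 - th)); [lra|]. apply Rmult_le_compat_l; lra.
Qed.

Lemma apx_prodC {A : Type} (F : A -> list C -> C) (w : A -> Z) (l : list A) :
  (forall a, In a l -> apx r k W (w a) (F a)) ->
  apx r k W (fold_right (fun a s => (w a + s)%Z) 0%Z l) (fun zs => prodC (fun a => F a zs) l).
Proof.
  induction l as [|a l IH]; intros H; simpl.
  - apply apx_const.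
  - apply apx_mult; [apply H; left; auto|]. apply IH. intros; apply H; right; auto.
Qed.

(** Substitute for moving a contour to infinity: only the monomial with all exponents [-1]
    contributes to the integral, and its weight is below that of every monomial in the
    approximants. *)
Lemma mci_vanish (c : Z) (F : list C -> C) :
  apx r k W c F -> (forall e, isres k e = true -> (W e < c)%Z) -> multi_circ_int r k F = 0%C.
Proof.
  intros H Hc. apply (Ceq_of_arbitrarily_close _ _ (r ^ k)). intros eps Heps.
  destruct (H eps Heps) as [p [H1 H2]].
  replace (RtoC 0) with (lres k p); [apply mci_approx; auto; apply (apx_lau _ _ _ _ _ H)|].
  clear H2. induction H1 as [|[a e] p Ha _ IH]; [reflexivity|].
  rewrite lres_cons, IH. simpl in Ha |- *. destruct (isres k e) eqn:E; [|ring]. apply Hc in E. lia.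
Qed.

End Closure.

(** * Linearity of the iterated integral *)

Section Linearity.

Context (r : R) (Hr : 0 < r) (k : nat).

(** Read off from the additivity of residues of approximants, which spares an integrability argument
    at each level. The factor 4 collects the errors of both summands and twice that error for the
    sum. *)
Lemma mci_plus (F G : list C -> C) : lau r k F -> lau r k G ->
  multi_circ_int r k (fun zs => (F zs + G zs)%C) = (multi_circ_int r k F + multi_circ_int r k G)%C.
Proof.
  intros HF HG. apply (Ceq_of_arbitrarily_close _ _ (r ^ k * 4)). intros eps Heps.
  destruct (HF eps Heps) as [p [_ Hp]]. destruct (HG eps Heps) as [q [_ Hq]].
  pose proof (mci_approx r k Hr _ HF p eps Hp) as E1.
  pose proof (mci_approx r k Hr _ HG q eps Hq) as E2.
  assert (E3 : Cmod (multi_circ_int r k (fun zs => (F zs + G zs)%C) - lres k (p ++ q)) <= r ^ k * (2 * eps)).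
  { apply mci_approx; auto.
    - apply apx_plus; auto.
    - intros zs Hz. rewrite lev_app.
      replace (F zs + G zs - (lev p zs + lev q zs))%C with ((F zs - lev p zs) + (G zs - lev q zs))%C by ring.
      eapply Rle_trans; [apply Cmod_triangle|]. specialize (Hp zs Hz). specialize (Hq zs Hz). lra. }
  rewrite lres_app in E3.
  set (a := multi_circ_int r k F) in *. set (d := multi_circ_int r k G) in *.
  set (m := multi_circ_int r k (fun zs => (F zs + G zs)%C)) in *.
  replace (m - (a + d))%C with ((m - (lres k p + lres k q)) + (- (a - lres k p) + - (d - lres k q)))%C by ring.
  eapply Rle_trans; [apply Cmod_triangle|]. eapply Rle_trans; [apply Rplus_le_compat_l, Cmod_triangle|].
  rewrite !Cmod_opp. lra.
Qed.

Lemma mci_scal (a : C) (F : list C -> C) : lau r k F ->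
  multi_circ_int r k (fun zs => (a * F zs)%C) = (a * multi_circ_int r k F)%C.
Proof.
  intros HF. apply (Ceq_of_arbitrarily_close _ _ (2 * (r ^ k * Cmod a))). intros eps Heps.
  destruct (HF eps Heps) as [p [_ Hp]].
  pose proof (mci_approx r k Hr _ HF p eps Hp) as E1.
  assert (E3 : Cmod (multi_circ_int r k (fun zs => (a * F zs)%C) - lres k (lscal a p)) <= r ^ k * (Cmod a * eps)).
  { apply mci_approx; auto.
    - apply apx_scal; auto. apply additive_zero.
    - intros zs Hz. rewrite lev_scal.
      replace (a * F zs - a * lev p zs)%C with (a * (F zs - lev p zs))%C by ring.
      rewrite Cmod_mult. apply Rmult_le_compat_l; auto. apply Cmod_ge_0. }
  rewrite lres_scal in E3.
  set (u := multi_circ_int r k F) in *.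
  set (m := multi_circ_int r k (fun zs => (a * F zs)%C)) in *.
  replace (m - a * u)%C with ((m - a * lres k p) + - (a * (u - lres k p)))%C by ring.
  eapply Rle_trans; [apply Cmod_triangle|]. rewrite Cmod_opp, Cmod_mult.
  pose proof (Rmult_le_compat_l (Cmod a) _ _ (Cmod_ge_0 a) E1). lra.
Qed.

Lemma mci_minus (F G : list C -> C) : lau r k F -> lau r k G ->
  multi_circ_int r k (fun zs => (F zs - G zs)%C) = (multi_circ_int r k F - multi_circ_int r k G)%C.
Proof.
  intros HF HG.
  rewrite (mci_ext r k (Rlt_le _ _ Hr) _ (fun zs => (F zs + (-1) * G zs)%C)) by (intros; ring).
  rewrite mci_plus, mci_scal; auto; [ring|]. apply apx_scal; auto. apply additive_zero.
Qed.

Lemma mci_zero : multi_circ_int r k (fun _ => 0%C) = 0%C.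
Proof.
  rewrite (mci_ext r k (Rlt_le _ _ Hr) _ (fun zs => (0 * 0)%C)) by (intros; ring).
  rewrite (mci_scal 0 (fun _ => 0%C)); [ring|]. apply apx_const. apply additive_zero.
Qed.

Lemma mci_sumC {A : Type} (F : A -> list C -> C) (l : list A) :
  (forall a, In a l -> lau r k (F a)) ->
  multi_circ_int r k (fun zs => sumC (fun a => F a zs) l) = sumC (fun a => multi_circ_int r k (F a)) l.
Proof.
  induction l as [|a l IH]; intros H; simpl.
  - apply mci_zero.
  - rewrite <- IH by (intros; apply H; right; auto). apply mci_plus.
    + apply H; left; auto.
    + apply apx_sumC; auto; try lia. apply additive_zero. intros; apply H; right; auto.
Qed.

End Linearity.

(** * Exchange of two neighbouring variables *)

Fixpoint swap_nth {A : Type} (i : nat) (zs : list A) : list A :=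
  match i, zs with
  | O, u :: v :: t => v :: u :: t
  | S i', u :: t => u :: swap_nth i' t
  | _, _ => zs
  end.

Fixpoint swap_index (i n : nat) : nat :=
  match i, n with
  | O, O => 1
  | O, S O => 0
  | S i', S n' => S (swap_index i' n')
  | _, _ => n
  end.

Lemma isres_spec (k : nat) (e : nat -> Z) (i : nat) : isres k e = true -> (i < k)%nat -> e i = (-1)%Z.
Proof.
  revert e i. induction k as [|k IH]; intros e i H Hi; [lia|]. simpl in H.
  apply andb_prop in H. destruct H as [H1 H2]. destruct i as [|i].
  - apply Z.eqb_eq; auto.
  - apply (IH (fun n => e (S n))); auto. lia.
Qed.

Lemma mono_swap_nth (i : nat) (e : nat -> Z) (zs : list C) : (S i < length zs)%nat ->
  mono e (swap_nth i zs) = mono (fun n => e (swap_index i n)) zs.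
Proof.
  revert e zs. induction i as [|i IH]; intros e zs H.
  - destruct zs as [|u [|v t]]; simpl in H; try lia. simpl. ring_simplify.
    f_equal.
  - destruct zs as [|u t]; simpl in H; try lia. simpl. rewrite IH by lia. reflexivity.
Qed.

Lemma isres_swap_nth (i k : nat) (e : nat -> Z) : (S i < k)%nat ->
  isres k (fun n => e (swap_index i n)) = isres k e.
Proof.
  revert e k. induction i as [|i IH]; intros e k H.
  - destruct k as [|[|k]]; try lia. simpl.
    rewrite !Bool.andb_assoc. f_equal. apply Bool.andb_comm.
  - destruct k as [|k]; try lia. simpl. f_equal. apply (IH (fun n => e (S n))). lia.
Qed.

Lemma torus_swap_nth (r : R) (k i : nat) (zs : list C) : torus r k zs -> torus r k (swap_nth i zs).
Proof.
  revert k zs. induction i as [|i IH]; intros k zs H.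
  - destruct zs as [|u [|v t]]; auto. destruct H as [H1 H2]. inversion H2; subst. inversion H4; subst.
    split; simpl in *; auto.
  - destruct zs as [|u t]; auto. simpl. destruct k as [|k]; [destruct H; discriminate|].
    apply torus_inv in H. destruct H as [z [t' [E [Hz Ht]]]]. injection E; intros; subst.
    apply torus_cons; auto.
Qed.

(** Takes the place of Fubini: the condition that all exponents equal [-1] is symmetric in the
    variables, and this passes to uniform limits. *)
Lemma mci_swap (r : R) (k i : nat) (F : list C -> C) : 0 < r -> (S i < k)%nat -> lau r k F ->
  multi_circ_int r k (fun zs => F (swap_nth i zs)) = multi_circ_int r k F.
Proof.
  intros Hr Hi HF. apply (Ceq_of_arbitrarily_close _ _ (r ^ k * 2)). intros eps Heps.
  assert (Hsw : forall p eps, (forall zs, torus r k zs -> Cmod (F zs - lev p zs) <= eps) ->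
     forall zs, torus r k zs -> Cmod (F (swap_nth i zs) - lev (map (fun ce => (fst ce, fun n => snd ce (swap_index i n))) p) zs) <= eps).
  { intros p eps' Hp zs Hz.
    replace (lev (map (fun ce => (fst ce, fun n => snd ce (swap_index i n))) p) zs) with (lev p (swap_nth i zs)).
    - apply Hp, torus_swap_nth; auto.
    - assert (Hl : (S i < length zs)%nat) by (destruct Hz; lia). clear - Hl.
      induction p as [|[a e] p IH]; [reflexivity|]. simpl map. rewrite !lev_cons, IH. simpl. rewrite mono_swap_nth; auto. }
  destruct (HF eps Heps) as [p [_ Hp]].
  pose proof (mci_approx r k Hr _ HF p eps Hp) as E1.
  assert (E2 : Cmod (multi_circ_int r k (fun zs => F (swap_nth i zs)) -
     lres k (map (fun ce => (fst ce, fun n => snd ce (swap_index i n))) p)) <= r ^ k * eps).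
  { apply mci_approx; auto. intros eps' He'. destruct (HF eps' He') as [p' [_ Hp']].
    eexists. split; [|apply Hsw; exact Hp']. apply Forall_forall; intros; lia. }
  replace (lres k (map (fun ce => (fst ce, fun n => snd ce (swap_index i n))) p)) with (lres k p) in E2.
  - eapply Rle_trans; [apply (Cmod_minus_triangle _ (lres k p))|].
    rewrite (Cmod_minus_sym (lres k p)). lra.
  - clear - Hi. induction p as [|[a e] p IH]; [reflexivity|]. simpl map. rewrite !lres_cons, IH. simpl. rewrite isres_swap_nth; auto.
Qed.

(** * Partial fractions in the first variable *)

(** This is [b] times the denominator of the pair factor in the theorem. Clearing [/ b] leaves
    coefficients bounded by 2, so that one radius serves all [b]. *)
Definition den (b : R) (u v : C) : C := (u * v - (1 + b) * u + b)%C.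

Fixpoint vandermonde (l : list C) : C :=
  match l with
  | [] => 1%C
  | u :: l' => (prodC (fun v => (v - u)%C) l' * vandermonde l')%C
  end.

Fixpoint inv_dens (b : R) (l : list C) : C :=
  match l with
  | [] => 1%C
  | u :: l' => (prodC (fun v => (/ den b u v)%C) l' * inv_dens b l')%C
  end.

Fixpoint pairs_AD (b : R) (l : list C) : C :=
  match l with
  | [] => 1%C
  | u :: l' => (prodC (fun v => ((v - u) / den b u v)%C) l' * pairs_AD b l')%C
  end.

Fixpoint remove_nth {A : Type} (i : nat) (l : list A) : list A :=
  match i, l with
  | _, [] => []
  | O, _ :: t => t
  | S i', u :: t => u :: remove_nth i' t
  end.

Lemma sumC_ext {A : Type} (f g : A -> C) (l : list A) :
  (forall a, In a l -> f a = g a) -> sumC f l = sumC g l.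
Proof.
  induction l as [|a l IH]; intros H; simpl; auto.
  rewrite H by (left; auto). f_equal. apply IH. intros; apply H; right; auto.
Qed.

Lemma prodC_ext {A : Type} (f g : A -> C) (l : list A) :
  (forall a, In a l -> f a = g a) -> prodC f l = prodC g l.
Proof.
  induction l as [|a l IH]; intros H; simpl; auto.
  rewrite H by (left; auto). f_equal. apply IH. intros; apply H; right; auto.
Qed.

Lemma sumC_map {A B : Type} (g : A -> B) (f : B -> C) (l : list A) :
  sumC f (map g l) = sumC (fun a => f (g a)) l.
Proof. induction l as [|a l IH]; simpl; auto. unfold sumC in *; simpl. rewrite IH; auto. Qed.

Lemma prodC_map {A B : Type} (g : A -> B) (f : B -> C) (l : list A) :
  prodC f (map g l) = prodC (fun a => f (g a)) l.
Proof. induction l as [|a l IH]; simpl; auto. unfold prodC in *; simpl. rewrite IH; auto. Qed.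

Lemma sumC_mult_l {A : Type} (c : C) (f : A -> C) (l : list A) :
  sumC (fun a => (c * f a)%C) l = (c * sumC f l)%C.
Proof. induction l as [|a l IH]; simpl; [ring|]. rewrite IH; ring. Qed.

Lemma sumC_plus {A : Type} (f g : A -> C) (l : list A) :
  sumC (fun a => (f a + g a)%C) l = (sumC f l + sumC g l)%C.
Proof. induction l as [|a l IH]; simpl; [ring|]. rewrite IH; ring. Qed.

Lemma prodC_mult {A : Type} (f g : A -> C) (l : list A) :
  prodC (fun a => (f a * g a)%C) l = (prodC f l * prodC g l)%C.
Proof. induction l as [|a l IH]; simpl; [ring|]. rewrite IH; ring. Qed.

Lemma prodC_neq_0 {A : Type} (f : A -> C) (l : list A) :
  (forall a, In a l -> f a <> 0%C) -> prodC f l <> 0%C.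
Proof.
  induction l as [|a l IH]; intros H; simpl; [apply C1_nz|].
  apply Cmult_neq_0; [apply H; left; auto|]. apply IH. intros; apply H; right; auto.
Qed.

Lemma sumC_seq_S (f : nat -> C) (n : nat) :
  sumC f (seq 0 (S n)) = (f 0%nat + sumC (fun i => f (S i)) (seq 0 n))%C.
Proof. simpl. rewrite <- seq_shift, sumC_map. reflexivity. Qed.

Lemma prodC_remove_nth (f : C -> C) (i : nat) (l : list C) : (i < length l)%nat ->
  prodC f l = (f (nth i l 0%C) * prodC f (remove_nth i l))%C.
Proof.
  revert i. induction l as [|u l IH]; intros i Hi; simpl in Hi; [lia|].
  destruct i as [|i]; simpl; [reflexivity|]. rewrite (IH i) by lia. ring.
Qed.

(* Expansion of a Vandermonde determinant along a row, in a form free of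
   denominators, so that coinciding nodes need no separate treatment. *)
Lemma vandermonde_expansion (alpha beta : C) (l : list C) : l <> [] ->
  sumC (fun i => ((-1) ^ i * (vandermonde (remove_nth i l) * prodC (fun v => (alpha * v + beta)%C) (remove_nth i l)))%C)
    (seq 0 (length l)) = (alpha ^ (length l - 1) * vandermonde l)%C.
Proof.
  revert alpha beta. induction l as [|x l IH]; intros alpha beta Hl; [congruence|].
  assert (Hc : l = [] \/ l <> []) by (destruct l; [left|right]; congruence).
    destruct Hc as [->|Hl'].
  - simpl. ring.
  - simpl length. rewrite sumC_seq_S.
    set (d := fun v => (alpha * v + beta)%C).
    set (P := prodC d l). set (Q := prodC (fun v => (v - x)%C) l).
    (* At the removed node [v] one has [d x = d v - alpha * (v - x)]. The first part restores the
       full product [P] and leaves an expansion with [alpha = 1], [beta = - x]; the second restores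
       [Q] and leaves the original expansion. *)
    assert (E : sumC (fun i => ((-1) ^ S i * (vandermonde (remove_nth (S i) (x :: l)) * prodC d (remove_nth (S i) (x :: l))))%C)
                 (seq 0 (length l)) =
      sumC (fun i => ((- P) * ((-1) ^ i * (vandermonde (remove_nth i l) * prodC (fun v => (1 * v + - x)%C) (remove_nth i l)))
        + (alpha * Q) * ((-1) ^ i * (vandermonde (remove_nth i l) * prodC d (remove_nth i l))))%C) (seq 0 (length l))).
    { apply sumC_ext. intros i Hi. apply in_seq in Hi.
      unfold P, Q. rewrite (prodC_remove_nth d i l), (prodC_remove_nth (fun v => (v - x)%C) i l) by lia.
      rewrite (prodC_ext (fun v => (1 * v + - x)%C) (fun v => (v - x)%C)) by (intros; ring).
      simpl. unfold d. ring. }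
    rewrite E, sumC_plus, !sumC_mult_l.
    pose proof (IH 1%C (- x)%C Hl') as I1. pose proof (IH alpha beta Hl') as I2.
    fold d in I2. rewrite I1, I2. simpl. fold P Q.
    assert (E1 : forall n, (1 ^ n)%C = 1%C) by apply Cpow_1_l. rewrite E1.
    destruct l as [|y l]; [congruence|].
    replace (length (y :: l) - 0)%nat with (S (length (y :: l) - 1)) by (simpl; lia).
    rewrite Cpow_S. ring.
Qed.

(** At [z = 1] every factor [(u - z) / den b z u] equals 1, so the product minus 1 is divisible by
    [z - 1]; this is the quotient over the common denominator. *)
Fixpoint numerator (b : R) (z : C) (l : list C) : C :=
  match l with
  | [] => 0%C
  | u :: l' => ((u - z) * numerator b z l' - (u - b) * prodC (den b z) l')%C
  end.

Lemma numerator_spec (b : R) (z : C) (l : list C) : (forall u, In u l -> den b z u <> 0%C) ->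
  prodC (fun u => ((u - z) / den b z u)%C) l = (1 + (z - 1) * numerator b z l / prodC (den b z) l)%C.
Proof.
  induction l as [|u l IH]; intros H; simpl.
  - field.
  - assert (Hu : den b z u <> 0%C) by (apply H; left; auto).
    assert (Hl : prodC (den b z) l <> 0%C) by (apply prodC_neq_0; intros; apply H; right; auto).
    rewrite IH by (intros; apply H; right; auto).
    set (q := prodC (den b z) l) in *. set (N := numerator b z l).
    (* This identity extracts the factor [z - 1] from [(u - z) / den b z u - 1]. *)
    assert (E : (u - z = den b z u - (z - 1) * (u - b))%C) by (unfold den; ring).
    set (dd := den b z u) in *.
    transitivity (((u - z) * q + (z - 1) * ((u - z) * N)) / (dd * q))%C; [field; auto|].
    rewrite E at 1. field; auto.
Qed.

Lemma pairs_AD_split (b : R) (l : list C) : pairs_AD b l = (vandermonde l * inv_dens b l)%C.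
Proof.
  induction l as [|u l IH]; simpl; [ring|]. rewrite IH.
  unfold Cdiv. rewrite prodC_mult. ring.
Qed.

Fixpoint exp_prod (a : list Z) (zs : list C) : C :=
  match a, zs with
  | a1 :: a', z :: t => (Cpowz z a1 / (z - 1) * exp_prod a' t)%C
  | _, _ => 1%C
  end.

Lemma Cpowz_minus (z : C) (p : Z) (n : nat) : z <> 0%C ->
  (Cpowz z (p - Z.of_nat n) * z ^ n = Cpowz z p)%C.
Proof.
  intros Hz. rewrite <- Cpowz_of_nat, <- Cpowz_add by auto. f_equal. lia.
Qed.

(* Partial fractions in the first variable [z]: the pole at [z = 1] and the
   simple poles at [den b z u = 0]. *)
Lemma first_variable_expansion (b : R) (a1 : Z) (a : list Z) (z : C) (l : list C) :
  z <> 0%C -> z <> 1%C -> (forall u, In u l -> den b z u <> 0%C) ->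
  (pairs_AD b (z :: l) * exp_prod (a1 :: a) (z :: l) =
   Cpowz z a1 / (z - 1) * (pairs_AD b l * exp_prod a l) +
   sumC (fun i => (-1) ^ i * (Cpowz z (a1 - (Z.of_nat (length l) - 1)) * numerator b z l *
      inv_dens b l * exp_prod a l * vandermonde (remove_nth i l) * / den b z (nth i l 0)))
     (seq 0 (length l)))%C.
Proof.
  intros Hz0 Hz1 Hd.
  assert (Hz1' : (z - 1)%C <> 0%C).
  { intros H. apply Hz1. replace z with ((z - 1) + 1)%C by ring. rewrite H. ring. }
  simpl pairs_AD. rewrite numerator_spec by auto. simpl exp_prod.
  assert (Hc : l = [] \/ l <> []) by (destruct l; [left|right]; congruence).
  destruct Hc as [->|Hl].
  - simpl. field. auto.
  - assert (HP : prodC (den b z) l <> 0%C) by (apply prodC_neq_0; auto).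
    (* With this choice [alpha * v + beta] is [den b z v]. Divided by all denominators, each term of
       the expansion retains the single pole [den b z (nth i l 0) = 0]. *)
    pose proof (vandermonde_expansion (z) (- (1 + b) * z + b)%C l Hl) as E.
    rewrite (sumC_ext _ (fun i => (prodC (den b z) l * ((-1) ^ i * (vandermonde (remove_nth i l) * / den b z (nth i l 0))))%C)) in E.
    2:{ intros i Hi. apply in_seq in Hi. rewrite (prodC_remove_nth (den b z) i l) by lia.
        rewrite (prodC_ext _ (den b z)) by (intros; unfold den; ring).
        field. apply Hd, nth_In. lia. }
    rewrite sumC_mult_l in E.
    rewrite (sumC_ext _ (fun i => (Cpowz z (a1 - (Z.of_nat (length l) - 1)) * numerator b z l *
      inv_dens b l * exp_prod a l * ((-1) ^ i * (vandermonde (remove_nth i l) * / den b z (nth i l 0))))%C)) by (intros; ring).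
    rewrite sumC_mult_l.
    set (S := sumC _ _) in *.
    assert (Hn : (Z.of_nat (length l) - 1 = Z.of_nat (length l - 1))%Z).
    { destruct l; [congruence|]. simpl length. lia. }
    rewrite Hn. rewrite (pairs_AD_split b l).
    set (P := prodC (den b z) l) in *.
    rewrite <- (Cpowz_minus z a1 (length l - 1)) by auto.
    set (n := (length l - 1)%nat) in *.
    transitivity (Cpowz z (a1 - Z.of_nat n) * z ^ n / (z - 1) * (vandermonde l * inv_dens b l * exp_prod a l) +
       Cpowz z (a1 - Z.of_nat n) * (z ^ n * vandermonde l) * numerator b z l / P * inv_dens b l * exp_prod a l)%C.
    + field; auto.
    + rewrite <- E. field. split; auto.
Qed.

(** One family for all weights in use: [s = t = 0] gives bare approximability, [s = 0], [t = 1] the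
    decay in [z_i], and [s = t = 1] compares [z_0] with [z_i]. [coord_weight] is the weight of a
    single variable. *)
Definition diff_weight (s t : Z) (i : nat) (e : nat -> Z) : Z := (s * e 0%nat - t * e i)%Z.

Definition coord_weight (s t : Z) (i m : nat) : Z :=
  ((if Nat.eqb m 0 then s else 0) - (if Nat.eqb m i then t else 0))%Z.

Lemma diff_weight_additive s t i : additive (diff_weight s t i).
Proof. unfold diff_weight; split; intros; ring. Qed.

Lemma diff_weight_delta s t i m p :
  diff_weight s t i (fun n => if Nat.eqb n m then p else 0%Z) = (p * coord_weight s t i m)%Z.
Proof.
  unfold diff_weight, coord_weight. rewrite (Nat.eqb_sym m 0), (Nat.eqb_sym m i).
  destruct (Nat.eqb 0 m), (Nat.eqb i m); ring.
Qed.

Section Memberships.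

Context (r b : R) (Hr : 4 <= r) (Hb : 0 < b < 1) (k : nat) (s t : Z) (i : nat).

Let Hr0 : 0 < r. Proof. lra. Qed.
Let HW := diff_weight_additive s t i.
Let omg := coord_weight s t i.
Let ap := apx r k (diff_weight s t i).

Definition coord (m : nat) (zs : list C) : C := nth m zs 0%C.

Lemma torus_coord_neq_0 (zs : list C) (m : nat) : torus r k zs -> (m < k)%nat -> coord m zs <> 0%C.
Proof. intros H Hm. apply Cmod_gt_0. unfold coord. rewrite (torus_nth r k m zs H Hm). auto. Qed.

Lemma Cmod_inv_coord (zs : list C) (m : nat) : torus r k zs -> (m < k)%nat -> Cmod (/ coord m zs) <= 1 / 4.
Proof.
  intros H Hm. rewrite Cmod_inv by (apply torus_coord_neq_0; auto).
  unfold coord. rewrite (torus_nth r k m zs H Hm). unfold Rdiv. rewrite Rmult_1_l.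
  apply Rinv_le_contravar; lra.
Qed.

Lemma ap_pow (m : nat) (p : Z) : (m < k)%nat -> ap (p * omg m) (fun zs => Cpowz (coord m zs) p).
Proof. intros Hm. unfold ap, omg. rewrite <- diff_weight_delta. apply apx_coord; auto. Qed.

Lemma ap_coord (m : nat) : (m < k)%nat -> ap (omg m) (coord m).
Proof.
  intros Hm. replace (omg m) with (1 * omg m)%Z by ring.
  eapply apx_ext; [|apply ap_pow; auto]. intros zs _. apply Cpowz_1.
Qed.

Lemma ap_inv_coord (m : nat) : (m < k)%nat -> ap (- omg m) (fun zs => / coord m zs)%C.
Proof.
  intros Hm. replace (- omg m)%Z with (-1 * omg m)%Z by ring.
  eapply apx_ext; [|apply ap_pow; auto]. intros zs _. apply Cpowz_m1.
Qed.

Lemma inv_one_minus_neq (v : C) (th : R) : th < 1 -> Cmod v <= th -> (1 - v)%C <> 0%C.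
Proof.
  intros Ht Hv H. assert (E : v = 1%C) by (replace v with (1 - (1 - v))%C by ring; rewrite H; ring).
  rewrite E, Cmod_1 in Hv. lra.
Qed.

(** The origin of the radius 4: the first term is at most [2 / 4], the second at most [1 / 16],
    together below [3 / 4]. *)
Lemma den_small (zs : list C) (u v : nat) : torus r k zs -> (u < k)%nat -> (v < k)%nat ->
  Cmod ((1 + b) * / coord v zs - b * (/ coord u zs * / coord v zs)) <= 3 / 4.
Proof.
  intros H Hu Hv. unfold Cminus. eapply Rle_trans; [apply Cmod_triangle|].
  rewrite Cmod_opp, !Cmod_mult, <- RtoC_plus, !Cmod_R, !Rabs_right by lra.
  pose proof (Cmod_inv_coord zs u H Hu). pose proof (Cmod_inv_coord zs v H Hv).
  pose proof (Cmod_ge_0 (/ coord u zs)). pose proof (Cmod_ge_0 (/ coord v zs)).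
  assert (Cmod (/ coord u zs) * Cmod (/ coord v zs) <= 1/4 * (1/4)) by (apply Rmult_le_compat; auto).
  nra.
Qed.

Lemma den_factor (zs : list C) (u v : nat) : torus r k zs -> (u < k)%nat -> (v < k)%nat ->
  den b (coord u zs) (coord v zs) =
  (coord u zs * coord v zs * (1 - ((1 + b) * / coord v zs - b * (/ coord u zs * / coord v zs))))%C.
Proof.
  intros H Hu Hv. unfold den. field. split; apply torus_coord_neq_0; auto.
Qed.

Lemma den_neq_0 (zs : list C) (u v : nat) : torus r k zs -> (u < k)%nat -> (v < k)%nat ->
  den b (coord u zs) (coord v zs) <> 0%C.
Proof.
  intros H Hu Hv. rewrite den_factor by auto.
  apply Cmult_neq_0; [apply Cmult_neq_0; apply torus_coord_neq_0; auto|].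
  apply (inv_one_minus_neq _ (3/4)); [lra|]. apply den_small; auto.
Qed.

(** The geometric series runs in [/ v] and [/ (u * v)], never in [/ u] alone. Hence only [omg v] and
    [omg u + omg v] have to be nonpositive, and [u] may be the variable 0 of weight 1 when [v] has
    weight [-1]. *)
Lemma ap_inv_den (u v : nat) : (u < k)%nat -> (v < k)%nat ->
  (omg v <= 0)%Z -> (omg u + omg v <= 0)%Z ->
  ap (- omg u - omg v) (fun zs => / den b (coord u zs) (coord v zs))%C.
Proof.
  intros Hu Hv H1 H2.
  set (sm := fun zs => ((1 + b) * / coord v zs - b * (/ coord u zs * / coord v zs))%C).
  apply (apx_ext r k _ _ (fun zs => (/ coord u zs * / coord v zs * / (1 - sm zs))%C)).
  - intros zs Hz. rewrite den_factor by auto. fold (sm zs). field.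
    repeat split; try (apply torus_coord_neq_0; auto).
    apply (inv_one_minus_neq _ (3/4)); [lra|]. apply den_small; auto.
  - replace (- omg u - omg v)%Z with ((- omg u + - omg v) + 0)%Z by ring.
    apply apx_mult; auto; [apply apx_mult; auto; apply ap_inv_coord; auto|].
    apply (apx_geom r Hr0 k _ HW sm (3/4)); [lra|intros; apply den_small; auto|].
    apply apx_minus; auto.
    + apply apx_scal; auto. apply (apx_weaken r k _ (- omg v)); [lia|]. apply ap_inv_coord; auto.
    + apply apx_scal; auto. apply (apx_weaken r k _ (- omg u + - omg v)); [lia|].
      apply apx_mult; auto; apply ap_inv_coord; auto.
Qed.

Lemma torus_coord_neq_1 (zs : list C) (m : nat) : torus r k zs -> (m < k)%nat -> coord m zs <> 1%C.
Proof.
  intros H Hm E. pose proof (torus_nth r k m zs H Hm) as E1. unfold coord in E. rewrite E, Cmod_1 in E1. lra.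
Qed.

Lemma ap_inv_minus_1 (m : nat) : (m < k)%nat -> (omg m <= 0)%Z ->
  ap (- omg m) (fun zs => / (coord m zs - 1))%C.
Proof.
  intros Hm H1. apply (apx_ext r k _ _ (fun zs => (/ coord m zs * / (1 - / coord m zs))%C)).
  - intros zs Hz. assert (coord m zs <> 0%C) by (apply torus_coord_neq_0; auto).
    assert (coord m zs - 1 <> 0)%C.
    { intros E. apply (torus_coord_neq_1 zs m); auto. replace (coord m zs) with (coord m zs - 1 + 1)%C by ring. rewrite E; ring. }
    field. split; auto.
  - replace (- omg m)%Z with (- omg m + 0)%Z by ring.
    apply apx_mult; auto; [apply ap_inv_coord; auto|].
    apply (apx_geom r Hr0 k _ HW (fun zs => / coord m zs)%C (1/4)); [lra|intros; apply Cmod_inv_coord; auto|].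
    apply (apx_weaken r k _ (- omg m)); [lia|]. apply ap_inv_coord; auto.
Qed.

Lemma ap_diff (u v : nat) (c : Z) : (u < k)%nat -> (v < k)%nat -> (c <= omg u)%Z -> (c <= omg v)%Z ->
  ap c (fun zs => coord v zs - coord u zs)%C.
Proof.
  intros Hu Hv H1 H2. apply apx_minus; auto.
  - apply (apx_weaken r k _ (omg v)); auto. apply ap_coord; auto.
  - apply (apx_weaken r k _ (omg u)); auto. apply ap_coord; auto.
Qed.

Definition coords_at (idx : list nat) (zs : list C) : list C := map (fun m => coord m zs) idx.

Lemma ap_prodC_const (F : nat -> list C -> C) (idx : list nat) :
  (forall m, In m idx -> ap 0 (F m)) -> ap 0 (fun zs => prodC (fun m => F m zs) idx).
Proof.
  intros H. assert (E : fold_right (fun (a : nat) (s : Z) => (0 + s)%Z) 0%Z idx = 0%Z) by (clear; induction idx as [|m l IH]; [reflexivity|]; cbn [fold_right]; rewrite IH; reflexivity).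
  pose proof (apx_prodC r Hr0 k _ HW F (fun _ => 0%Z) idx H) as A. cbv beta in A. rewrite E in A. exact A.
Qed.

Lemma ap_vandermonde (idx : list nat) : (forall m, In m idx -> (m < k)%nat /\ omg m = 0%Z) ->
  ap 0 (fun zs => vandermonde (coords_at idx zs)).
Proof.
  induction idx as [|u l IH]; intros H.
  - exact (apx_const r k _ HW (RtoC 1)).
  - apply (apx_ext r k _ _ (fun zs => (prodC (fun m => (coord m zs - coord u zs)%C) l * vandermonde (coords_at l zs))%C)).
    + intros zs _. simpl. unfold coords_at at 2. rewrite prodC_map. reflexivity.
    + apply (apx_mult r Hr0 k _ HW 0 0); [|apply IH; intros; apply H; right; auto].
      apply (ap_prodC_const (fun m zs => (coord m zs - coord u zs)%C)).
      intros m Hm. destruct (H u (or_introl eq_refl)). destruct (H m (or_intror Hm)).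
      apply ap_diff; auto; lia.
Qed.

(** The amplitude stays bounded when one variable grows. In every pair one weight is 0 and the other
    nonpositive, so the difference in the numerator has weight at least [omg u + omg m], exactly
    what the denominator gives back. *)
Lemma ap_pairs_AD (idx : list nat) : NoDup idx ->
  (forall m, In m idx -> (m < k)%nat /\ (omg m <= 0)%Z) ->
  (forall m m', In m idx -> In m' idx -> m <> m' -> omg m = 0%Z \/ omg m' = 0%Z) ->
  ap 0 (fun zs => pairs_AD b (coords_at idx zs)).
Proof.
  intros Hnd. induction Hnd as [|u l Hu Hnd IH]; intros H H'.
  - exact (apx_const r k _ HW (RtoC 1)).
  - apply (apx_ext r k _ _ (fun zs => (prodC (fun m => ((coord m zs - coord u zs) / den b (coord u zs) (coord m zs))%C) l
        * pairs_AD b (coords_at l zs))%C)).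
    + intros zs _. simpl. unfold coords_at at 2. rewrite prodC_map. reflexivity.
    + apply (apx_mult r Hr0 k _ HW 0 0);
        [|apply IH; intros; [apply H; right|apply H'; try right]; auto].
      apply (ap_prodC_const (fun m zs => ((coord m zs - coord u zs) / den b (coord u zs) (coord m zs))%C)).
      intros m Hm. destruct (H u (or_introl eq_refl)). destruct (H m (or_intror Hm)).
      assert (Hum : u <> m) by (intros E; subst; auto).
      pose proof (H' u m (or_introl eq_refl) (or_intror Hm) Hum) as H4.
      apply (apx_weaken r k _ ((omg u + omg m) + (- omg u - omg m))); [lia|].
      apply apx_mult; auto.
      * apply ap_diff; auto; lia.
      * apply ap_inv_den; auto; lia.
Qed.

Definition weight_sum (idx : list nat) : Z := fold_right (fun m s => (- omg m + s)%Z) 0%Z idx.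

(** Each variable of the list occurs in [length idx - 1] denominators and each occurrence gains its
    [- omg]. *)
Lemma ap_inv_dens (idx : list nat) :
  (forall m, In m idx -> (m < k)%nat /\ (omg m <= 0)%Z) ->
  ap ((Z.of_nat (length idx) - 1) * weight_sum idx) (fun zs => inv_dens b (coords_at idx zs)).
Proof.
  induction idx as [|u l IH]; intros H.
  - exact (apx_const r k _ HW (RtoC 1)).
  - apply (apx_ext r k _ _ (fun zs => (prodC (fun m => (/ den b (coord u zs) (coord m zs))%C) l
        * inv_dens b (coords_at l zs))%C)).
    + intros zs _. simpl. unfold coords_at at 2. rewrite prodC_map. reflexivity.
    + replace ((Z.of_nat (length (u :: l)) - 1) * weight_sum (u :: l))%Z with
        (fold_right (fun m s => ((- omg u - omg m) + s)%Z) 0%Z l + (Z.of_nat (length l) - 1) * weight_sum l)%Z.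
      * apply apx_mult; auto; [|apply IH; intros; apply H; right; auto].
        apply (apx_prodC r Hr0 k _ HW (fun m zs => (/ den b (coord u zs) (coord m zs))%C) (fun m => (- omg u - omg m)%Z)).
        intros m Hm. destruct (H u (or_introl eq_refl)). destruct (H m (or_intror Hm)).
        apply ap_inv_den; auto; lia.
      * assert (E : (fold_right (fun m s => ((- omg u - omg m) + s)%Z) 0%Z l =
           Z.of_nat (length l) * (- omg u) + weight_sum l)%Z).
        { clear. induction l as [|m l IH]; [simpl; ring|]. simpl fold_right. rewrite IH.
          simpl length. rewrite Nat2Z.inj_succ. simpl weight_sum. ring. }
        rewrite E. simpl length. rewrite Nat2Z.inj_succ. simpl weight_sum. ring.
Qed.

Fixpoint exp_prod_weight (a : list Z) (idx : list nat) : Z :=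
  match a, idx with
  | a1 :: a', m :: idx' => ((a1 - 1) * omg m + exp_prod_weight a' idx')%Z
  | _, _ => 0%Z
  end.

Lemma ap_exp_prod (a : list Z) (idx : list nat) :
  (forall m, In m idx -> (m < k)%nat /\ (omg m <= 0)%Z) ->
  ap (exp_prod_weight a idx) (fun zs => exp_prod a (coords_at idx zs)).
Proof.
  revert idx. induction a as [|a1 a IH]; intros idx H.
  - exact (apx_const r k _ HW (RtoC 1)).
  - destruct idx as [|m idx]; [exact (apx_const r k _ HW (RtoC 1))|]. simpl.
    destruct (H m (or_introl eq_refl)).
    apply apx_mult; auto; [|apply IH; intros; apply H; right; auto].
    replace ((a1 - 1) * omg m)%Z with (a1 * omg m + - omg m)%Z by ring.
    apply apx_mult; auto; [apply ap_pow; auto|apply ap_inv_minus_1; auto].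
Qed.

(** The weight 1 of variable 0 compensates a weight [-1] in [den b z v], which therefore has weight
    at least 0. Only the factors [u - z] and [u - b] lose weight, at most [- omg u] for each [u]. *)
Lemma ap_numerator (idx : list nat) : (0 < k)%nat -> omg 0 = 1%Z ->
  (forall m, In m idx -> (m < k)%nat /\ (-1 <= omg m <= 0)%Z) ->
  ap (- weight_sum idx) (fun zs => numerator b (coord 0 zs) (coords_at idx zs)).
Proof.
  intros Hk H0. induction idx as [|u l IH]; intros H.
  - exact (apx_const r k _ HW (RtoC 0)).
  - destruct (H u (or_introl eq_refl)) as [Hu1 Hu2].
    assert (Hl : (0 <= weight_sum l)%Z).
    { assert (Hl : forall m, In m l -> (omg m <= 0)%Z) by (intros m Hm; apply (H m (or_intror Hm))).
      clear - Hl. induction l as [|m l IH]; simpl; [lia|].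
      pose proof (Hl m (or_introl eq_refl)). assert (0 <= weight_sum l)%Z by (apply IH; intros; apply Hl; right; auto). lia. }
    apply (apx_ext r k _ _ (fun zs => ((coord u zs - coord 0 zs) * numerator b (coord 0 zs) (coords_at l zs)
       - (coord u zs - b) * prodC (fun m => den b (coord 0 zs) (coord m zs)) l)%C)).
    + intros zs _. simpl. unfold coords_at at 3. rewrite prodC_map. reflexivity.
    + replace (- weight_sum (u :: l))%Z with (omg u + - weight_sum l)%Z by (simpl; ring).
      apply apx_minus; auto.
      * apply apx_mult; auto; [apply ap_diff; auto; lia|]. apply IH; intros; apply H; right; auto.
      * apply (apx_weaken r k _ (omg u + 0)); [lia|].
        apply apx_mult; auto.
        -- apply apx_minus; auto; [apply ap_coord; auto|]. apply (apx_weaken r k _ 0); [lia|]. apply apx_const; auto.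
        -- apply (ap_prodC_const (fun m zs => den b (coord 0 zs) (coord m zs))).
           intros m Hm. destruct (H m (or_intror Hm)).
           unfold den. apply apx_plus; auto; [|apply apx_const; auto].
           apply apx_minus; auto.
           ++ apply (apx_weaken r k _ (omg 0 + omg m)); [lia|]. apply apx_mult; auto; apply ap_coord; auto.
           ++ apply apx_scal; auto. apply (apx_weaken r k _ (omg 0)); [lia|]. apply ap_coord; auto.
Qed.

End Memberships.

(** * Coefficients of the Bethe amplitude *)

Lemma torus_coords_at (r : R) (k : nat) (zs : list C) : torus r k zs -> coords_at (seq 0 k) zs = zs.
Proof.
  intros [Hl _]. subst k. unfold coords_at, coord. clear. induction zs as [|z t IH]; simpl; auto.
  f_equal. rewrite <- seq_shift, map_map. exact IH.
Qed.

Lemma torus_coords_at_tail (r : R) (k : nat) (zs : list C) : torus r (S k) zs ->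
  zs = coord 0 zs :: coords_at (seq 1 k) zs.
Proof. intros H. rewrite <- (torus_coords_at r (S k) zs H) at 1. reflexivity. Qed.

Lemma remove_nth_map {A B : Type} (f : A -> B) (i : nat) (l : list A) : remove_nth i (map f l) = map f (remove_nth i l).
Proof.
  revert i. induction l as [|u l IH]; intros [|i]; simpl; auto. rewrite IH. reflexivity.
Qed.

Lemma in_remove_nth_seq (j c n m : nat) : In m (remove_nth j (seq c n)) -> m <> (c + j)%nat /\ (c <= m < c + n)%nat.
Proof.
  revert j c. induction n as [|n IH]; intros j c H; simpl in H; [destruct j; destruct H|].
  destruct j as [|j].
  - apply in_seq in H. lia.
  - destruct H as [<-|H]; [lia|]. apply IH in H. lia.
Qed.

(** * Weight sums when, from index [c] on, a single variable has weight -1 *)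

Section WeightSums.

Context (s : Z) (i c : nat) (Hom : forall m, (c <= m)%nat -> coord_weight s 1 i m = if Nat.eqb m i then (-1)%Z else 0%Z).

Lemma weight_sum_out (d n : nat) : (c <= d)%nat -> (i < d)%nat -> weight_sum s 1 i (seq d n) = 0%Z.
Proof.
  revert d. induction n as [|n IH]; intros d H1 H2; simpl; auto.
  rewrite IH by lia. rewrite Hom by lia. destruct (Nat.eqb_spec d i); lia.
Qed.

Lemma weight_sum_in (d n : nat) : (c <= d)%nat -> (d <= i < d + n)%nat -> weight_sum s 1 i (seq d n) = 1%Z.
Proof.
  revert d. induction n as [|n IH]; intros d H1 H2; simpl; [lia|].
  rewrite Hom by lia. destruct (Nat.eqb_spec d i).
  - rewrite weight_sum_out by lia. lia.
  - rewrite IH by lia. lia.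
Qed.

Lemma exp_prod_weight_out (a : list Z) (d n : nat) : (c <= d)%nat -> (i < d)%nat -> exp_prod_weight s 1 i a (seq d n) = 0%Z.
Proof.
  revert a d. induction n as [|n IH]; intros a d H1 H2; simpl; [destruct a; auto|].
  destruct a as [|a1 a]; simpl; auto.
  rewrite IH by lia. rewrite Hom by lia. destruct (Nat.eqb_spec d i); lia.
Qed.

Lemma exp_prod_weight_in (a : list Z) (d n : nat) : (c <= d)%nat -> (d <= i < d + n)%nat -> length a = n ->
  exp_prod_weight s 1 i a (seq d n) = (1 - nth (i - d) a 0)%Z.
Proof.
  revert a d. induction n as [|n IH]; intros a d H1 H2 H3; [lia|]; cbn [seq].
  destruct a as [|a1 a]; simpl in H3; [lia|]. cbn [exp_prod_weight].
  rewrite Hom by lia. destruct (Nat.eqb_spec d i).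
  - rewrite exp_prod_weight_out by lia. subst. rewrite Nat.sub_diag. cbn [nth]. lia.
  - rewrite IH by lia. replace (i - d)%nat with (S (i - S d)) by lia. cbn [nth]. lia.
Qed.

End WeightSums.

Fixpoint strictly_decreasing (a : list Z) : Prop :=
  match a with
  | [] => True
  | a1 :: a' => Forall (fun x => (x < a1)%Z) a' /\ strictly_decreasing a'
  end.

Section Initial.

Context (r b : R) (Hr : 4 <= r) (Hb : 0 < b < 1).

Lemma lau_pairs_exp_prod (a : list Z) :
  lau r (length a) (fun zs => pairs_AD b zs * exp_prod a zs)%C.
Proof.
  assert (Hr0 : 0 < r) by lra.
  apply (apx_lau _ _ (diff_weight 0 0 0) (0 + exp_prod_weight 0 0 0 a (seq 0 (length a)))).
  assert (Ho : forall m, coord_weight 0 0 0 m = 0%Z).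
  { intros m. unfold coord_weight. destruct (Nat.eqb m 0); reflexivity. }
  apply (apx_ext _ _ _ _ (fun zs => (pairs_AD b (coords_at (seq 0 (length a)) zs) *
        exp_prod a (coords_at (seq 0 (length a)) zs))%C)).
  - intros zs Hz. rewrite torus_coords_at with (r := r); auto.
  - apply apx_mult; auto; [apply diff_weight_additive| |].
    + apply ap_pairs_AD; auto; [apply seq_NoDup|].
      intros m Hm. apply in_seq in Hm. rewrite Ho. lia.
    + apply ap_exp_prod; auto. intros m Hm. apply in_seq in Hm. rewrite Ho. lia.
Qed.

(** In [z_j] the amplitude is bounded at infinity and [z_j ^ a_j / (z_j - 1)] decays at least like
    [z_j ^ (-2)], so the exponent [-1] does not occur. *)
Lemma mci_pairs_exp_prod_neg (a : list Z) (j : nat) : (j < length a)%nat -> (nth j a 0 < 0)%Z ->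
  multi_circ_int r (length a) (fun zs => pairs_AD b zs * exp_prod a zs)%C = 0%C.
Proof.
  intros Hj Ha. assert (Hr0 : 0 < r) by lra.
  assert (Ho : forall m, (0 <= m)%nat -> coord_weight 0 1 j m = if Nat.eqb m j then (-1)%Z else 0%Z).
  { intros m _. unfold coord_weight. destruct (Nat.eqb m 0), (Nat.eqb m j); reflexivity. }
  apply (mci_vanish r Hr0 _ (diff_weight 0 1 j) (0 + exp_prod_weight 0 1 j a (seq 0 (length a)))).
  - apply (apx_ext _ _ _ _ (fun zs => (pairs_AD b (coords_at (seq 0 (length a)) zs) *
        exp_prod a (coords_at (seq 0 (length a)) zs))%C)).
    + intros zs Hz. rewrite torus_coords_at with (r := r); auto.
    + apply apx_mult; auto; [apply diff_weight_additive| |].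
      * apply ap_pairs_AD; auto; [apply seq_NoDup| |].
        -- intros m Hm. apply in_seq in Hm. rewrite Ho by lia. destruct (Nat.eqb m j); lia.
        -- intros m m' _ _ Hmm. rewrite !Ho by lia.
           destruct (Nat.eqb_spec m j), (Nat.eqb_spec m' j); subst; tauto.
      * apply ap_exp_prod; auto. intros m Hm. apply in_seq in Hm. rewrite Ho by lia. destruct (Nat.eqb m j); lia.
  - intros e He. unfold diff_weight. rewrite (isres_spec _ e j He Hj).
    rewrite (exp_prod_weight_in 0 j 0 Ho) by lia. rewrite Nat.sub_0_r. lia.
Qed.

(** From [z ^ (q + 1) / (z - 1) = z ^ q + z ^ q / (z - 1)] the integral changes only in the step
    from [q = -1] to 0, where the first term contributes 1. At [q = -1] it vanishes, as the
    integrand decays like [z ^ (-2)]. *)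
Lemma mci_single (p : Z) : (0 <= p)%Z ->
  multi_circ_int r 1 (fun zs => Cpowz (coord 0 zs) p / (coord 0 zs - 1))%C = 1%C.
Proof.
  assert (Hr0 : 0 < r) by lra.
  assert (Hn0 : forall zs, torus r 1 zs -> coord 0 zs <> 0%C) by (intros; apply (torus_coord_neq_0 r Hr 1 zs 0); auto; lia).
  assert (Hn1 : forall zs, torus r 1 zs -> (coord 0 zs - 1)%C <> 0%C).
  { intros zs Hz E. apply (torus_coord_neq_1 r Hr 1 zs 0); auto.
    replace (coord 0 zs) with (coord 0 zs - 1 + 1)%C by ring. rewrite E; ring. }
  assert (Ho : coord_weight 0 1 0 0 = (-1)%Z) by reflexivity.
  assert (Hl : forall q, lau r 1 (fun zs => Cpowz (coord 0 zs) q)).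
  { intros q. apply (apx_lau _ _ (diff_weight 0 1 0) (q * coord_weight 0 1 0 0)). apply (ap_pow r 1 0 1 0 0 q). lia. }
  assert (Hi : apx r 1 (diff_weight 0 1 0) 1 (fun zs => / (coord 0 zs - 1))%C).
  { apply (ap_inv_minus_1 r Hr 1 0 1 0 0); [lia|]. rewrite Ho; lia. }
  assert (Hli : forall q, lau r 1 (fun zs => Cpowz (coord 0 zs) q / (coord 0 zs - 1))%C).
  { intros q. unfold Cdiv. apply (apx_mult r Hr0 1 _ additive_zero 0 0 _ (fun zs => / (coord 0 zs - 1))%C); [apply Hl|apply (apx_lau _ _ _ _ _ Hi)]. }
  assert (Hstep : forall q, multi_circ_int r 1 (fun zs => Cpowz (coord 0 zs) (q + 1) / (coord 0 zs - 1))%C =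
     ((if Z.eqb q (-1) then 1%C else 0%C) + multi_circ_int r 1 (fun zs => Cpowz (coord 0 zs) q / (coord 0 zs - 1))%C)%C).
  { intros q. rewrite <- (is_cint_unique r (fun z => Cpowz z q) _ (is_cint_Cpowz r q Hr0)).
    change (circ_int r (fun z => Cpowz z q)) with (multi_circ_int r 1 (fun zs => Cpowz (coord 0 zs) q)).
    rewrite <- mci_plus; auto.
    apply mci_ext; [lra|]. intros zs Hz. rewrite Cpowz_succ by auto. field. auto. }
  intros Hp. pattern p. apply natlike_ind; auto.
  - change 0%Z with (-1 + 1)%Z. rewrite Hstep. simpl (Z.eqb _ _).
    rewrite (mci_vanish r Hr0 1 (diff_weight 0 1 0) 2).
    + ring.
    + unfold Cdiv. apply (apx_mult r Hr0 1 _ (diff_weight_additive 0 1 0) 1 1); auto.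
      apply (ap_pow r 1 0 1 0 0 (-1)). lia.
    + intros e He. unfold diff_weight. rewrite (isres_spec _ e 0 He) by lia. lia.
  - intros q Hq IH. unfold Z.succ. rewrite Hstep, IH.
    destruct (Z.eqb_spec q (-1)); [lia|]. ring.
Qed.

Lemma mci_cons_product (k : nat) (f : C -> C) (G : list C -> C) : lau r k G ->
  multi_circ_int r (S k) (fun zs => match zs with z :: l => f z * G l | [] => 0 end)%C
  = multi_circ_int r 1 (fun zs => f (coord 0 zs) * multi_circ_int r k G)%C.
Proof.
  intros HG. simpl. apply circ_int_ext; [lra|]. intros z _. unfold coord; simpl.
  apply mci_scal; auto. lra.
Qed.

(** Partial fractions in the first variable: the term [T0] of the pole at 1 factors into
    [mci_single] and the same integral for the tail. In the term [T j] every monomial has its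
    exponent of [z_0] strictly above that of [z_(j+1)], since [a1] exceeds the entry [j] of [a]; the
    residue needs equal exponents, so these terms vanish. *)
Lemma mci_pairs_exp_prod_one (a : list Z) : strictly_decreasing a -> Forall (fun x => (0 <= x)%Z) a ->
  multi_circ_int r (length a) (fun zs => pairs_AD b zs * exp_prod a zs)%C = 1%C.
Proof.
  assert (Hr0 : 0 < r) by lra.
  induction a as [|a1 a IH]; intros Hs Hp.
  - simpl. ring.
  - destruct Hs as [Hs1 Hs2]. inversion Hp as [|? ? Hp1 Hp2]; subst.
    specialize (IH Hs2 Hp2). simpl length. set (n := length a) in *.
    set (idx := seq 1 n).
    set (T0 := fun zs : list C => match zs return C with z :: l => (Cpowz z a1 / (z - 1) * (pairs_AD b l * exp_prod a l))%C | [] => 0%C end).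
    set (T := fun j zs => ((-1) ^ j * (Cpowz (coord 0 zs) (a1 - (Z.of_nat n - 1)) * numerator b (coord 0 zs) (coords_at idx zs) *
      inv_dens b (coords_at idx zs) * exp_prod a (coords_at idx zs) * vandermonde (coords_at (remove_nth j idx) zs) * / den b (coord 0 zs) (coord (S j) zs)))%C).
    assert (HT : forall j, (j < n)%nat ->
       apx r (S n) (diff_weight 1 1 (S j)) 1 (T j)).
    { intros j Hj.
      assert (Ho : forall m, (1 <= m)%nat -> coord_weight 1 1 (S j) m = if Nat.eqb m (S j) then (-1)%Z else 0%Z).
      { intros m Hm. unfold coord_weight. destruct (Nat.eqb_spec m 0); [lia|]. destruct (Nat.eqb m (S j)); reflexivity. }
      assert (Ho0 : coord_weight 1 1 (S j) 0 = 1%Z) by reflexivity.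
      assert (Hix : forall m, In m idx -> (m < S n)%nat /\ (-1 <= coord_weight 1 1 (S j) m <= 0)%Z).
      { intros m Hm. apply in_seq in Hm. rewrite Ho by lia. destruct (Nat.eqb m (S j)); lia. }
      assert (Hix' : forall m, In m idx -> (m < S n)%nat /\ (coord_weight 1 1 (S j) m <= 0)%Z).
      { intros m Hm. specialize (Hix m Hm). lia. }
      pose proof (diff_weight_additive 1 1 (S j)) as HW.
      unfold T. apply apx_scal; auto.
      apply (apx_weaken r _ _ ((a1 - (Z.of_nat n - 1)) * coord_weight 1 1 (S j) 0 + - weight_sum 1 1 (S j) idx
        + (Z.of_nat (length idx) - 1) * weight_sum 1 1 (S j) idx + exp_prod_weight 1 1 (S j) a idx + 0
        + (- coord_weight 1 1 (S j) 0 - coord_weight 1 1 (S j) (S j)))%Z).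
      (* The contributions add up to [a1 - nth j a 0]: the power of [z_0] lost to the row expansion
         is returned by [inv_dens]. *)
      - unfold idx. rewrite length_seq.
        rewrite (weight_sum_in 1 (S j) 1 Ho) by lia. rewrite (exp_prod_weight_in 1 (S j) 1 Ho) by (auto; lia).
        rewrite Ho0, Ho, Nat.eqb_refl by lia.
        replace (S j - 1)%nat with j by lia.
        assert (Hlt : (nth j a 0 < a1)%Z).
        { rewrite Forall_forall in Hs1. apply Hs1, nth_In. auto. }
        lia.
      - repeat (apply apx_mult; auto).
        + apply ap_pow. lia.
        + apply ap_numerator; auto. lia.
        + apply ap_inv_dens; auto.
        + apply ap_exp_prod; auto.
        + apply ap_vandermonde; auto. intros m Hm. apply in_remove_nth_seq in Hm. rewrite Ho by lia.
          destruct (Nat.eqb_spec m (S j)); lia.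
        + apply ap_inv_den; auto; try lia; rewrite ?Ho0, Ho, Nat.eqb_refl by lia; lia. }
    assert (Hid : forall zs, torus r (S n) zs ->
       (pairs_AD b zs * exp_prod (a1 :: a) zs = T0 zs + sumC (fun j => T j zs) (seq 0 n))%C).
    { intros zs Hz. pose proof (torus_coords_at_tail _ _ _ Hz) as E.
      fold idx in E. set (z := coord 0 zs) in *. set (l := coords_at idx zs) in *.
      assert (Hl : length l = n) by (unfold l, coords_at, idx; rewrite length_map, length_seq; auto).
      rewrite E at 1 2.
      rewrite first_variable_expansion.
      - rewrite E at 1. unfold T0. f_equal. rewrite Hl. apply sumC_ext. intros j Hj. apply in_seq in Hj.
        unfold T. fold z l. f_equal. f_equal.
        + unfold l, coords_at. rewrite remove_nth_map. reflexivity.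
        + f_equal. f_equal. unfold l, coords_at.
          rewrite nth_indep with (d' := coord 0 zs) by (rewrite length_map; unfold idx; rewrite length_seq; lia).
          rewrite map_nth with (f := fun m => coord m zs). unfold idx. rewrite seq_nth by lia. reflexivity.
      - apply (torus_coord_neq_0 r Hr (S n)); auto. lia.
      - apply (torus_coord_neq_1 r Hr (S n)); auto. lia.
      - intros u Hu. unfold l, coords_at in Hu. apply in_map_iff in Hu. destruct Hu as [m [<- Hm]].
        apply in_seq in Hm. apply (den_neq_0 r b Hr Hb (S n)); auto; lia. }
    rewrite (mci_ext r (S n) (Rlt_le _ _ Hr0) _ (fun zs => (T0 zs + sumC (fun j => T j zs) (seq 0 n))%C)).
    + assert (HlT : lau r (S n) (fun zs => sumC (fun j => T j zs) (seq 0 n))).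
      { apply apx_sumC; auto; [apply additive_zero|lia|]. intros j Hj. apply in_seq in Hj.
        apply (apx_lau _ _ _ _ _ (HT j ltac:(lia))). }
      assert (Hlall : lau r (S n) (fun zs => pairs_AD b zs * exp_prod (a1 :: a) zs)%C) by apply (lau_pairs_exp_prod (a1 :: a)).
      rewrite mci_plus; auto.
      * rewrite mci_sumC; auto.
        2:{ intros j Hj. apply in_seq in Hj. apply (apx_lau _ _ _ _ _ (HT j ltac:(lia))). }
        rewrite (sumC_ext _ (fun j => (0 * 0)%C)).
        2:{ intros j Hj. apply in_seq in Hj.
            rewrite (mci_vanish r Hr0 (S n) (diff_weight 1 1 (S j)) 1); [ring|apply HT; lia|].
            intros e He. unfold diff_weight. rewrite !(isres_spec _ e _ He) by lia. lia. }
        rewrite sumC_mult_l. unfold T0.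
        rewrite (mci_cons_product n (fun z => (Cpowz z a1 / (z - 1))%C) (fun l => (pairs_AD b l * exp_prod a l)%C)).
        2: apply lau_pairs_exp_prod.
        rewrite IH.
        rewrite (mci_ext r 1 (Rlt_le _ _ Hr0) _ (fun zs => Cpowz (coord 0 zs) a1 / (coord 0 zs - 1))%C) by (intros; ring).
        rewrite mci_single by auto. ring.
      (* [T0] is defined by matching on the list; it is approximable as the whole integrand minus
         the other terms. *)
      * apply (apx_ext r _ _ _ (fun zs => (pairs_AD b zs * exp_prod (a1 :: a) zs - sumC (fun j => T j zs) (seq 0 n))%C)).
        2: apply apx_minus; auto; apply additive_zero.
        intros zs Hz. rewrite Hid by auto. ring.
    + exact Hid.
Qed.

End Initial.

(** * Boxes, free evolution and the boundary condition *)

Lemma sumR_ext {A : Type} (f g : A -> R) (l : list A) :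
  (forall a, In a l -> f a = g a) -> sumR f l = sumR g l.
Proof.
  induction l as [|a l IH]; intros H; simpl; auto.
  rewrite H by (left; auto). f_equal. apply IH. intros; apply H; right; auto.
Qed.

Lemma sumR_app {A : Type} (f : A -> R) (l l' : list A) : sumR f (l ++ l') = sumR f l + sumR f l'.
Proof. induction l as [|a l IH]; simpl; [ring|]. rewrite IH; ring. Qed.

Lemma sumR_map {A B : Type} (g : A -> B) (f : B -> R) (l : list A) :
  sumR f (map g l) = sumR (fun a => f (g a)) l.
Proof. induction l as [|a l IH]; simpl; auto. rewrite IH; auto. Qed.

Lemma sumR_flat_map {A B : Type} (g : A -> list B) (f : B -> R) (l : list A) :
  sumR f (flat_map g l) = sumR (fun a => sumR f (g a)) l.
Proof. induction l as [|a l IH]; simpl; auto. rewrite sumR_app, IH; auto. Qed.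

Lemma sumR_scal {A : Type} (c : R) (f : A -> R) (l : list A) :
  sumR (fun a => c * f a) l = c * sumR f l.
Proof. induction l as [|a l IH]; simpl; [ring|]. rewrite IH; ring. Qed.

Lemma sumR_plus {A : Type} (f g : A -> R) (l : list A) :
  sumR (fun a => f a + g a) l = sumR f l + sumR g l.
Proof. induction l as [|a l IH]; simpl; [ring|]. rewrite IH; ring. Qed.

Lemma sumR_minus {A : Type} (f g : A -> R) (l : list A) :
  sumR (fun a => f a - g a) l = sumR f l - sumR g l.
Proof. induction l as [|a l IH]; simpl; [ring|]. rewrite IH; ring. Qed.

Lemma sumR_zero {A : Type} (f : A -> R) (l : list A) :
  (forall a, In a l -> f a = 0) -> sumR f l = 0.
Proof.
  induction l as [|a l IH]; intros H; simpl; auto.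
  rewrite H by (left; auto). rewrite IH; [ring|]. intros; apply H; right; auto.
Qed.

Lemma sumR_le {A : Type} (f g : A -> R) (l : list A) :
  (forall a, In a l -> f a <= g a) -> sumR f l <= sumR g l.
Proof.
  induction l as [|a l IH]; intros H; simpl; [lra|].
  apply Rplus_le_compat; [apply H; left; auto|]. apply IH. intros; apply H; right; auto.
Qed.

Lemma sumR_nonneg {A : Type} (f : A -> R) (l : list A) :
  (forall a, In a l -> 0 <= f a) -> 0 <= sumR f l.
Proof.
  intros H. rewrite <- (sumR_zero (fun _ : A => 0) l) by auto. apply sumR_le; auto.
Qed.

Lemma sumR_Rabs {A : Type} (f : A -> R) (l : list A) : Rabs (sumR f l) <= sumR (fun a => Rabs (f a)) l.
Proof.
  induction l as [|a l IH]; simpl; [rewrite Rabs_R0; lra|].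
  eapply Rle_trans; [apply Rabs_triang|]. lra.
Qed.

Lemma sumR_exchange {A B : Type} (f : A -> B -> R) (l : list A) (l' : list B) :
  sumR (fun a => sumR (f a) l') l = sumR (fun c => sumR (fun a => f a c) l) l'.
Proof.
  induction l as [|a l IH]; simpl.
  - symmetry. apply sumR_zero; auto.
  - rewrite IH, <- sumR_plus. reflexivity.
Qed.

Lemma sumR_single {A : Type} (f : A -> R) (l : list A) (c : A) : NoDup l -> In c l ->
  (forall a, In a l -> a <> c -> f a = 0) -> sumR f l = f c.
Proof.
  intros Hnd Hc H. induction Hnd as [|a l Ha Hnd IH]; [destruct Hc|]. simpl.
  destruct Hc as [->|Hc].
  - rewrite sumR_zero; [ring|]. intros d Hd. apply H; [right; auto|]. intros ->; auto.
  - rewrite IH; auto; [|intros; apply H; auto; right; auto].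
    rewrite H; [ring|left; auto|]. intros ->; auto.
Qed.

(** Both sums equal a double sum over the diagonal of [l'] and [l], evaluated in either order; the
    order of the lists is then immaterial. *)
Lemma sumR_incl {A : Type} (dec : forall u v : A, {u = v} + {u <> v}) (f : A -> R) (l l' : list A) :
  NoDup l -> NoDup l' -> incl l l' -> (forall a, In a l' -> ~ In a l -> f a = 0) ->
  sumR f l' = sumR f l.
Proof.
  intros Hnd Hnd' Hi H.
  transitivity (sumR (fun a => sumR (fun c => if dec a c then f c else 0) l) l').
  - apply sumR_ext. intros a Ha. destruct (in_dec dec a l) as [Hal|Hal].
    + rewrite (sumR_single _ l a); auto.
      * destruct (dec a a); congruence.
      * intros c _ Hc. destruct (dec a c); congruence.
    + rewrite H by auto. symmetry. apply sumR_zero. intros c Hc. destruct (dec a c); congruence.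
  - rewrite sumR_exchange. apply sumR_ext. intros c Hc. rewrite (sumR_single _ l' c); auto.
    + destruct (dec c c); congruence.
    + intros a _ Ha. destruct (dec a c); congruence.
Qed.

(** * Finite boxes of configurations *)

Definition positions_eq_dec := list_eq_dec Nat.eq_dec.

Lemma in_box (bnd z : list nat) : In z (box bnd) <-> Forall2 le z bnd.
Proof.
  revert z. induction bnd as [|a bnd IH]; intros z.
  - simpl. split; [intros [<-|[]]; constructor|]. intros H. inversion H; auto.
  - cbn [box]. rewrite in_flat_map. split.
    + intros [v [Hv Hz]]. apply in_map_iff in Hz. destruct Hz as [t [<- Ht]].
      constructor; [|apply IH; auto]. apply in_seq in Hv. lia.
    + intros H. inversion H as [|v ? t ? Hv Ht]; subst. exists v. split; [apply in_seq; lia|].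
      apply in_map. apply IH; auto.
Qed.

Lemma NoDup_box (bnd : list nat) : NoDup (box bnd).
Proof.
  induction bnd as [|a bnd IH]; [simpl; constructor; auto; constructor|].
  cbn [box]. generalize (seq_NoDup (S a) 0). generalize (seq 0 (S a)).
  intros l Hl. induction Hl as [|v l Hv Hl IHl]; simpl; [constructor|].
  apply NoDup_app; auto.
  - apply FinFun.Injective_map_NoDup; auto. intros s t E. congruence.
  - intros z Hz Hz'. apply in_map_iff in Hz. destruct Hz as [t [<- _]].
    apply in_flat_map in Hz'. destruct Hz' as [v' [Hv' Hz']].
    apply in_map_iff in Hz'. destruct Hz' as [t' [E _]]. injection E; intros; subst. auto.
Qed.

Definition cube (L N : nat) : list (list nat) := box (repeat L N).

Lemma in_cube (L N : nat) (z : list nat) : In z (cube L N) <-> length z = N /\ Forall (fun v => (v <= L)%nat) z.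
Proof.
  unfold cube. rewrite in_box. revert z. induction N as [|N IH]; intros z; simpl.
  - split.
    + intros H; inversion H; auto.
    + intros [H _]. destruct z; [constructor|discriminate].
  - split.
    + intros H. inversion H as [|v ? t ? Hv Ht]; subst. apply IH in Ht. destruct Ht. simpl; auto.
    + intros [H1 H2]. destruct z as [|v t]; [discriminate|]. inversion H2; subst.
      constructor; auto. apply IH. simpl in H1. auto.
Qed.

Lemma cube_mono (L L' N : nat) : (L <= L')%nat -> incl (cube L N) (cube L' N).
Proof.
  intros H z. rewrite !in_cube. intros [H1 H2]. split; auto.
  eapply Forall_impl; [|apply H2]. simpl; intros; lia.
Qed.

Lemma in_cube_max (z : list nat) (L : nat) : (list_max z <= L)%nat -> In z (cube L (length z)).
Proof. intros H. apply in_cube. split; auto. apply list_max_le; auto. Qed.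

Lemma sumR_cube_S (f : list nat -> R) (L N : nat) :
  sumR f (cube L (S N)) = sumR (fun v => sumR (fun z => f (v :: z)) (cube L N)) (seq 0 (S L)).
Proof.
  unfold cube. cbn [repeat box]. rewrite sumR_flat_map. apply sumR_ext. intros v _.
  rewrite sumR_map. reflexivity.
Qed.

Lemma sumR_seq_shift (f : nat -> R) (a n : nat) : sumR f (seq a n) = sumR (fun j => f (a + j)%nat) (seq 0 n).
Proof.
  revert a. induction n as [|n IH]; intros a; [reflexivity|].
  cbn [seq sumR fold_right]. change (fold_right (fun a s => f a + s) 0 (seq (S a) n)) with (sumR f (seq (S a) n)).
  change (fold_right (fun j s => f (a + j)%nat + s) 0 (seq 1 n)) with (sumR (fun j => f (a + j)%nat) (seq 1 n)).
  rewrite (IH (S a)), <- seq_shift, sumR_map, Nat.add_0_r. f_equal.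
  apply sumR_ext. intros j _. f_equal. lia.
Qed.

Lemma sumR_seq_support (h : nat -> R) (a c L : nat) : (a <= c)%nat -> (c <= L)%nat ->
  (forall v, (v <= a)%nat -> h v = 0) -> (forall v, (c < v <= L)%nat -> h v = 0) ->
  sumR h (seq 0 (S L)) = sumR (fun j => h (a + 1 + j)%nat) (seq 0 (c - a)).
Proof.
  intros H1 H2 Ha Hc.
  replace (S L) with ((a + 1) + ((c - a) + (L - c)))%nat by lia.
  rewrite (seq_app (a + 1)), sumR_app, (seq_app (c - a)), sumR_app.
  rewrite (sumR_zero h (seq 0 (a + 1))) by (intros v Hv; apply in_seq in Hv; apply Ha; lia).
  rewrite (sumR_zero h (seq _ (L - c))) by (intros v Hv; apply in_seq in Hv; apply Hc; lia).
  rewrite sumR_seq_shift. simpl. ring.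
Qed.

Lemma sumR_seq_sum_n (h : nat -> R) (n : nat) : sumR h (seq 0 (S n)) = sum_n h n.
Proof.
  induction n as [|n IH].
  - rewrite sum_O. simpl. ring.
  - rewrite seq_S, sumR_app, IH, sum_Sn. unfold plus; simpl. ring.
Qed.

Lemma ex_series_geom_bounded (b B : R) (h : nat -> R) : 0 < b < 1 ->
  (forall j, Rabs (h j) <= B) -> ex_series (fun j => b ^ j * h j).
Proof.
  intros Hb Hh. apply (ex_series_le (K := R_AbsRing) (V := R_CompleteNormedModule) _ (fun j => B * b ^ j)).
  - intros j. change (Rabs (b ^ j * h j) <= B * b ^ j). rewrite Rabs_mult.
    rewrite (Rabs_right (b ^ j)) by (apply Rle_ge, pow_le; lra).
    rewrite Rmult_comm. apply Rmult_le_compat_r; auto. apply pow_le; lra.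
  - apply (ex_series_scal (K := R_AbsRing) (V := R_NormedModule)). exists (/ (1 - b)).
    apply is_series_geom. rewrite Rabs_right; lra.
Qed.

Definition free_jump (b : R) (f : nat -> R) (a : nat) : R :=
  Series (fun j => b ^ j * ((1 - b) * f (a + 1 + j)%nat)).

(** The sum over the particles of the expected value of [f] after an unobstructed jump. There is no
    term [- f]: it is compared with the transition kernel of the uniformized chain, not with its
    generator. *)
Fixpoint free_gen (b : R) (f : list nat -> R) (y : list nat) : R :=
  match y with
  | [] => 0
  | a :: yr => free_jump b (fun v => f (v :: yr)) a + free_gen b (fun z => f (a :: z)) yr
  end.

(* Under this condition the interaction of neighbouring particles can be
   absorbed into the free evolution of an extension of [f] beyond ordered lists. *)
Definition boundary_cond (b : R) (f : list nat -> R) : Prop :=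
  forall pre c suf,
    Series (fun j => b ^ j * f (pre ++ (c + j)%nat :: c :: suf)) =
    Series (fun j => b ^ j * f (pre ++ c :: (c + 1 + j)%nat :: suf)).

Definition bounded_obs (f : list nat -> R) : Prop := exists B, forall z, Rabs (f z) <= B.

Lemma bounded_obs_cons (f : list nat -> R) (a : nat) : bounded_obs f -> bounded_obs (fun z => f (a :: z)).
Proof. intros [B HB]. exists B. auto. Qed.

Lemma boundary_cond_cons (b : R) (f : list nat -> R) (a : nat) :
  boundary_cond b f -> boundary_cond b (fun z => f (a :: z)).
Proof. intros H pre c suf. apply (H (a :: pre) c suf). Qed.

Lemma is_lim_seq_from (u v : nat -> R) (L0 : nat) (l : R) :
  (forall L, (L0 <= L)%nat -> u L = v L) -> is_lim_seq v l -> is_lim_seq u l.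
Proof. intros H. apply is_lim_seq_ext_loc. exists L0. intros; symmetry; auto. Qed.

Lemma casc_single (b : R) (a v : nat) :
  casc b [a] [v] = if Nat.ltb a v then (1 - b) * b ^ (v - a - 1) else 0.
Proof. reflexivity. Qed.

Lemma casc_cons (b : R) (a c : nat) (yr : list nat) (v : nat) (z : list nat) :
  casc b (a :: c :: yr) (v :: z) =
  if (Nat.ltb a v && Nat.ltb v c)%bool then
    (if list_eq_dec Nat.eq_dec (c :: yr) z then (1 - b) * b ^ (v - a - 1) else 0)
  else if Nat.eqb v c then b ^ (c - a - 1) * casc b (c :: yr) z
  else 0.
Proof. reflexivity. Qed.

Lemma sum_f_R0_sumR (h : nat -> R) (n : nat) : sum_f_R0 h n = sumR h (seq 0 (S n)).
Proof.
  induction n as [|n IH]; [simpl; ring|]. rewrite seq_S, sumR_app, <- IH. simpl. ring.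
Qed.

(** A jump that reaches the neighbour at [c] hands over to the particle there, and by induction this
    particle jumps freely from [c]. The boundary condition replaces that by the first particle
    moving on to [c + j] with the second one left at [c], which is the missing tail of its free
    geometric jump. *)
Lemma casc_lim (b : R) (Hb : 0 < b < 1) (yr : list nat) : forall (a : nat) (f : list nat -> R),
  bounded_obs f -> boundary_cond b f -> strictly_increasing (a :: yr) ->
  is_lim_seq (fun L => sumR (fun z => casc b (a :: yr) z * f z) (cube L (S (length yr))))
    (free_jump b (fun v => f (v :: yr)) a).
Proof.
  induction yr as [|c yr IH]; intros a f Hf Hbc Hs.
  - destruct Hf as [B HB].
    assert (Hex : ex_series (fun j => b ^ j * ((1 - b) * f [(a + 1 + j)%nat]))).
    { apply (ex_series_geom_bounded b ((1 - b) * B)); auto. intros j. rewrite Rabs_mult, Rabs_right by lra.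
      apply Rmult_le_compat_l; [lra|auto]. }
    apply Series_correct in Hex. unfold free_jump.
    apply (is_lim_seq_incr_n _ (S a)).
    apply (is_lim_seq_ext (sum_n (fun j => b ^ j * ((1 - b) * f [(a + 1 + j)%nat])))); [|exact Hex].
    intros n. simpl length. rewrite sumR_cube_S.
    rewrite (sumR_ext _ (fun v => casc b [a] [v] * f [v])).
    2:{ intros v _. unfold cube. simpl. ring. }
    rewrite (sumR_seq_support _ a (n + S a)); try lia.
    + replace (n + S a - a)%nat with (S n) by lia. rewrite <- sumR_seq_sum_n. apply sumR_ext.
      intros j _. rewrite casc_single. destruct (Nat.ltb_spec a (a + 1 + j)); [|lia].
      replace (a + 1 + j - a - 1)%nat with j by lia. ring.
    + intros v Hv. rewrite casc_single. destruct (Nat.ltb_spec a v); [lia|ring].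
  - destruct Hs as [Hac Hs].
    pose proof (IH c (fun z => f (c :: z)) (bounded_obs_cons f c Hf) (boundary_cond_cons b f c Hbc) Hs) as IHc.
    set (X := fun L => sumR (fun z => casc b (c :: yr) z * f (c :: z)) (cube L (S (length yr)))) in IHc.
    set (d := (c - a - 1)%nat).
    (* Once the cube contains [c :: yr], the sum over the new first position splits: strictly
       between [a] and [c] nothing is pushed, at [c] the cascade continues, and no other position is
       reached. *)
    apply (is_lim_seq_from _ (fun L => sumR (fun j => (1 - b) * b ^ j * f ((a + 1 + j)%nat :: c :: yr)) (seq 0 d)
       + b ^ d * X L) (Nat.max c (list_max (c :: yr)))).
    + intros L HL. simpl length. rewrite sumR_cube_S.
      rewrite (sumR_seq_support _ a c) by (try lia; intros v Hv; apply sumR_zero; intros z _;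
        rewrite casc_cons; destruct (Nat.ltb_spec a v), (Nat.ltb_spec v c), (Nat.eqb_spec v c); simpl; try lia; ring).
      replace (c - a)%nat with (d + 1)%nat by (unfold d; lia).
      rewrite seq_app, sumR_app. f_equal.
      * apply sumR_ext. intros j Hj. apply in_seq in Hj.
        rewrite (sumR_single _ _ (c :: yr)).
        -- rewrite casc_cons. destruct (Nat.ltb_spec a (a + 1 + j)), (Nat.ltb_spec (a + 1 + j) c);
             try (unfold d in Hj; lia).
           destruct (list_eq_dec Nat.eq_dec (c :: yr) (c :: yr)); [|congruence]. cbn [andb].
           replace (a + 1 + j - a - 1)%nat with j by lia. reflexivity.
        -- apply NoDup_box.
        -- apply (in_cube_max (c :: yr)). lia.
        -- intros z _ Hz. rewrite casc_cons.
           destruct (Nat.ltb_spec a (a + 1 + j)), (Nat.ltb_spec (a + 1 + j) c);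
             try (unfold d in Hj; lia). cbn [andb].
           destruct (list_eq_dec Nat.eq_dec (c :: yr) z); [congruence|ring].
      * cbn [seq sumR fold_right]. rewrite Rplus_0_r. unfold X. rewrite <- sumR_scal.
        replace (a + 1 + (0 + d))%nat with c by (unfold d; lia).
        apply sumR_ext. intros z _. rewrite casc_cons, Nat.ltb_irrefl, Bool.andb_false_r, Nat.eqb_refl.
        unfold d. ring.
    + assert (E : free_jump b (fun v => f (v :: c :: yr)) a =
        sumR (fun j => (1 - b) * b ^ j * f ((a + 1 + j)%nat :: c :: yr)) (seq 0 d)
        + b ^ d * free_jump b (fun v => f (c :: v :: yr)) c).
      { destruct Hf as [B HB].
        assert (Hex : ex_series (fun j => b ^ j * ((1 - b) * f ((a + 1 + j)%nat :: c :: yr)))).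
        { apply (ex_series_geom_bounded b ((1 - b) * B)); auto. intros j. rewrite Rabs_mult, Rabs_right by lra.
          apply Rmult_le_compat_l; [lra|auto]. }
        (* The only use of the boundary condition, for the first two particles. *)
        assert (E1 : free_jump b (fun v => f (c :: v :: yr)) c =
           Series (fun j => b ^ j * ((1 - b) * f ((c + j)%nat :: c :: yr)))).
        { unfold free_jump.
          rewrite (Series_ext _ (fun j => (1 - b) * (b ^ j * f ([] ++ c :: (c + 1 + j)%nat :: yr)))) by (intros; simpl; ring).
          rewrite Series_scal_l, <- Hbc, <- Series_scal_l. apply Series_ext. intros; simpl; ring. }
        rewrite E1. unfold free_jump.
        (* For [d = 0] the neighbour is adjacent and there is no initial segment of the series to
           split off. *)
        destruct d as [|d'] eqn:Hd.
        - simpl. rewrite Rplus_0_l, Rmult_1_l. apply Series_ext. intros j.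
          replace (a + 1 + j)%nat with (c + j)%nat by lia. reflexivity.
        - rewrite (Series_incr_n _ (S d')) by (auto; lia). f_equal.
          + simpl Nat.pred. rewrite sum_f_R0_sumR. apply sumR_ext. intros; ring.
          + rewrite <- Series_scal_l. apply Series_ext. intros j. rewrite pow_add.
            replace (a + 1 + (S d' + j))%nat with (c + j)%nat by lia. ring. }
      rewrite E. apply (is_lim_seq_plus' _ _ _ (b ^ d * free_jump b (fun v => f (c :: v :: yr)) c)).
      * apply is_lim_seq_const.
      * apply (is_lim_seq_scal_l _ (b ^ d) (Finite _)) in IHc. exact IHc.
Qed.

(** * The uniformized chain *)

Lemma strictly_increasing_tail (a : nat) (l : list nat) :
  strictly_increasing (a :: l) -> strictly_increasing l.
Proof. destruct l; simpl; tauto. Qed.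

Lemma strictly_increasing_cons (a : nat) (l : list nat) :
  (a < hd (S a) l)%nat -> strictly_increasing l -> strictly_increasing (a :: l).
Proof. destruct l; simpl; auto. Qed.

Lemma act_cons (b : R) (a : nat) (yr : list nat) (v : nat) (z : list nat) :
  act b (a :: yr) (v :: z) = casc b (a :: yr) (v :: z) + (if Nat.eq_dec a v then act b yr z else 0).
Proof. reflexivity. Qed.

Lemma act_lim (b : R) (Hb : 0 < b < 1) (y : list nat) : forall f,
  bounded_obs f -> boundary_cond b f -> strictly_increasing y ->
  is_lim_seq (fun L => sumR (fun z => act b y z * f z) (cube L (length y))) (free_gen b f y).
Proof.
  induction y as [|a yr IH]; intros f Hf Hbc Hs.
  - apply (is_lim_seq_ext (fun _ => 0)); [|apply is_lim_seq_const]. intros L. unfold cube; simpl. ring.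
  - simpl free_gen. simpl length.
    apply (is_lim_seq_from _ (fun L => sumR (fun z => casc b (a :: yr) z * f z) (cube L (S (length yr)))
       + sumR (fun z => act b yr z * f (a :: z)) (cube L (length yr))) a).
    + intros L HL. rewrite !sumR_cube_S.
      rewrite (sumR_ext _ (fun v => sumR (fun z => casc b (a :: yr) (v :: z) * f (v :: z)) (cube L (length yr)) +
         (if Nat.eq_dec a v then sumR (fun z => act b yr z * f (v :: z)) (cube L (length yr)) else 0))).
      2:{ intros v _. destruct (Nat.eq_dec a v) as [E|E].
          - rewrite <- sumR_plus. apply sumR_ext. intros z _. rewrite act_cons.
            destruct (Nat.eq_dec a v); [ring|congruence].
          - rewrite Rplus_0_r. apply sumR_ext. intros z _. rewrite act_cons.
            destruct (Nat.eq_dec a v); [congruence|ring]. }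
      rewrite sumR_plus. f_equal.
      rewrite (sumR_single _ _ a).
      * destruct (Nat.eq_dec a a); congruence.
      * apply seq_NoDup.
      * apply in_seq. lia.
      * intros v _ Hv. destruct (Nat.eq_dec a v); congruence.
    + apply is_lim_seq_plus'.
      * apply casc_lim; auto.
      * apply (IH (fun z => f (a :: z))); [apply bounded_obs_cons|apply boundary_cond_cons|apply strictly_increasing_tail in Hs]; auto.
Qed.

Lemma casc_nonneg (b : R) (Hb : 0 < b < 1) (y : list nat) : forall z, 0 <= casc b y z.
Proof.
  induction y as [|a yr IH]; intros z; [simpl; lra|].
  assert (Hp : forall n, 0 <= b ^ n) by (intros; apply pow_le; lra).
  assert (Hq : forall n, 0 <= (1 - b) * b ^ n) by (intros; apply Rmult_le_pos; [lra|auto]).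
  destruct yr as [|c yr].
  - destruct z as [|v [|w z]]; try (simpl; lra). rewrite casc_single. destruct (Nat.ltb a v); [auto|lra].
  - destruct z as [|v z]; [simpl; lra|]. rewrite casc_cons.
    destruct (_ && _)%bool; [destruct (list_eq_dec _ _ _); [auto|lra]|].
    destruct (Nat.eqb v c); [|lra]. apply Rmult_le_pos; auto.
Qed.

Lemma act_nonneg (b : R) (Hb : 0 < b < 1) (y : list nat) : forall z, 0 <= act b y z.
Proof.
  induction y as [|a yr IH]; intros z; [simpl; lra|].
  destruct z as [|v z]; [simpl; lra|]. rewrite act_cons.
  apply Rplus_le_le_0_compat; [apply casc_nonneg; auto|]. destruct (Nat.eq_dec a v); [auto|lra].
Qed.

Lemma Forall2_le_refl (l : list nat) : Forall2 le l l.
Proof. induction l; constructor; auto. Qed.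

(** The order survives a cascade because a pushed particle ends strictly beyond the site that its
    pusher takes over; the third conjunct carries this through the induction. *)
Lemma casc_support (b : R) (y : list nat) : forall z,
  strictly_increasing y -> casc b y z <> 0 ->
  strictly_increasing z /\ Forall2 le y z /\ (hd 0 y < hd 0 z)%nat.
Proof.
  induction y as [|a yr IH]; intros z Hs H; [simpl in H; lra|].
  destruct yr as [|c yr].
  - destruct z as [|v [|w z]]; try (simpl in H; lra). rewrite casc_single in H.
    destruct (Nat.ltb_spec a v); [|lra]. simpl. repeat split; auto. constructor; [lia|constructor].
  - destruct z as [|v z]; [simpl in H; lra|]. rewrite casc_cons in H.
    pose proof Hs as [Hac Hs'].
    destruct (Nat.ltb_spec a v), (Nat.ltb_spec v c); cbn [andb] in H.
    + destruct (list_eq_dec Nat.eq_dec (c :: yr) z) as [<-|]; [|lra].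
      repeat split; auto. constructor; [lia|apply Forall2_le_refl].
    + destruct (Nat.eqb_spec v c) as [->|]; [|lra].
      assert (Hc : casc b (c :: yr) z <> 0) by (intros E; apply H; rewrite E; ring).
      destruct (IH z Hs' Hc) as [I1 [I2 I3]].
      split; [|split; [|auto]].
      * apply strictly_increasing_cons; auto. destruct z; simpl in *; lia.
      * constructor; [lia|auto].
    + destruct (Nat.eqb_spec v c); [lia|lra].
    + destruct (Nat.eqb_spec v c); [lia|lra].
Qed.

Lemma act_support (b : R) (y : list nat) : forall z,
  strictly_increasing y -> act b y z <> 0 -> strictly_increasing z /\ Forall2 le y z.
Proof.
  induction y as [|a yr IH]; intros z Hs H; [simpl in H; lra|].
  destruct z as [|v z]; [simpl in H; lra|]. rewrite act_cons in H.
  destruct (Req_dec (casc b (a :: yr) (v :: z)) 0) as [E|E].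
  - rewrite E in H. destruct (Nat.eq_dec a v) as [<-|]; [|lra].
    assert (Ha : act b yr z <> 0) by lra.
    destruct (IH z (strictly_increasing_tail _ _ Hs) Ha) as [H1 H2]. split; [|constructor; auto].
    apply strictly_increasing_cons; auto. inversion H2; subst; simpl in *; lia.
  - destruct (casc_support b _ _ Hs E) as [H1 [H2 _]]. auto.
Qed.

Lemma kern_nonneg (b : R) (N : nat) (y z : list nat) : 0 < b < 1 -> (0 < N)%nat -> 0 <= kern b N y z.
Proof.
  intros Hb HN. unfold kern, Rdiv. apply Rmult_le_pos; [apply act_nonneg; auto|].
  apply Rlt_le, Rinv_0_lt_compat, lt_0_INR; auto.
Qed.

Lemma kern_support (b : R) (N : nat) (y z : list nat) :
  strictly_increasing y -> kern b N y z <> 0 -> strictly_increasing z /\ Forall2 le y z.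
Proof.
  intros Hs H. apply (act_support b); auto. intros E. apply H. unfold kern. rewrite E. unfold Rdiv; ring.
Qed.

Lemma free_gen_one (b : R) (y : list nat) : 0 < b < 1 -> free_gen b (fun _ => 1) y = INR (length y).
Proof.
  intros Hb. induction y as [|a yr IH]; [reflexivity|].
  cbn [free_gen length]. rewrite IH, S_INR. unfold free_jump.
  rewrite (Series_ext _ (fun j => (1 - b) * b ^ j)) by (intros; ring).
  rewrite Series_scal_l, Series_geom by (rewrite Rabs_right; lra). field; lra.
Qed.

Section Chain.

Context (b : R) (N : nat) (Hb : 0 < b < 1) (HN : (0 < N)%nat).

Definition config (y : list nat) : Prop := length y = N /\ strictly_increasing y.

Let HN' : INR N <> 0. Proof. apply not_0_INR; lia. Qed.

Lemma kern_lim (f : list nat -> R) (y : list nat) : bounded_obs f -> boundary_cond b f -> config y ->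
  is_lim_seq (fun L => sumR (fun z => kern b N y z * f z) (cube L N)) (free_gen b f y / INR N).
Proof.
  intros Hf Hbc [Hl Hs].
  apply (is_lim_seq_ext (fun L => / INR N * sumR (fun z => act b y z * f z) (cube L (length y)))).
  - intros L. rewrite <- sumR_scal, Hl. apply sumR_ext. intros z _. unfold kern. field; auto.
  - replace (Finite (free_gen b f y / INR N)) with (Rbar_mult (/ INR N) (free_gen b f y))
      by (simpl; f_equal; field; auto).
    apply is_lim_seq_scal_l, act_lim; auto.
Qed.

Definition mass (L : nat) (y : list nat) : R := sumR (kern b N y) (cube L N).

(** The kernel is stochastic: the constant 1 satisfies the boundary condition trivially and each
    free jump preserves it, so [kern_lim] applies. *)
Lemma mass_lim (y : list nat) : config y -> is_lim_seq (fun L => mass L y) 1.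
Proof.
  intros Hy. replace 1 with (free_gen b (fun _ => 1) y / INR N).
  - apply (is_lim_seq_ext (fun L => sumR (fun z => kern b N y z * 1) (cube L N))).
    + intros L. apply sumR_ext. intros; ring.
    + apply (kern_lim (fun _ => 1)); auto.
      * exists 1. intros. rewrite Rabs_R1; lra.
      * intros pre c suf. reflexivity.
  - rewrite free_gen_one by auto. destruct Hy as [-> _]. field; auto.
Qed.

Lemma sumR_cube_restrict (K L : nat) (f : list nat -> R) : (K <= L)%nat ->
  sumR (fun z => if in_dec positions_eq_dec z (cube K N) then f z else 0) (cube L N) = sumR f (cube K N).
Proof.
  intros HKL. rewrite (sumR_incl positions_eq_dec _ (cube K N)).
  - apply sumR_ext. intros z Hz. destruct (in_dec _ _ _); tauto.
  - apply NoDup_box.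
  - apply NoDup_box.
  - apply cube_mono; auto.
  - intros z _ Hz. destruct (in_dec _ _ _); tauto.
Qed.

Lemma mass_mono (K L : nat) (y : list nat) : (K <= L)%nat -> mass K y <= mass L y.
Proof.
  intros HKL. unfold mass at 1. rewrite <- (sumR_cube_restrict K L) by auto.
  apply sumR_le. intros z _. pose proof (kern_nonneg b N y z Hb HN). destruct (in_dec _ _ _); lra.
Qed.

Lemma mass_le_1 (L : nat) (y : list nat) : config y -> mass L y <= 1.
Proof.
  intros Hy. apply (is_lim_seq_incr_compare (fun L => mass L y)); [apply mass_lim; auto|].
  intros n. apply mass_mono; lia.
Qed.

(** Dominated convergence for the law [kern b N y], with integrand and domain both varying with [L].
    A fixed cube carries all but [eps / (2 * (B + 1))] of the mass; on it there are finitely many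
    pointwise limits, outside it the bound [B] suffices. *)
Lemma dominated_kern_lim (y : list nat) (h : nat -> list nat -> R) (B : R) : config y ->
  (forall L z, config z -> Rabs (h L z) <= B) ->
  (forall z, config z -> is_lim_seq (fun L => h L z) 0) ->
  is_lim_seq (fun L => sumR (fun z => kern b N y z * h L z) (cube L N)) 0.
Proof.
  intros Hy HB Hh. apply is_lim_seq_spec. intros [eps Heps]. simpl.
  assert (HB0 : 0 <= B) by (eapply Rle_trans; [apply Rabs_pos|apply (HB 0%nat y); auto]).
  assert (Hker : forall z L, Rabs (kern b N y z * h L z) <= kern b N y z * B).
  { intros z L. rewrite Rabs_mult, (Rabs_right (kern _ _ _ _)) by (apply Rle_ge, kern_nonneg; auto).
    destruct (Req_dec (kern b N y z) 0) as [->|E]; [lra|].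
    apply Rmult_le_compat_l; [apply kern_nonneg; auto|]. apply HB.
    destruct Hy as [Hy1 Hy2]. destruct (kern_support b N y z Hy2 E) as [H1 H2]. split; auto.
    rewrite <- Hy1. symmetry. eapply Forall2_length; eauto. }
  assert (He : 0 < eps / (2 * (B + 1))) by (apply Rdiv_lt_0_compat; lra).
  pose proof (mass_lim y Hy) as Hm. apply is_lim_seq_spec in Hm.
  destruct (Hm (mkposreal _ He)) as [K HK]. simpl in HK.
  assert (Hfin : is_lim_seq (fun L => sumR (fun z => kern b N y z * h L z) (cube K N)) 0).
  { assert (Hgen : forall l, is_lim_seq (fun L => sumR (fun z => kern b N y z * h L z) l) 0).
    { induction l as [|z l IH]; simpl; [apply is_lim_seq_const|].
      replace 0 with (0 + 0) by ring. apply is_lim_seq_plus'; auto.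
      destruct (Req_dec (kern b N y z) 0) as [->|E].
      - apply (is_lim_seq_ext (fun _ => 0)); [intros; ring|apply is_lim_seq_const].
      - replace (Finite 0) with (Rbar_mult (kern b N y z) 0) by (simpl; f_equal; ring).
        apply is_lim_seq_scal_l, Hh.
        destruct Hy as [Hy1 Hy2]. destruct (kern_support b N y z Hy2 E) as [H1 H2]. split; auto.
        rewrite <- Hy1. symmetry. eapply Forall2_length; eauto. }
    apply Hgen. }
  apply is_lim_seq_spec in Hfin. assert (He2 : 0 < eps / 2) by lra.
  destruct (Hfin (mkposreal _ He2)) as [L0 HL0]. simpl in HL0.
  exists (Nat.max K L0). intros L HL.
  specialize (HL0 L ltac:(lia)). rewrite Rminus_0_r in *.
  set (Sk := sumR (fun z => kern b N y z * h L z) (cube K N)) in *.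
  assert (Hdiff : Rabs (sumR (fun z => kern b N y z * h L z) (cube L N) - Sk) <= B * (mass L y - mass K y)).
  { unfold Sk, mass. rewrite <- !(sumR_cube_restrict K L) by lia.
    rewrite <- !sumR_minus, <- sumR_scal. eapply Rle_trans; [apply sumR_Rabs|].
    apply sumR_le. intros z _. destruct (in_dec _ _ _).
    - rewrite !Rminus_diag, Rabs_R0. lra.
    - rewrite !Rminus_0_r, (Rmult_comm B). apply Hker. }
  assert (Hmm : mass L y - mass K y <= eps / (2 * (B + 1))).
  { pose proof (mass_le_1 L y Hy). specialize (HK K ltac:(lia)).
    apply Rabs_def2 in HK. lra. }
  assert (Hbb : B * (mass L y - mass K y) <= eps / 2).
  { pose proof (mass_mono K L y ltac:(lia)).
    apply Rle_trans with ((B + 1) * (eps / (2 * (B + 1)))).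
    - apply Rmult_le_compat; lra.
    - right. field. lra. }
  replace (sumR (fun z => kern b N y z * h L z) (cube L N))
    with ((sumR (fun z => kern b N y z * h L z) (cube L N) - Sk) + Sk) by ring.
  eapply Rle_lt_trans; [apply Rabs_triang|]. lra.
Qed.

Lemma kern_pow_support (n : nat) (y z : list nat) : config y -> kern_pow b N n y z <> 0 -> config z.
Proof.
  intros Hy. revert z. induction n as [|n IH]; intros z H; simpl in H.
  - destruct (list_eq_dec Nat.eq_dec y z); [subst; auto|lra].
  - destruct (excluded_middle_informative (config z)) as [|Hz]; auto.
    exfalso. apply H. apply sumR_zero. intros w _.
    destruct (Req_dec (kern_pow b N n y w) 0) as [->|E]; [ring|].
    destruct (Req_dec (kern b N w z) 0) as [->|E2]; [ring|].
    exfalso. apply Hz. destruct (IH w E) as [H1 H2].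
    destruct (kern_support b N w z H2 E2) as [H3 H4]. split; auto.
    rewrite <- H1. symmetry. eapply Forall2_length; eauto.
Qed.

Lemma kern_pow_S_cube (n L : nat) (y x : list nat) : config y -> In x (cube L N) ->
  kern_pow b N (S n) y x = sumR (fun z => kern_pow b N n y z * kern b N z x) (cube L N).
Proof.
  intros Hy Hx. simpl. symmetry. apply (sumR_incl positions_eq_dec); try apply NoDup_box.
  - intros z Hz. apply in_box in Hz. apply in_cube in Hx. apply in_cube.
    destruct Hx as [Hx1 Hx2]. split.
    + rewrite <- Hx1. eapply Forall2_length; eauto.
    + clear Hx1. induction Hz; inversion Hx2; subst; constructor; auto. lia.
  - intros z _ Hz.
    destruct (Req_dec (kern_pow b N n y z) 0) as [->|E]; [ring|].
    destruct (Req_dec (kern b N z x) 0) as [->|E2]; [ring|].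
    exfalso. apply Hz. apply in_box.
    destruct (kern_pow_support n y z Hy E) as [H1 H2].
    apply (kern_support b N z x H2 E2).
Qed.

(** [kern_pow] appends steps at the end, whereas the recursion in the starting point splits off the
    first one. A common cube in place of the boxes [box x] allows the two summations to be
    exchanged. *)
Lemma kern_pow_backward (n L : nat) (y x : list nat) : config y -> In x (cube L N) ->
  kern_pow b N (S n) y x = sumR (fun z => kern b N y z * kern_pow b N n z x) (cube L N).
Proof.
  intros Hy. revert x. induction n as [|n IH]; intros x Hx.
  - rewrite (kern_pow_S_cube 0 L) by auto.
    rewrite (sumR_single (fun z => kern b N y z * _) _ x).
    + simpl. destruct (list_eq_dec Nat.eq_dec x x); [|congruence]. rewrite Rmult_1_r.
      destruct (in_dec positions_eq_dec y (cube L N)) as [Hin|Hin].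
      * rewrite (sumR_single _ _ y); [|apply NoDup_box|auto|].
        -- destruct (list_eq_dec Nat.eq_dec y y); [ring|congruence].
        -- intros z _ Hz. destruct (list_eq_dec Nat.eq_dec y z); [congruence|ring].
      * rewrite sumR_zero.
        -- symmetry. destruct (Req_dec (kern b N y x) 0) as [|E]; auto. exfalso. apply Hin.
           destruct Hy as [Hy1 Hy2]. destruct (kern_support b N y x Hy2 E) as [_ H2].
           apply in_cube in Hx. destruct Hx as [_ Hx]. apply in_cube. split; auto.
           clear - H2 Hx. induction H2; inversion Hx; subst; constructor; auto. lia.
        -- intros z Hz. destruct (list_eq_dec Nat.eq_dec y z); [subst; tauto|ring].
    + apply NoDup_box.
    + auto.
    + intros z _ Hz. simpl. destruct (list_eq_dec Nat.eq_dec z x); [congruence|ring].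
  - rewrite (kern_pow_S_cube (S n) L) by auto.
    rewrite (sumR_ext _ (fun w => sumR (fun z => kern b N y z * (kern_pow b N n z w * kern b N w x)) (cube L N))).
    2:{ intros w Hw. rewrite (IH w Hw), Rmult_comm, <- sumR_scal. apply sumR_ext. intros; ring. }
    rewrite sumR_exchange. apply sumR_ext. intros z Hz. rewrite sumR_scal.
    destruct (Req_dec (kern b N y z) 0) as [->|E]; [ring|]. f_equal.
    symmetry. apply kern_pow_S_cube; auto.
    destruct Hy as [Hy1 Hy2]. destruct (kern_support b N y z Hy2 E) as [H1 H2]. split; auto.
    rewrite <- Hy1. symmetry. eapply Forall2_length; eauto.
Qed.

Section Observable.

Context (m : nat) (x : Z).

Definition at_site (z : list nat) : R :=
  if Z.eq_dec (Z.of_nat (nth (m - 1) z 0%nat)) x then 1 else 0.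

Definition truncated (L n : nat) (y : list nat) : R :=
  sumR (fun z => at_site z * kern_pow b N n y z) (cube L N).

Lemma truncated_S (L n : nat) (y : list nat) : config y ->
  truncated L (S n) y = sumR (fun z => kern b N y z * truncated L n z) (cube L N).
Proof.
  intros Hy. unfold truncated.
  rewrite (sumR_ext _ (fun w => sumR (fun z => kern b N y z * (at_site w * kern_pow b N n z w)) (cube L N))).
  - rewrite sumR_exchange. apply sumR_ext. intros z _. rewrite sumR_scal. reflexivity.
  - intros w Hw. rewrite (kern_pow_backward n L) by auto. rewrite <- sumR_scal. apply sumR_ext. intros; ring.
Qed.

Lemma kern_pow_nonneg (n : nat) (y z : list nat) : 0 <= kern_pow b N n y z.
Proof.
  revert z. induction n as [|n IH]; intros z; simpl.
  - destruct (list_eq_dec _ _ _); lra.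
  - apply sumR_nonneg. intros w _. apply Rmult_le_pos; auto. apply kern_nonneg; auto.
Qed.

Lemma truncated_0 (L : nat) (y : list nat) : config y ->
  truncated L 0 y = if in_dec positions_eq_dec y (cube L N) then at_site y else 0.
Proof.
  intros Hy. unfold truncated. simpl. destruct (in_dec _ _ _) as [H|H].
  - rewrite (sumR_single _ _ y); [|apply NoDup_box|auto|].
    + destruct (list_eq_dec _ _ _); [ring|congruence].
    + intros z _ Hz. destruct (list_eq_dec _ _ _); [congruence|ring].
  - apply sumR_zero. intros z Hz. destruct (list_eq_dec _ _ _); [subst; tauto|ring].
Qed.

Lemma at_site_range (z : list nat) : 0 <= at_site z <= 1.
Proof. unfold at_site. destruct (Z.eq_dec _ _); lra. Qed.

Lemma truncated_range (L n : nat) (y : list nat) : config y -> 0 <= truncated L n y <= 1.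
Proof.
  intros Hy. split.
  - apply sumR_nonneg. intros z _. apply Rmult_le_pos; [apply at_site_range|apply kern_pow_nonneg].
  - revert y Hy. induction n as [|n IH]; intros y Hy.
    + rewrite truncated_0 by auto. destruct (in_dec _ _ _); [apply at_site_range|lra].
    + rewrite truncated_S by auto. eapply Rle_trans; [|apply (mass_le_1 L y Hy)].
      unfold mass. apply sumR_le. intros z _.
      destruct (Req_dec (kern b N y z) 0) as [->|E]; [lra|].
      rewrite <- (Rmult_1_r (kern b N y z)) at 2. apply Rmult_le_compat_l; [apply kern_nonneg; auto|].
      apply IH. destruct Hy as [Hy1 Hy2]. destruct (kern_support b N y z Hy2 E) as [H1 H2]. split; auto.
      rewrite <- Hy1. symmetry. eapply Forall2_length; eauto.
Qed.

(* [kappa = 1] and [kappa = 0] serve for real and imaginary parts. *)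
Lemma truncated_lim (kappa : R) (f : nat -> list nat -> R) :
  (forall n, bounded_obs (f n)) -> (forall n, boundary_cond b (f n)) ->
  (forall n y, config y -> free_gen b (f n) y = INR N * f (S n) y) ->
  (forall y, config y -> f 0%nat y = kappa * at_site y) ->
  forall n y, config y -> is_lim_seq (fun L => kappa * truncated L n y) (f n y).
Proof.
  intros Hbd Hbc Hgen H0 n. induction n as [|n IH]; intros y Hy.
  - apply (is_lim_seq_from _ (fun _ => f 0%nat y) (list_max y)); [|apply is_lim_seq_const].
    intros L HL. rewrite truncated_0, H0 by auto.
    destruct (in_dec _ _ _) as [_|H]; auto. exfalso. apply H.
    destruct Hy as [<- _]. apply in_cube_max; auto.
  - destruct (Hbd n) as [B HB].
    pose proof (kern_lim (f n) y (Hbd n) (Hbc n) Hy) as H1.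
    rewrite Hgen in H1 by auto.
    replace (INR N * f (S n) y / INR N) with (f (S n) y) in H1 by (field; auto).
    (* The kernel applied to [f n] is covered by [kern_lim]. The error [kappa * truncated - f n] is
       bounded and tends to 0 pointwise by induction, so its kernel sum vanishes in the limit. *)
    assert (H2 : is_lim_seq (fun L => sumR (fun z => kern b N y z * (kappa * truncated L n z - f n z)) (cube L N)) 0).
    { apply (dominated_kern_lim y _ (Rabs kappa + B)); auto.
      - intros L z Hz. eapply Rle_trans; [apply Rabs_triang|].
        rewrite Rabs_Ropp, Rabs_mult. apply Rplus_le_compat; auto.
        destruct (truncated_range L n z Hz). rewrite (Rabs_right (truncated _ _ _)) by lra.
        rewrite <- (Rmult_1_r (Rabs kappa)) at 2. apply Rmult_le_compat_l; auto. apply Rabs_pos.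
      - intros z Hz. replace 0 with (f n z - f n z) by ring.
        apply is_lim_seq_minus'; [apply IH; auto|apply is_lim_seq_const]. }
    pose proof (is_lim_seq_plus' _ _ _ _ H1 H2) as H3. rewrite Rplus_0_r in H3.
    eapply is_lim_seq_ext; [|exact H3]. intros L. simpl.
    rewrite <- sumR_plus, truncated_S, <- sumR_scal by auto. apply sumR_ext. intros; ring.
Qed.

End Observable.

End Chain.

(** * Sums over subsets *)

(* The sum of [b ^ kappa * g] over the subsequences of [y], where the entries of
   [y] are indexed from [s] on. *)
Fixpoint subset_sum (b : R) (s : nat) (y : list nat) (g : list nat -> R) : R :=
  match y with
  | [] => g []
  | a :: yr => b ^ s * subset_sum b (S s) yr (fun z => g (a :: z)) + subset_sum b (S s) yr g
  end.

Lemma subset_sum_ext (b : R) (y : list nat) : forall s g h, (forall z, g z = h z) ->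
  subset_sum b s y g = subset_sum b s y h.
Proof.
  induction y as [|a y IH]; intros s g h H; simpl; auto.
  rewrite (IH (S s) g h), (IH (S s) (fun z => g (a :: z)) (fun z => h (a :: z))); auto.
Qed.

Lemma subset_sum_plus (b : R) (y : list nat) : forall s g h,
  subset_sum b s y (fun z => g z + h z) = subset_sum b s y g + subset_sum b s y h.
Proof.
  induction y as [|a y IH]; intros s g h; simpl; auto.
  rewrite (IH (S s) g h), (IH (S s) (fun z => g (a :: z)) (fun z => h (a :: z))); ring.
Qed.

Lemma subset_sum_scal (b c : R) (y : list nat) : forall s g,
  subset_sum b s y (fun z => c * g z) = c * subset_sum b s y g.
Proof.
  induction y as [|a y IH]; intros s g; simpl; auto.
  rewrite (IH (S s) g), (IH (S s) (fun z => g (a :: z))); ring.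
Qed.

(** The total weight of the subsets is the product of the [1 + b ^ i], at most the exponential of
    the geometric sum [b ^ s / (1 - b)]. The bound does not depend on the length of [y]. *)
Lemma subset_sum_bound (b B : R) (y : list nat) : 0 < b < 1 -> 0 <= B -> forall s g,
  (forall z, Rabs (g z) <= B) -> Rabs (subset_sum b s y g) <= B * exp (b ^ s / (1 - b)).
Proof.
  intros Hb HB. assert (Hp : forall s, 0 < b ^ s / (1 - b)).
  { intros s. apply Rdiv_lt_0_compat; [apply pow_lt; lra|lra]. }
  induction y as [|a y IH]; intros s g H; simpl.
  - eapply Rle_trans; [apply H|]. rewrite <- (Rmult_1_r B) at 1.
    apply Rmult_le_compat_l; auto. pose proof (exp_ineq1_le (b ^ s / (1 - b))). specialize (Hp s). lra.
  - assert (Hbs : 0 < b ^ s) by (apply pow_lt; lra).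
    eapply Rle_trans; [apply Rabs_triang|]. rewrite Rabs_mult, (Rabs_right (b ^ s)) by lra.
    pose proof (IH (S s) g H) as I1. pose proof (IH (S s) (fun z => g (a :: z)) (fun z => H (a :: z))) as I2.
    set (X := B * exp (b ^ S s / (1 - b))) in *.
    apply Rle_trans with ((1 + b ^ s) * X).
    + pose proof (Rmult_le_compat_l (b ^ s) _ _ (Rlt_le _ _ Hbs) I2). lra.
    + replace (b ^ s / (1 - b)) with (b ^ s + b ^ S s / (1 - b)) by (simpl; field; lra).
      rewrite exp_plus. unfold X.
      replace ((1 + b ^ s) * (B * exp (b ^ S s / (1 - b)))) with (B * ((1 + b ^ s) * exp (b ^ S s / (1 - b)))) by ring.
      apply Rmult_le_compat_l; auto. apply Rmult_le_compat_r; [apply Rlt_le, exp_pos|]. apply exp_ineq1_le.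
Qed.

Lemma subset_sum_bounded (b : R) (s : nat) (g : list nat -> R) : 0 < b < 1 ->
  bounded_obs g -> bounded_obs (fun y => subset_sum b s y g).
Proof.
  intros Hb [B HB]. exists (B * exp (b ^ s / (1 - b))). intros y.
  apply subset_sum_bound; auto. eapply Rle_trans; [apply Rabs_pos|apply (HB [])].
Qed.

Lemma Series_geom_const (b c : R) : 0 < b < 1 -> Series (fun j => b ^ j * c) = c / (1 - b).
Proof.
  intros Hb. rewrite Series_scal_r, Series_geom by (rewrite Rabs_right; lra). field; lra.
Qed.

Lemma Series_subset_sum (b B : R) (y : list nat) : 0 < b < 1 -> forall s (h : nat -> list nat -> R),
  (forall j z, Rabs (h j z) <= B) ->
  Series (fun j => b ^ j * subset_sum b s y (h j)) =
  subset_sum b s y (fun z => Series (fun j => b ^ j * h j z)).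
Proof.
  intros Hb. induction y as [|a y IH]; intros s h Hh; [reflexivity|]. simpl.
  assert (HB0 : 0 <= B) by (eapply Rle_trans; [apply Rabs_pos|apply (Hh 0%nat [])]).
  rewrite (Series_ext _ (fun j => b ^ s * (b ^ j * subset_sum b (S s) y (fun z => h j (a :: z)))
     + b ^ j * subset_sum b (S s) y (h j))) by (intros; ring).
  rewrite Series_plus.
  - rewrite Series_scal_l, (IH (S s) h), (IH (S s) (fun j z => h j (a :: z))) by auto. reflexivity.
  - apply (ex_series_scal (K := R_AbsRing) (V := R_NormedModule)).
    apply (ex_series_geom_bounded b (B * exp (b ^ S s / (1 - b)))); auto.
    intros j. apply subset_sum_bound; auto.
  - apply (ex_series_geom_bounded b (B * exp (b ^ S s / (1 - b)))); auto.
    intros j. apply subset_sum_bound; auto.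
Qed.

(** Subsets that contain both neighbours use the condition on [g]; those that contain neither agree
    on both sides. For those with exactly one, put [g0 = g (c :: z)] and let [T] be the series of
    [b ^ j * g ((c + 1 + j) :: z)]: up to [b ^ s] the sides are [(g0 + b * T) + b * g0 / (1 - b)]
    and [g0 / (1 - b) + b * T], which agree thanks to the ratio [b] of the two weights. *)
Lemma subset_sum_boundary (b : R) (g : list nat -> R) : 0 < b < 1 -> bounded_obs g ->
  boundary_cond b g -> forall s, boundary_cond b (fun y => subset_sum b s y g).
Proof.
  intros Hb Hg Hbc s pre c suf. revert s g Hg Hbc.
  induction pre as [|a pre IH]; intros s g Hg Hbc; simpl app.
  - destruct Hg as [B HB].
    cbn [subset_sum].
    set (W := subset_sum b (S (S s)) suf).
    assert (HexB : forall h : nat -> list nat -> R, (forall j z, Rabs (h j z) <= B) ->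
        ex_series (fun j => b ^ j * W (h j))).
    { intros h Hh. apply (ex_series_geom_bounded b (B * exp (b ^ S (S s) / (1 - b)))); auto.
      intros j. apply subset_sum_bound; auto. eapply Rle_trans; [apply Rabs_pos|apply (HB [])]. }
    (* [h1] to [h4] stand for the subsets that contain both neighbours, only the left one, only the
       right one, or neither. *)
    assert (HS : forall h1 h2 h3 h4 : nat -> list nat -> R,
       (forall j z, Rabs (h1 j z) <= B) -> (forall j z, Rabs (h2 j z) <= B) ->
       (forall j z, Rabs (h3 j z) <= B) -> (forall j z, Rabs (h4 j z) <= B) ->
       Series (fun j => b ^ j * (b ^ s * (b ^ S s * W (h1 j) + W (h2 j)) + (b ^ S s * W (h3 j) + W (h4 j)))) =
       W (fun z => b ^ s * (b ^ S s * Series (fun j => b ^ j * h1 j z) + Series (fun j => b ^ j * h2 j z))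
         + (b ^ S s * Series (fun j => b ^ j * h3 j z) + Series (fun j => b ^ j * h4 j z)))).
    { intros h1 h2 h3 h4 H1 H2 H3 H4.
      rewrite (Series_ext _ (fun j => (b ^ s * b ^ S s) * (b ^ j * W (h1 j)) + (b ^ s * (b ^ j * W (h2 j)) +
         (b ^ S s * (b ^ j * W (h3 j)) + b ^ j * W (h4 j))))) by (intros; ring).
      pose proof (HexB h1 H1) as E1. pose proof (HexB h2 H2) as E2. pose proof (HexB h3 H3) as E3.
      pose proof (HexB h4 H4) as E4.
      pose proof (ex_series_scal (K := R_AbsRing) (V := R_NormedModule) (b ^ s * b ^ S s) _ E1) as F1.
      pose proof (ex_series_scal (K := R_AbsRing) (V := R_NormedModule) (b ^ s) _ E2) as F2.
      pose proof (ex_series_scal (K := R_AbsRing) (V := R_NormedModule) (b ^ S s) _ E3) as F3.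
      pose proof (ex_series_plus (K := R_AbsRing) (V := R_NormedModule) _ _ F3 E4) as F4.
      pose proof (ex_series_plus (K := R_AbsRing) (V := R_NormedModule) _ _ F2 F4) as F5.
      rewrite Series_plus by auto. rewrite Series_plus by auto. rewrite Series_plus by auto.
      rewrite !Series_scal_l. unfold W.
      rewrite !(Series_subset_sum b B) by auto.
      rewrite !subset_sum_plus, !subset_sum_scal, !subset_sum_plus, !subset_sum_scal. ring. }
    etransitivity; [apply (HS (fun j z => g ((c + j)%nat :: c :: z)) (fun j z => g ((c + j)%nat :: z)) (fun _ z => g (c :: z)) (fun _ z => g z)); auto|].
    etransitivity; [|symmetry; apply (HS (fun j z => g (c :: (c + 1 + j)%nat :: z)) (fun j z => g (c :: z)) (fun j z => g ((c + 1 + j)%nat :: z)) (fun _ z => g z)); auto].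
    apply subset_sum_ext. intros z.
    pose proof (Hbc [] c z) as Hbc0. cbn [app] in Hbc0. rewrite Hbc0, !Series_geom_const by auto.
    assert (E : Series (fun j => b ^ j * g ((c + j)%nat :: z)) =
       g (c :: z) + b * Series (fun j => b ^ j * g ((c + 1 + j)%nat :: z))).
    { rewrite Series_incr_1 by (apply (ex_series_geom_bounded b B); auto).
      rewrite Nat.add_0_r, <- Series_scal_l. simpl pow at 1. rewrite Rmult_1_l. f_equal.
      apply Series_ext. intros j. replace (c + S j)%nat with (c + 1 + j)%nat by lia. simpl; ring. }
    rewrite E. simpl. field. lra.
  - pose proof (IH (S s) g Hg Hbc) as I1.
    pose proof (IH (S s) (fun z => g (a :: z)) (bounded_obs_cons g a Hg) (boundary_cond_cons b g a Hbc)) as I2.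
    cbn [subset_sum].
    assert (HE : forall (q : nat -> list nat),
       Series (fun j => b ^ j * (b ^ s * subset_sum b (S s) (q j) (fun z => g (a :: z)) + subset_sum b (S s) (q j) g)) =
       b ^ s * Series (fun j => b ^ j * subset_sum b (S s) (q j) (fun z => g (a :: z))) +
       Series (fun j => b ^ j * subset_sum b (S s) (q j) g)).
    { intros q.
      destruct (subset_sum_bounded b (S s) g Hb Hg) as [B1 HB1].
      destruct (subset_sum_bounded b (S s) _ Hb (bounded_obs_cons g a Hg)) as [B2 HB2].
      rewrite <- Series_scal_l, <- Series_plus.
      - apply Series_ext; intros; ring.
      - apply (ex_series_scal (K := R_AbsRing) (V := R_NormedModule)).
        apply (ex_series_geom_bounded b B2); auto.
      - apply (ex_series_geom_bounded b B1); auto. }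
    rewrite (HE (fun j => pre ++ (c + j)%nat :: c :: suf)), (HE (fun j => pre ++ c :: (c + 1 + j)%nat :: suf)).
    rewrite I1, I2. reflexivity.
Qed.

Lemma ex_free_jump (b : R) (f : nat -> R) (a : nat) (B : R) : 0 < b < 1 -> (forall v, Rabs (f v) <= B) ->
  ex_series (fun j => b ^ j * ((1 - b) * f (a + 1 + j)%nat)).
Proof.
  intros Hb HB. apply (ex_series_geom_bounded b ((1 - b) * B)); auto.
  intros j. rewrite Rabs_mult, Rabs_right by lra. apply Rmult_le_compat_l; [lra|auto].
Qed.

Lemma free_jump_linear (b c : R) (f h : nat -> R) (a : nat) (B B' : R) : 0 < b < 1 ->
  (forall v, Rabs (f v) <= B) -> (forall v, Rabs (h v) <= B') ->
  free_jump b (fun v => c * f v + h v) a = c * free_jump b f a + free_jump b h a.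
Proof.
  intros Hb Hf Hh. unfold free_jump.
  rewrite <- Series_scal_l, <- Series_plus.
  - apply Series_ext; intros; ring.
  - apply (ex_series_scal (K := R_AbsRing) (V := R_NormedModule)). apply (ex_free_jump b f a B); auto.
  - apply (ex_free_jump b h a B'); auto.
Qed.

Lemma free_gen_linear (b c : R) (y : list nat) : 0 < b < 1 -> forall f h,
  bounded_obs f -> bounded_obs h ->
  free_gen b (fun z => c * f z + h z) y = c * free_gen b f y + free_gen b h y.
Proof.
  intros Hb. induction y as [|a y IH]; intros f h Hf Hh; simpl; [ring|].
  rewrite (IH (fun z => f (a :: z)) (fun z => h (a :: z))) by (apply bounded_obs_cons; auto).
  destruct Hf as [B HB], Hh as [B' HB'].
  rewrite (free_jump_linear b c (fun v => f (v :: y)) (fun v => h (v :: y)) a B B') by auto. ring.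
Qed.

Lemma free_jump_const (b c : R) (a : nat) : 0 < b < 1 -> free_jump b (fun _ => c) a = c.
Proof.
  intros Hb. unfold free_jump. rewrite Series_geom_const by auto. field; lra.
Qed.

(** The jump of a particle outside the subset leaves the summand unchanged and contributes it once;
    this is the source of the term [INR N - INR (length zs)] in [rate_symbol]. *)
Lemma free_gen_subset_sum (b : R) (y : list nat) : 0 < b < 1 -> forall s g, bounded_obs g ->
  free_gen b (fun z => subset_sum b s z g) y =
  subset_sum b s y (fun z => free_gen b g z + (INR (length y) - INR (length z)) * g z).
Proof.
  intros Hb. induction y as [|a y IH]; intros s g Hg.
  - simpl. ring.
  - cbn [free_gen subset_sum].
    pose proof (bounded_obs_cons g a Hg) as Hga.
    destruct (subset_sum_bounded b (S s) g Hb Hg) as [B1 HB1].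
    rewrite (free_gen_linear b (b ^ s) y Hb (fun z => subset_sum b (S s) z (fun w => g (a :: w))) (fun z => subset_sum b (S s) z g))
      by (apply subset_sum_bounded; auto).
    rewrite !IH by auto.
    assert (E : free_jump b (fun v => b ^ s * subset_sum b (S s) y (fun z => g (v :: z)) + subset_sum b (S s) y g) a
      = b ^ s * subset_sum b (S s) y (fun z => free_jump b (fun v => g (v :: z)) a) + subset_sum b (S s) y g).
    { destruct Hg as [B HB].
      assert (HB0 : 0 <= B) by (eapply Rle_trans; [apply Rabs_pos|apply (HB [])]).
      rewrite (free_jump_linear b (b ^ s) (fun v => subset_sum b (S s) y (fun z => g (v :: z))) (fun _ => subset_sum b (S s) y g)
        a (B * exp (b ^ S s / (1 - b))) B1 Hb); [|intros; apply subset_sum_bound; auto|auto].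
      rewrite free_jump_const by auto. f_equal. f_equal.
      unfold free_jump.
      rewrite (Series_ext _ (fun j => (1 - b) * (b ^ j * subset_sum b (S s) y (fun z => g ((a + 1 + j)%nat :: z))))) by (intros; ring).
      rewrite Series_scal_l, (Series_subset_sum b B y Hb (S s) (fun j z => g ((a + 1 + j)%nat :: z))) by auto.
      rewrite <- subset_sum_scal. apply subset_sum_ext. intros z. rewrite <- Series_scal_l.
      apply Series_ext. intros; ring. }
    rewrite E.
    rewrite (subset_sum_ext b y (S s) (fun z => free_jump b (fun v => g (v :: z)) a + free_gen b (fun w => g (a :: w)) z
        + (INR (length (a :: y)) - INR (length (a :: z))) * g (a :: z))
      (fun z => free_jump b (fun v => g (v :: z)) a + (free_gen b (fun w => g (a :: w)) z
        + (INR (length y) - INR (length z)) * g (a :: z))))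
      by (intros z; cbn [length]; rewrite !S_INR; ring).
    rewrite (subset_sum_ext b y (S s) (fun z => free_gen b g z + (INR (length (a :: y)) - INR (length z)) * g z)
      (fun z => g z + (free_gen b g z + (INR (length y) - INR (length z)) * g z)))
      by (intros z; cbn [length]; rewrite !S_INR; ring).
    rewrite !(subset_sum_plus b y (S s) (fun z => free_jump b (fun v => g (v :: z)) a)), !(subset_sum_plus b y (S s) g). ring.
Qed.

(* The factor [X^-s] with [X = b^length] turns the sum over subsets into the
   product of the [1 - b^(i - s)], one of which vanishes. *)
Lemma subset_sum_vanish (b : R) (l : list nat) (cs : list R) (s : nat) : 0 < b < 1 ->
  (length cs < s <= length l)%nat ->
  subset_sum b 1 l (fun z => (-1) ^ length z * / b ^ (s * length z)
     * fold_right (fun c p => (1 - c * b ^ length z) * p) 1 cs) = 0.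
Proof.
  intros Hb. revert s. induction cs as [|c cs IH]; intros s Hs; simpl length in Hs.
  - assert (Hprod : forall l i, subset_sum b i l (fun z => (-1) ^ length z * / b ^ (s * length z)) =
       fold_right (fun j p => (1 - b ^ j * / b ^ s) * p) 1 (seq i (length l))).
    { clear. intros l. induction l as [|a l IH]; intros i.
      - simpl. rewrite Nat.mul_0_r. simpl. field.
      - cbn [subset_sum length seq fold_right].
        rewrite (subset_sum_ext b l (S i) _ (fun z => (- / b ^ s) * ((-1) ^ length z * / b ^ (s * length z)))).
        + rewrite subset_sum_scal, IH. ring.
        + intros z. rewrite Nat.mul_succ_r, pow_add, Rinv_mult. simpl. ring. }
    rewrite (subset_sum_ext b l 1 _ (fun z => (-1) ^ length z * / b ^ (s * length z))) by (intros; simpl; ring).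
    rewrite Hprod.
    assert (Hin : In s (seq 1 (length l))) by (apply in_seq; lia).
    assert (Hb' : b ^ s <> 0) by (apply pow_nonzero; lra).
    clear - Hin Hb'. induction (seq 1 (length l)) as [|j q IHq]; [destruct Hin|]. simpl.
    destruct Hin as [->|Hin].
    + rewrite Rinv_r by auto. ring.
    + rewrite IHq by auto. ring.
  - assert (Hnz : forall n, b ^ n <> 0) by (intros; apply pow_nonzero; lra).
    destruct s as [|s]; [lia|].
    (* Multiplying by [c * b ^ length z] lowers [S s] to [s], so each root costs at most one unit of
       [s]; since [length cs < s], the exponent stays positive down to the base case. *)
    rewrite (subset_sum_ext b l 1 _ (fun z => (-1) ^ length z * / b ^ (S s * length z)
       * fold_right (fun c p => (1 - c * b ^ length z) * p) 1 cs + (- c) * ((-1) ^ length z * / b ^ (s * length z)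
       * fold_right (fun c p => (1 - c * b ^ length z) * p) 1 cs))).
    + rewrite subset_sum_plus, subset_sum_scal, !IH by lia. ring.
    + intros z. cbn [fold_right]. rewrite Nat.mul_succ_l, pow_add.
      set (F := fold_right _ _ _). field. split; auto.
Qed.

(** * Superpositions of plane waves *)

Section Lau.

Context (r : R) (Hr : 4 <= r) (k : nat).

Let Hr0 : 0 < r. Proof. lra. Qed.

Lemma lau_mult (F G : list C -> C) : lau r k F -> lau r k G -> lau r k (fun zs => (F zs * G zs)%C).
Proof. intros HF HG. apply (apx_mult r Hr0 k _ additive_zero 0 0); auto. Qed.

Lemma lau_const (a : C) : lau r k (fun _ => a).
Proof. apply apx_const, additive_zero. Qed.

Lemma lau_ext (F G : list C -> C) : (forall zs, torus r k zs -> F zs = G zs) -> lau r k F -> lau r k G.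
Proof. apply apx_ext. Qed.

Lemma lau_plus (F G : list C -> C) : lau r k F -> lau r k G -> lau r k (fun zs => (F zs + G zs)%C).
Proof. apply apx_plus. Qed.

Lemma lau_minus (F G : list C -> C) : lau r k F -> lau r k G -> lau r k (fun zs => (F zs - G zs)%C).
Proof. apply apx_minus; auto. apply additive_zero. Qed.

Lemma lau_scal (a : C) (F : list C -> C) : lau r k F -> lau r k (fun zs => (a * F zs)%C).
Proof. apply apx_scal; auto. apply additive_zero. Qed.

Lemma lau_pow (n : nat) (F : list C -> C) : lau r k F -> lau r k (fun zs => Cpow (F zs) n).
Proof. apply apx_pow; auto. apply additive_zero. Qed.

Lemma lau_coord (m : nat) (p : Z) : (m < k)%nat -> lau r k (fun zs => Cpowz (coord m zs) p).
Proof. intros Hm. apply (apx_lau _ _ _ _ _ (ap_pow r k 0 0 0 m p Hm)). Qed.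

Lemma lau_inv (m : nat) : (m < k)%nat -> lau r k (fun zs => / coord m zs)%C.
Proof. intros Hm. apply (lau_ext (fun zs => Cpowz (coord m zs) (-1))); [intros; apply Cpowz_m1|apply lau_coord; auto]. Qed.

Lemma lau_inv_minus_1 (m : nat) : (m < k)%nat -> lau r k (fun zs => / (coord m zs - 1))%C.
Proof.
  intros Hm. apply (apx_lau _ _ (diff_weight 0 0 0) (- coord_weight 0 0 0 m)). apply ap_inv_minus_1; auto.
  unfold coord_weight. destruct (Nat.eqb m 0); lia.
Qed.

Lemma lau_prodC (f : C -> C) : (forall m, (m < k)%nat -> lau r k (fun zs => f (coord m zs))) ->
  lau r k (fun zs => prodC f zs).
Proof.
  intros H.
  apply (lau_ext (fun zs => prodC (fun m => f (coord m zs)) (seq 0 k))).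
  - intros zs Hz. transitivity (prodC f (coords_at (seq 0 k) zs)).
    + unfold coords_at. rewrite prodC_map. reflexivity.
    + rewrite torus_coords_at with (r := r); auto.
  - assert (Hl : forall idx, (forall m, In m idx -> (m < k)%nat) -> lau r k (fun zs => prodC (fun m => f (coord m zs)) idx)).
    { induction idx as [|m idx IH]; intros Hi; simpl; [apply lau_const|].
      apply lau_mult; [apply H, Hi; left; auto|]. apply IH. intros; apply Hi; right; auto. }
    apply Hl. intros m Hm. apply in_seq in Hm. lia.
Qed.

Lemma lau_sumC (f : C -> C) : (forall m, (m < k)%nat -> lau r k (fun zs => f (coord m zs))) ->
  lau r k (fun zs => sumC f zs).
Proof.
  intros H.
  apply (lau_ext (fun zs => sumC (fun m => f (coord m zs)) (seq 0 k))).
  - intros zs Hz. transitivity (sumC f (coords_at (seq 0 k) zs)).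
    + unfold coords_at. rewrite sumC_map. reflexivity.
    + rewrite torus_coords_at with (r := r); auto.
  - apply (apx_sumC r k _ additive_zero 0 (fun m zs => f (coord m zs))); [lia|].
    intros m Hm. apply in_seq in Hm. apply H. lia.
Qed.

Lemma lau_bounded (F : list C -> C) : lau r k F -> exists B, 0 <= B /\ forall zs, torus r k zs -> Cmod (F zs) <= B.
Proof. apply apx_bounded; auto. Qed.

Lemma lau_pairs_AD (b : R) : 0 < b < 1 -> lau r k (pairs_AD b).
Proof.
  intros Hb.
  assert (Ho : forall m, coord_weight 0 0 0 m = 0%Z) by (intros m; unfold coord_weight; destruct (Nat.eqb m 0); reflexivity).
  apply (apx_lau _ _ (diff_weight 0 0 0) 0).
  apply (apx_ext _ _ _ _ (fun zs => pairs_AD b (coords_at (seq 0 k) zs))).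
  - intros zs Hz. rewrite torus_coords_at with (r := r); auto.
  - apply ap_pairs_AD; auto; [apply seq_NoDup|].
    intros m Hm. apply in_seq in Hm. rewrite Ho. lia.
Qed.

End Lau.

Fixpoint zpow (x : Z) (ys : list nat) (zs : list C) : C :=
  match ys, zs with
  | a :: ys', z :: t => (Cpowz z (x - Z.of_nat a - 1) * zpow x ys' t)%C
  | _, _ => 1%C
  end.

Lemma lau_zpow (r : R) (Hr : 4 <= r) (x : Z) (ys : list nat) : lau r (length ys) (zpow x ys).
Proof.
  assert (E : forall (ys : list nat) (d : nat), (d + length ys <= length ys + d)%nat ->
    forall k, (d + length ys <= k)%nat ->
    lau r k (fun zs => zpow x ys (coords_at (seq d (length ys)) zs))).
  { clear ys. induction ys as [|a ys IH]; intros d _ k Hk; simpl in *.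
    - apply lau_const.
    - apply lau_mult; auto; [apply lau_coord; lia|]. apply IH; lia. }
  apply (lau_ext r _ (fun zs => zpow x ys (coords_at (seq 0 (length ys)) zs))).
  - intros zs Hz. rewrite (torus_coords_at r (length ys)); auto.
  - apply E; lia.
Qed.

Lemma zpow_shift (x : Z) (ys1 ys2 : list nat) (a j : nat) : forall zs,
  length zs = length (ys1 ++ a :: ys2) -> coord (length ys1) zs <> 0%C ->
  zpow x (ys1 ++ (a + j)%nat :: ys2) zs =
  (zpow x (ys1 ++ a :: ys2) zs * Cpow (/ coord (length ys1) zs) j)%C.
Proof.
  induction ys1 as [|c ys1 IH]; intros zs Hl Hz; destruct zs as [|z t]; try discriminate; simpl in *.
  - unfold coord in Hz; simpl in Hz. unfold coord; simpl.
    rewrite Cpow_inv by auto. rewrite <- Cpowz_opp_nat by auto.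
    replace (x - Z.of_nat (a + j) - 1)%Z with ((x - Z.of_nat a - 1) + - Z.of_nat j)%Z by lia.
    rewrite Cpowz_add by auto. ring.
  - rewrite (IH t); auto. unfold coord; simpl. ring.
Qed.

Lemma zpow_app (x : Z) (ys1 ys2 : list nat) (zs1 zs2 : list C) : length ys1 = length zs1 ->
  zpow x (ys1 ++ ys2) (zs1 ++ zs2) = (zpow x ys1 zs1 * zpow x ys2 zs2)%C.
Proof.
  revert zs1. induction ys1 as [|a ys1 IH]; intros [|z zs1] H; try discriminate; simpl.
  - ring.
  - rewrite IH by (simpl in H; lia). ring.
Qed.

(** Positions are nonnegative and [r >= 1], so a larger position only lowers the modulus; the bound
    is uniform over all lists of a given length. *)
Lemma zpow_bound (r : R) (x : Z) (ys : list nat) : 1 <= r -> forall zs, torus r (length ys) zs ->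
  Cmod (zpow x ys zs) <= powerRZ r (x - 1) ^ length ys.
Proof.
  intros Hr. induction ys as [|a ys IH]; intros zs Hz; simpl in *.
  - rewrite Cmod_1. lra.
  - apply torus_inv in Hz. destruct Hz as [z [t [-> [Hz Ht]]]].
    rewrite Cmod_mult, Cmod_Cpowz by (apply Cmod_gt_0; lra). rewrite Hz.
    assert (Hp : forall q, 0 < powerRZ r q) by (intros; apply powerRZ_lt; lra).
    apply Rmult_le_compat; auto using Cmod_ge_0; [apply Rlt_le; auto|].
    replace (x - Z.of_nat a - 1)%Z with ((x - 1) + - Z.of_nat a)%Z by lia.
    rewrite powerRZ_add by lra. rewrite <- (Rmult_1_r (powerRZ r (x - 1))) at 2.
    apply Rmult_le_compat_l; [apply Rlt_le; auto|].
    rewrite powerRZ_neg', <- pow_powerRZ.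
    rewrite <- Rinv_1. apply Rinv_le_contravar; [lra|]. apply pow_R1_Rle; auto.
Qed.

Lemma swap_nth_app {A : Type} (l1 l2 : list A) (u v : A) :
  swap_nth (length l1) (l1 ++ u :: v :: l2) = l1 ++ v :: u :: l2.
Proof. induction l1 as [|a l1 IH]; simpl; auto. rewrite IH; auto. Qed.

Lemma prodC_swap {A : Type} (f : A -> C) (l1 l2 : list A) (u v : A) :
  prodC f (l1 ++ u :: v :: l2) = prodC f (l1 ++ v :: u :: l2).
Proof. induction l1 as [|a l1 IH]; simpl; [ring|]. unfold prodC in *; simpl. rewrite IH; auto. Qed.

Lemma sumC_swap {A : Type} (f : A -> C) (l1 l2 : list A) (u v : A) :
  sumC f (l1 ++ u :: v :: l2) = sumC f (l1 ++ v :: u :: l2).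
Proof. induction l1 as [|a l1 IH]; simpl; [ring|]. unfold sumC in *; simpl. rewrite IH; auto. Qed.

Lemma pairs_AD_swap (b : R) (l1 l2 : list C) (u v : C) : exists Q,
  pairs_AD b (l1 ++ u :: v :: l2) = ((v - u) / den b u v * Q)%C /\
  pairs_AD b (l1 ++ v :: u :: l2) = ((u - v) / den b v u * Q)%C.
Proof.
  induction l1 as [|a l1 [Q [IH1 IH2]]].
  - exists (prodC (fun w => ((w - u) / den b u w)%C) l2 * prodC (fun w => ((w - v) / den b v w)%C) l2 * pairs_AD b l2)%C.
    simpl. split; ring.
  - exists (prodC (fun w => ((w - a) / den b a w)%C) (l1 ++ u :: v :: l2) * Q)%C.
    simpl. rewrite IH1, IH2, (prodC_swap _ l1 l2 v u). split; ring.
Qed.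

Lemma split_two {A : Type} (i : nat) (zs : list A) : (S i < length zs)%nat ->
  exists l1 u v l2, zs = l1 ++ u :: v :: l2 /\ length l1 = i.
Proof.
  revert zs. induction i as [|i IH]; intros zs H.
  - destruct zs as [|u [|v l]]; simpl in H; try lia. exists [], u, v, l. auto.
  - destruct zs as [|a zs]; simpl in H; [lia|]. destruct (IH zs) as [l1 [u [v [l2 [-> E]]]]]; [lia|].
    exists (a :: l1), u, v, l2. simpl. auto.
Qed.

(** The eigenvalue of the free jump on [z ^ (- v)]: the sum over [j >= 0] of
    [(1 - b) * b ^ j * z ^ (- (j + 1))]. *)
Definition jump_symbol (b : R) (z : C) : C := ((1 - b) * / z / (1 - b * / z))%C.

Definition rate_symbol (b : R) (N : nat) (zs : list C) : C :=
  ((sumC (jump_symbol b) zs + RtoC (INR N - INR (length zs))) * RtoC (/ INR N))%C.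

Definition amplitude (b : R) (zs : list C) : C :=
  (pairs_AD b zs * ((1 - prodC (fun z => z) zs) * prodC (fun z => / (z - 1)) zs))%C.

Definition wave (b : R) (N : nat) (x : Z) (n : nat) (ys : list nat) (zs : list C) : C :=
  (amplitude b zs * (zpow x ys zs * Cpow (rate_symbol b N zs) n))%C.

(** The factor [den b u v] cancels the denominator of the pair factor. What remains of the pair is
    [v - u] times a symmetric function, hence antisymmetric. *)
Lemma geom_difference (b : R) (u v : C) : u <> 0%C -> v <> 0%C ->
  (1 - b * / u)%C <> 0%C -> (1 - b * / v)%C <> 0%C ->
  (/ (1 - b * / u) - / v * / (1 - b * / v) = den b u v * (/ u * / v * / (1 - b * / u) * / (1 - b * / v)))%C.
Proof.
  intros Hu Hv H1 H2.
  assert (Ed : (den b u v = u * v * ((1 - b * / v) - / v * (1 - b * / u)))%C).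
  { unfold den. field. auto. }
  rewrite Ed. set (p := (1 - b * / u)%C) in *. set (q := (1 - b * / v)%C) in *. field. auto.
Qed.

Section Waves.

Context (r b : R) (N : nat) (x : Z) (Hr : 4 <= r) (Hb : 0 < b < 1) (HN : (0 < N)%nat).
Context (ell : C -> R) (ell_plus : forall u v, ell (u + v)%C = ell u + ell v)
  (ell_scal : forall (a : R) u, ell (RtoC a * u)%C = a * ell u)
  (ell_le : forall u, Rabs (ell u) <= Cmod u).
Context (cf : nat -> R) (Hcf : forall k, (N < k)%nat -> cf k = 0).

Let Hr0 : 0 < r. Proof. lra. Qed.

Lemma geom_symbol_neq (k m : nat) (zs : list C) : torus r k zs -> (m < k)%nat -> (1 - b * / coord m zs)%C <> 0%C.
Proof.
  intros Hz Hm. apply (inv_one_minus_neq _ (1/2)); [lra|].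
  rewrite Cmod_mult, Cmod_R, Rabs_right by lra. pose proof (Cmod_inv_coord r Hr k zs m Hz Hm).
  pose proof (Cmod_ge_0 (/ coord m zs)). nra.
Qed.

Lemma lau_geom (k m : nat) : (m < k)%nat -> lau r k (fun zs => / (1 - b * / coord m zs))%C.
Proof.
  intros Hm. apply (apx_geom r Hr0 k _ additive_zero (fun zs => (b * / coord m zs)%C) (1/2)); [lra| |].
  - intros zs Hz. rewrite Cmod_mult, Cmod_R, Rabs_right by lra. pose proof (Cmod_inv_coord r Hr k zs m Hz Hm).
    pose proof (Cmod_ge_0 (/ coord m zs)). nra.
  - apply lau_scal; auto. apply lau_inv; auto.
Qed.

Lemma lau_jump_symbol (k m : nat) : (m < k)%nat -> lau r k (fun zs => jump_symbol b (coord m zs)).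
Proof.
  intros Hm. unfold jump_symbol, Cdiv. apply lau_mult; auto; [|apply lau_geom; auto].
  apply lau_mult; auto; [apply lau_const|apply lau_inv; auto].
Qed.

Lemma lau_rate_symbol (k : nat) : lau r k (rate_symbol b N).
Proof.
  apply (lau_ext r k (fun zs => ((sumC (jump_symbol b) zs + RtoC (INR N - INR k)) * RtoC (/ INR N))%C)).
  - intros zs [Hl _]. unfold rate_symbol. rewrite Hl. reflexivity.
  - apply lau_mult; auto; [|apply lau_const]. apply lau_plus; [|apply lau_const].
    apply lau_sumC; auto. intros; apply lau_jump_symbol; auto.
Qed.

Lemma lau_amplitude (k : nat) : lau r k (amplitude b).
Proof.
  unfold amplitude. apply lau_mult; auto; [apply lau_pairs_AD; auto|].
  apply lau_mult; auto.
  - apply lau_minus; auto; [apply lau_const|]. apply (lau_prodC r Hr k (fun z => z)). intros m Hm.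
    apply (lau_ext r k (fun zs => Cpowz (coord m zs) 1)); [intros; apply Cpowz_1|apply lau_coord; auto].
  - apply (lau_prodC r Hr k (fun z => / (z - 1))%C). intros; apply lau_inv_minus_1; auto.
Qed.

Lemma lau_wave (n : nat) (ys : list nat) : lau r (length ys) (wave b N x n ys).
Proof.
  unfold wave. apply lau_mult; auto; [apply lau_amplitude|]. apply lau_mult; auto; [apply lau_zpow; auto|].
  apply lau_pow; auto. apply lau_rate_symbol.
Qed.

(** The coefficient [cf] vanishes beyond length [N], so that boundedness on all lists reduces to
    finitely many lengths. *)
Definition wave_obs (n : nat) (ys : list nat) : R :=
  cf (length ys) * ell (multi_circ_int r (length ys) (wave b N x n ys)).

Lemma bounded_of_lengths (g : list nat -> R) :
  (forall k, exists B, forall ys, length ys = k -> Rabs (g ys) <= B) ->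
  (forall ys, (N < length ys)%nat -> g ys = 0) -> bounded_obs g.
Proof.
  intros H H0.
  assert (Hk : forall K, exists B, 0 <= B /\ forall ys, (length ys <= K)%nat -> Rabs (g ys) <= B).
  { induction K as [|K [B [HB0 HB]]].
    - destruct (H 0%nat) as [B HB]. exists (Rabs B). split; [apply Rabs_pos|].
      intros ys Hy. eapply Rle_trans; [apply HB; lia|apply Rle_abs].
    - destruct (H (S K)) as [B' HB']. exists (Rmax B B'). split; [eapply Rle_trans; [apply HB0|apply Rmax_l]|].
      intros ys Hy. destruct (Nat.eq_dec (length ys) (S K)) as [E|E].
      + eapply Rle_trans; [apply HB'; auto|apply Rmax_r].
      + eapply Rle_trans; [apply HB; lia|apply Rmax_l]. }
  destruct (Hk N) as [B [HB0 HB]]. exists B. intros ys.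
  destruct (le_lt_dec (length ys) N); [auto|]. rewrite H0 by auto. rewrite Rabs_R0; auto.
Qed.

Lemma wave_obs_bounded (n : nat) : bounded_obs (wave_obs n).
Proof.
  apply bounded_of_lengths.
  - intros k.
    assert (HlF : lau r k (fun zs => amplitude b zs * Cpow (rate_symbol b N zs) n)%C).
    { apply lau_mult; auto; [apply lau_amplitude|]. apply lau_pow; auto. apply lau_rate_symbol. }
    destruct (lau_bounded r Hr k _ HlF) as [B [HB0 HB]].
    exists (Rabs (cf k) * (r ^ k * (B * powerRZ r (x - 1) ^ k))).
    intros ys <-. unfold wave_obs. rewrite Rabs_mult. apply Rmult_le_compat_l; [apply Rabs_pos|].
    eapply Rle_trans; [apply ell_le|]. apply mci_bound; auto; [apply lau_wave|].
    intros zs Hz. unfold wave.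
    replace (amplitude b zs * (zpow x ys zs * rate_symbol b N zs ^ n))%C
      with ((amplitude b zs * rate_symbol b N zs ^ n) * zpow x ys zs)%C by ring.
    rewrite Cmod_mult. apply Rmult_le_compat; auto using Cmod_ge_0. apply zpow_bound; auto. lra.
  - intros ys Hy. unfold wave_obs. rewrite Hcf by auto. ring.
Qed.

Lemma ell_minus (u v : C) : ell (u - v)%C = ell u - ell v.
Proof.
  replace (u - v)%C with (u + RtoC (-1) * v)%C by ring. rewrite ell_plus, ell_scal. ring.
Qed.

(** Moving a particle by [j] multiplies the wave by [z ^ (- j)], and the geometric series sums to
    [/ (1 - b * / z)]. The sum is taken by telescoping, without interchanging series and
    integral. *)
Lemma Series_wave (n : nat) (ys1 ys2 : list nat) (a : nat) :
  Series (fun j => b ^ j * wave_obs n (ys1 ++ (a + j)%nat :: ys2)) =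
  cf (length (ys1 ++ a :: ys2)) *
  ell (multi_circ_int r (length (ys1 ++ a :: ys2))
    (fun zs => wave b N x n (ys1 ++ a :: ys2) zs * / (1 - b * / coord (length ys1) zs))%C).
Proof.
  set (i := length ys1). set (k := length (ys1 ++ a :: ys2)).
  assert (Hi : (i < k)%nat) by (unfold i, k; rewrite length_app; simpl; lia).
  assert (Hk : forall j, length (ys1 ++ (a + j)%nat :: ys2) = k) by (intros; unfold k; rewrite !length_app; reflexivity).
  set (K := fun zs => (wave b N x n (ys1 ++ a :: ys2) zs * / (1 - b * / coord i zs))%C).
  assert (HK : lau r k K).
  { apply lau_mult; auto; [apply (lau_wave n (ys1 ++ a :: ys2))|apply lau_geom; auto]. }
  assert (HKw : forall j, lau r k (fun zs => K zs * Cpow (/ coord i zs) j)%C).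
  { intros j. apply lau_mult; auto. apply lau_pow; auto. apply lau_inv; auto. }
  destruct (lau_bounded r Hr k K HK) as [B [HB0 HB]].
  (* The wave is [K - b * (/ z) * K], hence term [j] of the series is a difference of consecutive
     remainders; the remainders tend to 0 because [b < 1] and [Cmod (/ z) <= 1]. *)
  assert (Hstep : forall j, ell (multi_circ_int r k (wave b N x n (ys1 ++ (a + j)%nat :: ys2))) =
     ell (multi_circ_int r k (fun zs => K zs * Cpow (/ coord i zs) j)%C)
     - b * ell (multi_circ_int r k (fun zs => K zs * Cpow (/ coord i zs) (S j))%C)).
  { intros j. rewrite <- ell_scal, <- ell_minus. f_equal.
    rewrite <- (mci_scal r Hr0 k b _ (HKw (S j))), <- mci_minus; auto; [|apply lau_scal; auto].
    apply mci_ext; [lra|]. intros zs Hz. unfold K, wave.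
    rewrite zpow_shift; [|destruct Hz; auto|apply (torus_coord_neq_0 r Hr k); auto].
    fold i. simpl.
    pose proof (torus_coord_neq_0 r Hr k zs i Hz Hi) as Hc.
    set (w := (/ coord i zs)%C) in *.
    assert (Hw : (1 - b * w)%C <> 0%C) by (apply (geom_symbol_neq k i); auto).
    set (g := amplitude b zs). set (p := (rate_symbol b N zs ^ n)%C). set (q := zpow x _ zs).
    set (wj := (w ^ j)%C). field. exact Hw. }
  assert (Hpart : forall n0, sum_n (fun j => b ^ j * wave_obs n (ys1 ++ (a + j)%nat :: ys2)) n0 =
     cf k * (ell (multi_circ_int r k K) - b ^ S n0 * ell (multi_circ_int r k (fun zs => K zs * Cpow (/ coord i zs) (S n0))%C))).
  { assert (H0 : ell (multi_circ_int r k K) = ell (multi_circ_int r k (fun zs => K zs * Cpow (/ coord i zs) 0)%C)).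
    { f_equal. apply mci_ext; [lra|]. intros; simpl; ring. }
    induction n0 as [|n0 IH].
    - rewrite sum_O. unfold wave_obs. rewrite Hk, Hstep, H0. simpl. ring.
    - rewrite sum_Sn, IH. unfold wave_obs. rewrite Hk, Hstep. unfold plus; simpl. ring. }
  apply is_series_unique.
  change (is_lim_seq (sum_n (fun j => b ^ j * wave_obs n (ys1 ++ (a + j)%nat :: ys2)))
    (Finite (cf k * ell (multi_circ_int r k K)))).
  apply (is_lim_seq_ext (fun n0 => cf k * (ell (multi_circ_int r k K) - b ^ S n0 * ell (multi_circ_int r k (fun zs => K zs * Cpow (/ coord i zs) (S n0))%C)))).
  { intros n0. symmetry. apply Hpart. }
  replace (Finite (cf k * ell (multi_circ_int r k K))) with (Rbar_mult (cf k) (ell (multi_circ_int r k K) - 0)) by (simpl; f_equal; ring).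
  apply is_lim_seq_scal_l. apply is_lim_seq_minus'; [apply is_lim_seq_const|].
  apply is_lim_seq_abs_0.
  apply (is_lim_seq_le_le (fun _ => 0) _ (fun n0 => b ^ S n0 * (r ^ k * B))).
  - intros n0. split; [apply Rabs_pos|]. rewrite Rabs_mult.
    rewrite Rabs_right by (apply Rle_ge, pow_le; lra). apply Rmult_le_compat_l; [apply pow_le; lra|].
    eapply Rle_trans; [apply ell_le|]. apply mci_bound; auto.
    intros zs Hz. rewrite Cmod_mult, Cmod_pow. rewrite <- (Rmult_1_r B).
    apply Rmult_le_compat; auto using Cmod_ge_0.
    + apply pow_le, Cmod_ge_0.
    + pose proof (Cmod_inv_coord r Hr k zs i Hz Hi). pose proof (Cmod_ge_0 (/ coord i zs)).
      rewrite <- (pow1 (S n0)). apply pow_incr. lra.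
  - apply is_lim_seq_const.
  - apply (is_lim_seq_incr_1 (fun n0 => b ^ n0 * (r ^ k * B))).
    replace (Finite 0) with (Rbar_mult 0 (r ^ k * B)) by (simpl; f_equal; ring).
    apply is_lim_seq_scal_r. apply is_lim_seq_geom. rewrite Rabs_right; lra.
Qed.

(* The two sides differ by the integral of a function that is antisymmetric in
   two neighbouring variables. *)
Lemma wave_obs_boundary (n : nat) : boundary_cond b (wave_obs n).
Proof.
  intros pre c suf.
  rewrite (Series_wave n pre (c :: suf) c).
  rewrite (Series_ext _ (fun j => b ^ j * wave_obs n ((pre ++ [c]) ++ (c + 1 + j)%nat :: suf)))
    by (intros; rewrite <- app_assoc; reflexivity).
  rewrite (Series_wave n (pre ++ [c]) suf (c + 1)).
  set (ys := pre ++ c :: c :: suf). set (k := length ys). set (i := length pre).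
  assert (Hk1 : length ((pre ++ [c]) ++ (c + 1)%nat :: suf) = k) by (unfold k, ys; rewrite !length_app; simpl; lia).
  assert (Hi : (S i < k)%nat) by (unfold k, ys, i; rewrite length_app; simpl; lia).
  assert (Hi1 : length (pre ++ [c]) = S i) by (unfold i; rewrite length_app; simpl; lia).
  rewrite Hk1, Hi1. f_equal.
  set (F1 := fun zs => (wave b N x n ys zs * / (1 - b * / coord i zs))%C).
  (* On this side the series starts at [c + 1], which accounts for the extra factor
     [/ coord (S i) zs]. *)
  set (F2 := fun zs => (wave b N x n ys zs * (/ coord (S i) zs * / (1 - b * / coord (S i) zs)))%C).
  assert (HF1 : lau r k F1).
  { apply lau_mult; auto; [apply lau_wave|apply lau_geom; lia]. }
  assert (HF2 : lau r k F2).
  { apply lau_mult; auto; [apply lau_wave|]. apply lau_mult; auto; [apply lau_inv; auto|apply lau_geom; lia]. }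
  rewrite (mci_ext r k (Rlt_le _ _ Hr0) (fun zs => (wave b N x n ((pre ++ [c]) ++ (c + 1)%nat :: suf) zs *
        / (1 - b * / coord (S i) zs))%C) F2).
  2:{ intros zs Hz. unfold F2, wave.
      rewrite zpow_shift; rewrite ?Hi1.
      - rewrite <- app_assoc. simpl app. fold ys. simpl Cpow. ring.
      - destruct Hz as [-> _]. rewrite <- app_assoc. reflexivity.
      - apply (torus_coord_neq_0 r Hr k); auto. }
  f_equal. fold F1.
  set (H := fun zs => (F1 zs - F2 zs)%C).
  assert (HH : lau r k H) by (apply lau_minus; auto).
  assert (Hanti : forall zs, torus r k zs -> H (swap_nth i zs) = (RtoC (-1) * H zs)%C).
  { intros zs Hz. assert (Hlen : length zs = k) by (destruct Hz; auto).
    destruct (split_two i zs) as [l1 [u [v [l2 [Ezs El1]]]]]; [rewrite Hlen; auto|].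
    assert (Hu : coord i zs = u) by (rewrite Ezs; unfold coord; rewrite app_nth2, El1, Nat.sub_diag by lia; reflexivity).
    assert (Hv : coord (S i) zs = v).
    { rewrite Ezs; unfold coord; rewrite app_nth2, El1 by lia. replace (S i - i)%nat with 1%nat by lia. reflexivity. }
    assert (Esw : swap_nth i zs = l1 ++ v :: u :: l2) by (rewrite Ezs, <- El1; apply swap_nth_app).
    pose proof (torus_swap_nth r k i zs Hz) as Hz'.
    assert (Hu' : coord i (swap_nth i zs) = v) by (rewrite Esw; unfold coord; rewrite app_nth2, El1, Nat.sub_diag by lia; reflexivity).
    assert (Hv' : coord (S i) (swap_nth i zs) = u).
    { rewrite Esw; unfold coord; rewrite app_nth2, El1 by lia. replace (S i - i)%nat with 1%nat by lia. reflexivity. }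
    assert (Hu0 : u <> 0%C) by (rewrite <- Hu; apply (torus_coord_neq_0 r Hr k); auto; lia).
    assert (Hv0 : v <> 0%C) by (rewrite <- Hv; apply (torus_coord_neq_0 r Hr k); auto; lia).
    assert (Hd1 : den b u v <> 0%C) by (rewrite <- Hu, <- Hv; apply (den_neq_0 r b Hr Hb k); auto; lia).
    assert (Hd2 : den b v u <> 0%C) by (rewrite <- Hu, <- Hv; apply (den_neq_0 r b Hr Hb k); auto; lia).
    assert (Hg1 : (1 - b * / u)%C <> 0%C) by (rewrite <- Hu; apply (geom_symbol_neq k); auto; lia).
    assert (Hg2 : (1 - b * / v)%C <> 0%C) by (rewrite <- Hv; apply (geom_symbol_neq k); auto; lia).
    destruct (pairs_AD_swap b l1 l2 u v) as [Q [HQ1 HQ2]].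
    assert (Hbase : forall zs', (H zs' = pairs_AD b zs' * (/ (1 - b * / coord i zs') - / coord (S i) zs' * / (1 - b * / coord (S i) zs')) *
       (((1 - prodC (fun z => z) zs') * prodC (fun z => / (z - 1)) zs') * (zpow x ys zs' * Cpow (rate_symbol b N zs') n)))%C).
    { intros zs'. unfold H, F1, F2, wave, amplitude. ring. }
    rewrite !Hbase, Hu', Hv', Hu, Hv, Esw, (geom_difference b u v), (geom_difference b v u) by auto.
    rewrite Ezs, HQ1, HQ2.
    rewrite (prodC_swap (fun z => z) l1 l2 v u), (prodC_swap (fun z => / (z - 1))%C l1 l2 v u).
    assert (Er : rate_symbol b N (l1 ++ v :: u :: l2) = rate_symbol b N (l1 ++ u :: v :: l2)).
    { unfold rate_symbol. rewrite sumC_swap, !length_app. reflexivity. }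
    (* The particles [i] and [i + 1] both sit at [c], so the plane wave is symmetric in their
       variables. *)
    assert (Ezp : zpow x ys (l1 ++ v :: u :: l2) = zpow x ys (l1 ++ u :: v :: l2)).
    { unfold ys. rewrite !zpow_app by auto. simpl. ring. }
    rewrite Er, Ezp.
    set (A := (1 - prodC (fun z : C => z) (l1 ++ u :: v :: l2))%C).
    set (P := prodC (fun z => / (z - 1))%C _). set (Zp := zpow x ys _). set (L := Cpow (rate_symbol b N _) n).
    set (p := (/ (1 - b * / u))%C). set (q := (/ (1 - b * / v))%C).
    set (d1 := den b u v) in *. set (d2 := den b v u) in *.
    field. auto. }
  assert (Hz : multi_circ_int r k H = 0%C).
  { pose proof (mci_swap r k i H Hr0 Hi HH) as E1.
    rewrite (mci_ext r k (Rlt_le _ _ Hr0) _ (fun zs => (RtoC (-1) * H zs)%C) Hanti) in E1.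
    rewrite mci_scal in E1 by auto.
    set (I := multi_circ_int r k H) in *.
    assert (E2 : (RtoC 2 * I = RtoC 2 * 0)%C).
    { replace (RtoC 2 * I)%C with (I - RtoC (-1) * I)%C by (apply injective_projections; simpl; ring).
      rewrite E1. ring. }
    apply Cmult_cancel_l in E2; auto. intros E; injection E; lra. }
  unfold H in Hz. rewrite mci_minus in Hz by auto.
  replace (multi_circ_int r k F1) with (multi_circ_int r k F1 - multi_circ_int r k F2 + multi_circ_int r k F2)%C by ring.
  rewrite Hz. ring.
Qed.

Lemma free_jump_wave (n : nat) (pre suf : list nat) (a : nat) :
  free_jump b (fun v => wave_obs n (pre ++ v :: suf)) a =
  cf (length (pre ++ a :: suf)) * ell (multi_circ_int r (length (pre ++ a :: suf))
    (fun zs => wave b N x n (pre ++ a :: suf) zs * jump_symbol b (coord (length pre) zs))%C).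
Proof.
  unfold free_jump.
  rewrite (Series_ext _ (fun j => (1 - b) * (b ^ j * wave_obs n (pre ++ (a + 1 + j)%nat :: suf)))) by (intros; ring).
  rewrite Series_scal_l, Series_wave.
  set (i := length pre). set (k := length (pre ++ a :: suf)).
  assert (Hk : length (pre ++ (a + 1)%nat :: suf) = k) by (unfold k; rewrite !length_app; reflexivity).
  assert (Hi : (i < k)%nat) by (unfold i, k; rewrite length_app; simpl; lia).
  rewrite Hk.
  replace ((1 - b) * (cf k * ell (multi_circ_int r k (fun zs => wave b N x n (pre ++ (a + 1)%nat :: suf) zs * / (1 - b * / coord i zs))%C)))
    with (cf k * ((1 - b) * ell (multi_circ_int r k (fun zs => wave b N x n (pre ++ (a + 1)%nat :: suf) zs * / (1 - b * / coord i zs))%C))) by ring.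
  rewrite <- ell_scal, <- mci_scal; auto.
  2:{ rewrite <- Hk. apply lau_mult; auto; [apply lau_wave|rewrite Hk; apply lau_geom; auto]. }
  f_equal. f_equal. apply mci_ext; [lra|]. intros zs Hz. unfold wave.
  rewrite zpow_shift; [|destruct Hz; auto|apply (torus_coord_neq_0 r Hr k); auto].
  fold i. unfold jump_symbol. rewrite RtoC_minus. simpl. unfold Cdiv. ring.
Qed.

(** [free_gen] moves each particle with its predecessors held fixed; the prefix [pre] records these,
    so that the variable indices stay aligned with the whole list. *)
Lemma free_gen_wave_pre (n : nat) (ys pre : list nat) :
  free_gen b (fun z => wave_obs n (pre ++ z)) ys =
  cf (length (pre ++ ys)) * ell (multi_circ_int r (length (pre ++ ys))
    (fun zs => wave b N x n (pre ++ ys) zs * sumC (fun i => jump_symbol b (coord i zs)) (seq (length pre) (length ys)))%C).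
Proof.
  revert pre. induction ys as [|a ys IH]; intros pre.
  - simpl. rewrite (mci_ext r _ (Rlt_le _ _ Hr0) _ (fun _ => 0%C)) by (intros; ring).
    rewrite mci_zero by auto. replace (RtoC 0) with (RtoC 0 * 0)%C by ring. rewrite ell_scal. ring.
  - cbn [free_gen]. rewrite free_jump_wave.
    assert (E : free_gen b (fun z => wave_obs n (pre ++ a :: z)) ys = free_gen b (fun z => wave_obs n ((pre ++ [a]) ++ z)) ys).
    { assert (Hx : forall l f g, (forall z, f z = g z) -> free_gen b f l = free_gen b g l).
      { clear. induction l as [|a l IH]; intros f g H; simpl; auto.
        rewrite (IH (fun z => f (a :: z)) (fun z => g (a :: z))) by auto. f_equal.
        unfold free_jump. apply Series_ext. intros; rewrite H; auto. }
      apply Hx. intros z. rewrite <- app_assoc. reflexivity. }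
    rewrite E, IH.
    assert (El : (pre ++ [a]) ++ ys = pre ++ a :: ys) by (rewrite <- app_assoc; reflexivity).
    assert (Ep : length (pre ++ [a]) = S (length pre)) by (rewrite length_app; simpl; lia).
    rewrite El, Ep, <- Rmult_plus_distr_l, <- ell_plus. f_equal. f_equal.
    set (k := length (pre ++ a :: ys)).
    assert (Hk : (length pre + S (length ys) = k)%nat) by (unfold k; rewrite length_app; reflexivity).
    rewrite <- mci_plus; auto.
    + apply mci_ext; [lra|]. intros zs Hz. simpl. ring.
    + apply lau_mult; auto; [apply lau_wave|apply lau_jump_symbol; lia].
    + apply lau_mult; auto; [apply lau_wave|].
      apply (apx_sumC r k _ additive_zero 0 (fun i zs => jump_symbol b (coord i zs))); [lia|].
      intros i Hi. apply in_seq in Hi. apply lau_jump_symbol. lia.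
Qed.

Lemma free_gen_wave (n : nat) (ys : list nat) :
  free_gen b (wave_obs n) ys + (INR N - INR (length ys)) * wave_obs n ys = INR N * wave_obs (S n) ys.
Proof.
  pose proof (free_gen_wave_pre n ys []) as E. simpl app in E. simpl length in E.
  change (fun z : list nat => wave_obs n z) with (wave_obs n) in E. rewrite E.
  unfold wave_obs. set (k := length ys).
  assert (HN' : INR N <> 0) by (apply not_0_INR; lia).
  assert (Hls : lau r k (fun zs => wave b N x n ys zs * sumC (fun i => jump_symbol b (coord i zs)) (seq 0 k))%C).
  { apply lau_mult; auto; [apply lau_wave|].
    apply (apx_sumC r k _ additive_zero 0 (fun i zs => jump_symbol b (coord i zs))); [lia|].
    intros i Hi. apply in_seq in Hi. apply lau_jump_symbol. lia. }
  replace ((INR N - INR k) * (cf k * ell (multi_circ_int r k (wave b N x n ys))))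
    with (cf k * ((INR N - INR k) * ell (multi_circ_int r k (wave b N x n ys)))) by ring.
  replace (INR N * (cf k * ell (multi_circ_int r k (wave b N x (S n) ys))))
    with (cf k * (INR N * ell (multi_circ_int r k (wave b N x (S n) ys)))) by ring.
  rewrite <- Rmult_plus_distr_l. f_equal.
  rewrite <- !ell_scal, <- ell_plus. f_equal.
  rewrite <- !mci_scal, <- mci_plus; auto; try apply lau_wave; [|apply lau_scal; auto; apply lau_wave].
  apply mci_ext; [lra|]. intros zs Hz. unfold wave. rewrite Cpow_S.
  unfold rate_symbol at 3.
  assert (Es : sumC (jump_symbol b) zs = sumC (fun i => jump_symbol b (coord i zs)) (seq 0 k)).
  { rewrite <- (torus_coords_at r k zs Hz) at 1. unfold coords_at. rewrite sumC_map. reflexivity. }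
  rewrite Es. destruct Hz as [-> _]. fold k.
  rewrite RtoC_inv by auto.
  set (Sg := sumC _ _). field. intros E0; injection E0; auto.
Qed.

End Waves.

(** * The initial condition *)

Inductive sublist : list nat -> list nat -> Prop :=
  | sublist_nil : sublist [] []
  | sublist_keep a z y : sublist z y -> sublist (a :: z) (a :: y)
  | sublist_skip a z y : sublist z y -> sublist z (a :: y).

Lemma subset_sum_ext_sub (b : R) (y : list nat) : forall s g h,
  (forall z, sublist z y -> g z = h z) -> subset_sum b s y g = subset_sum b s y h.
Proof.
  induction y as [|a y IH]; intros s g h H; simpl.
  - apply H. constructor.
  - rewrite (IH (S s) g h) by (intros; apply H; constructor; auto).
    rewrite (IH (S s) (fun z => g (a :: z)) (fun z => h (a :: z))); auto.
    intros; apply H; constructor; auto.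
Qed.

Lemma sublist_length (z y : list nat) : sublist z y -> (length z <= length y)%nat.
Proof. intros H; induction H; simpl; lia. Qed.

Lemma sublist_incl (z y : list nat) : sublist z y -> incl z y.
Proof.
  intros H; induction H; intros w Hw; simpl in *; auto.
  destruct Hw; auto.
Qed.

Lemma strictly_increasing_lt (a : nat) (y : list nat) : strictly_increasing (a :: y) ->
  forall c, In c y -> (a < c)%nat.
Proof.
  revert a. induction y as [|d y IH]; intros a H c Hc; [destruct Hc|].
  destruct H as [H1 H2]. destruct Hc as [<-|Hc]; auto. specialize (IH d H2 c Hc). lia.
Qed.

Lemma strictly_increasing_sublist (z y : list nat) : sublist z y ->
  strictly_increasing y -> strictly_increasing z.
Proof.
  intros H. induction H as [|a z y H IH|a z y H IH]; intros Hs; auto.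
  - pose proof (IH (strictly_increasing_tail _ _ Hs)) as Hz.
    apply strictly_increasing_cons; auto. destruct z as [|c z]; simpl; [lia|].
    apply (strictly_increasing_lt a y Hs). apply (sublist_incl _ _ H). left; auto.
  - apply IH. apply (strictly_increasing_tail _ _ Hs).
Qed.

Lemma strictly_increasing_NoDup (y : list nat) : strictly_increasing y -> NoDup y.
Proof.
  induction y as [|a y IH]; intros H; constructor.
  - intros Ha. pose proof (strictly_increasing_lt a y H a Ha). lia.
  - apply IH. apply (strictly_increasing_tail _ _ H).
Qed.

Lemma strictly_decreasing_exponents (c : Z) (ys : list nat) : strictly_increasing ys ->
  strictly_decreasing (map (fun a => (c - Z.of_nat a)%Z) ys).
Proof.
  induction ys as [|a ys IH]; intros H; simpl; auto. split.
  - apply Forall_map, Forall_forall. intros d Hd.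
    pose proof (strictly_increasing_lt a ys H d Hd). lia.
  - apply IH. apply (strictly_increasing_tail _ _ H).
Qed.

Lemma strictly_increasing_le_last (ys : list nat) (d : nat) : strictly_increasing ys ->
  forall a, In a ys -> (a <= last ys d)%nat.
Proof.
  induction ys as [|c ys IH]; intros H a Ha; [destruct Ha|].
  destruct ys as [|e ys].
  - destruct Ha as [<-|[]]. simpl. lia.
  - change (last (c :: e :: ys) d) with (last (e :: ys) d).
    pose proof (IH (strictly_increasing_tail _ _ H)) as I. destruct Ha as [<-|Ha]; [|auto].
    destruct H as [H _]. specialize (I e (or_introl eq_refl)). lia.
Qed.

(** The exponents decrease along [ys], so the sign of the last one decides between the two
    evaluations. *)
Lemma mci_pairs_exp_prod_shift (r b : R) (c : Z) (ys : list nat) : 4 <= r -> 0 < b < 1 ->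
  ys <> [] -> strictly_increasing ys ->
  multi_circ_int r (length ys) (fun zs => (pairs_AD b zs * exp_prod (map (fun a => (c - Z.of_nat a)%Z) ys) zs)%C)
  = if Z_le_dec (Z.of_nat (last ys 0%nat)) c then 1%C else 0%C.
Proof.
  intros Hr Hb Hne Hs. set (a := map (fun a => (c - Z.of_nat a)%Z) ys).
  assert (Hl : length ys = length a) by (unfold a; rewrite length_map; auto). rewrite Hl.
  destruct (Z_le_dec _ _) as [Hc|Hc].
  - apply mci_pairs_exp_prod_one; auto.
    + apply strictly_decreasing_exponents; auto.
    + apply Forall_map, Forall_forall. intros d Hd.
      pose proof (strictly_increasing_le_last ys 0 Hs d Hd). lia.
  - apply (mci_pairs_exp_prod_neg r b Hr Hb a (length ys - 1)).
    + rewrite <- Hl. destruct ys; [congruence|simpl; lia].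
    + unfold a. set (f := fun a : nat => (c - Z.of_nat a)%Z).
      rewrite nth_indep with (d' := f 0%nat).
      * rewrite (map_nth f).
        assert (E : nth (length ys - 1) ys 0%nat = last ys 0%nat).
        { clear - Hne. induction ys as [|d ys IH]; [congruence|]. destruct ys as [|e ys]; [reflexivity|].
          change (last (d :: e :: ys) 0%nat) with (last (e :: ys) 0%nat). rewrite <- IH by congruence.
          simpl. rewrite Nat.sub_0_r. reflexivity. }
        rewrite E. unfold f. lia.
      * rewrite length_map. destruct ys; [congruence|simpl; lia].
Qed.

Lemma exp_prod_zpow (x : Z) (ys : list nat) : forall zs, length zs = length ys -> Forall (fun z : C => z <> 0%C) zs ->
  (exp_prod (map (fun a => (x - 1 - Z.of_nat a)%Z) ys) zs = prodC (fun z => / (z - 1)) zs * zpow x ys zs /\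
  exp_prod (map (fun a => (x - Z.of_nat a)%Z) ys) zs =
    prodC (fun z => z) zs * prodC (fun z => / (z - 1)) zs * zpow x ys zs)%C.
Proof.
  induction ys as [|a ys IH]; intros zs Hl Hz; destruct zs as [|z t]; try discriminate; simpl in *.
  - split; ring.
  - inversion Hz as [|? ? Hz1 Hz2]; subst. destruct (IH t) as [I1 I2]; auto.
    rewrite I1, I2. unfold Cdiv.
    replace (x - 1 - Z.of_nat a)%Z with (x - Z.of_nat a - 1)%Z by lia.
    replace (Cpowz z (x - Z.of_nat a)) with (z * Cpowz z (x - Z.of_nat a - 1))%C.
    + split; ring.
    + rewrite <- Cpowz_succ by auto. f_equal. lia.
Qed.

(** Multiplying out [1 - prod z] leaves the indicator of [last ys <= x - 1] minus that of
    [last ys <= x]. *)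
Lemma mci_wave_0 (r b : R) (N : nat) (x : Z) (ys : list nat) : 4 <= r -> 0 < b < 1 ->
  ys <> [] -> strictly_increasing ys ->
  multi_circ_int r (length ys) (wave b N x 0 ys) =
  RtoC (if Z.eq_dec (Z.of_nat (last ys 0%nat)) x then -1 else 0).
Proof.
  intros Hr Hb Hne Hs. assert (Hr0 : 0 < r) by lra.
  rewrite (mci_ext r _ (Rlt_le _ _ Hr0) _ (fun zs =>
    (pairs_AD b zs * exp_prod (map (fun a => (x - 1 - Z.of_nat a)%Z) ys) zs -
     pairs_AD b zs * exp_prod (map (fun a => (x - Z.of_nat a)%Z) ys) zs)%C)).
  - rewrite mci_minus; auto.
    + rewrite !mci_pairs_exp_prod_shift by auto.
      destruct (Z_le_dec _ (x - 1)), (Z_le_dec _ x), (Z.eq_dec _ x); try lia;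
        rewrite <- RtoC_minus; f_equal; ring.
    + pose proof (lau_pairs_exp_prod r b Hr Hb (map (fun a => (x - 1 - Z.of_nat a)%Z) ys)) as H.
      rewrite length_map in H. exact H.
    + pose proof (lau_pairs_exp_prod r b Hr Hb (map (fun a => (x - Z.of_nat a)%Z) ys)) as H.
      rewrite length_map in H. exact H.
  - intros zs Hz. destruct (exp_prod_zpow x ys zs) as [-> ->].
    + destruct Hz; auto.
    + apply (torus_neq_0 r (length ys)); auto.
    + unfold wave, amplitude. simpl. ring.
Qed.

Fixpoint index_sum (s n : nat) : nat :=
  match n with O => 0 | S n' => s + index_sum (S s) n' end.

Lemma subset_sum_top (b : R) (l : list nat) : forall s h,
  (forall z, (length z < length l)%nat -> h z = 0) ->
  subset_sum b s l h = b ^ index_sum s (length l) * h l.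
Proof.
  induction l as [|a l IH]; intros s h H; simpl; [ring|].
  rewrite IH by (intros; apply H; simpl; lia).
  rewrite (subset_sum_ext_sub b l (S s) h (fun _ => 0 * 0)).
  - rewrite subset_sum_scal, pow_add. ring.
  - intros z Hz. rewrite H; [ring|]. apply sublist_length in Hz. simpl. lia.
Qed.

Lemma subset_sum_zero (b : R) (y : list nat) (s : nat) (g : list nat -> R) :
  (forall z, sublist z y -> g z = 0) -> subset_sum b s y g = 0.
Proof.
  intros H. rewrite (subset_sum_ext_sub b y s g (fun z => 0 * 0)).
  - rewrite subset_sum_scal. ring.
  - intros z Hz. rewrite H by auto. ring.
Qed.

(** The empty list is treated apart: [last] would give the default 0, a genuine site. *)
Definition last_at (p : nat) (th : nat -> R) (z : list nat) : R :=
  match z with [] => 0 | _ => if Nat.eq_dec (last z 0%nat) p then th (length z) else 0 end.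

Lemma last_at_cons (p a : nat) (th : nat -> R) (z : list nat) : a <> p ->
  last_at p th (a :: z) = last_at p (fun n => th (S n)) z.
Proof.
  intros Ha. destruct z as [|c z].
  - simpl. destruct (Nat.eq_dec a p); [congruence|reflexivity].
  - reflexivity.
Qed.

Lemma subset_sum_last_at_notin (b : R) (p : nat) (y : list nat) : ~ In p y -> forall s th,
  subset_sum b s y (last_at p th) = 0.
Proof.
  intros Hp s th. apply subset_sum_zero. intros z Hz.
  destruct z as [|c z]; [reflexivity|]. unfold last_at.
  destruct (Nat.eq_dec _ _) as [E|E]; auto. exfalso. apply Hp, (sublist_incl _ _ Hz).
  rewrite <- E. clear. revert c. induction z as [|d z IH]; intros c; [left; auto|].
  right. apply (IH d).
Qed.

(** A subsequence that ends at [p] contains [p], nothing after it and anything before it;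
    [s + length pre] is the index of [p]. *)
Lemma subset_sum_last_at (b : R) (p : nat) (suf : list nat) (pre : list nat) :
  ~ In p pre -> ~ In p suf -> forall s th,
  subset_sum b s (pre ++ p :: suf) (last_at p th) =
  b ^ (s + length pre) * subset_sum b s pre (fun z => th (S (length z))).
Proof.
  intros Hpre Hsuf. induction pre as [|a pre IH]; intros s th; simpl app; cbn [subset_sum length].
  - rewrite subset_sum_last_at_notin by auto. rewrite Nat.add_0_r, Rplus_0_r. f_equal.
    rewrite (subset_sum_ext b suf (S s) _ (fun z => (match z with [] => th 1%nat | _ => 0 end) + last_at p (fun n => th (S n)) z)).
    + rewrite subset_sum_plus, subset_sum_last_at_notin, Rplus_0_r by auto.
      generalize (S s). clear. induction suf as [|a suf IH]; intros s; [reflexivity|]. simpl.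
      rewrite IH, (subset_sum_zero b suf (S s)) by auto. ring.
    + intros z. destruct z as [|c z]; simpl.
      * destruct (Nat.eq_dec p p); [ring|congruence].
      * ring.
  - assert (Ha : a <> p) by (intros ->; apply Hpre; left; auto).
    assert (Hpre' : ~ In p pre) by (intros H; apply Hpre; right; auto).
    rewrite (subset_sum_ext b _ (S s) (fun z => last_at p th (a :: z)) (last_at p (fun n => th (S n))))
      by (intros; apply last_at_cons; auto).
    rewrite !IH by auto. replace (s + S (length pre))%nat with (S s + length pre)%nat by lia. ring.
Qed.

Lemma qpoch_shift (a q : R) (k : nat) : qpoch a q (S k) = (1 - a) * qpoch (a * q) q k.
Proof.
  induction k as [|k IH]; [simpl; ring|].
  change (qpoch a q (S (S k))) with (qpoch a q (S k) * (1 - a * q ^ S k)).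
  rewrite IH. simpl. ring.
Qed.

Definition falling_roots (b : R) (K : nat) : list R := map (fun i => / b ^ i) (seq 0 K).

Lemma qpoch_falling (b : R) (K j : nat) : 0 < b < 1 -> (K <= j)%nat ->
  qpoch (b ^ (j - K + 1)) b K = fold_right (fun c p => (1 - c * b ^ j) * p) 1 (falling_roots b K).
Proof.
  intros Hb. assert (Happ : forall l c, fold_right (fun c p => (1 - c * b ^ j) * p) 1 (l ++ [c]) =
     (1 - c * b ^ j) * fold_right (fun c p => (1 - c * b ^ j) * p) 1 l).
  { induction l as [|d l IH]; intros c; simpl; [ring|]. rewrite IH. ring. }
  induction K as [|K IH]; intros HK; [reflexivity|].
  unfold falling_roots. rewrite seq_S, map_app. simpl map. rewrite Happ. fold (falling_roots b K).
  rewrite <- IH by lia. rewrite qpoch_shift.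
  replace (j - S K + 1)%nat with (j - K)%nat by lia.
  replace (b ^ (j - K) * b) with (b ^ (j - K + 1)) by (rewrite pow_add; simpl; ring).
  f_equal. simpl Nat.add. replace (b ^ j) with (b ^ (j - K) * b ^ K) by (rewrite <- pow_add; f_equal; lia).
  field. apply pow_nonzero; lra.
Qed.

Lemma falling_zero (b : R) (K j : nat) : 0 < b < 1 -> (j < K)%nat ->
  fold_right (fun c p => (1 - c * b ^ j) * p) 1 (falling_roots b K) = 0.
Proof.
  intros Hb Hj. assert (Hin : In j (seq 0 K)) by (apply in_seq; lia).
  unfold falling_roots. induction (seq 0 K) as [|i l IH]; [destruct Hin|]. simpl.
  destruct Hin as [->|Hin].
  - rewrite Rinv_l by (apply pow_nonzero; lra). ring.
  - rewrite IH by auto. ring.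
Qed.

Lemma qpoch_neq_0 (b : R) (K : nat) : 0 < b < 1 -> qpoch b b K <> 0.
Proof.
  intros Hb. induction K as [|K IH]; simpl; [lra|]. apply Rmult_integral_contrapositive_currified; auto.
  assert (b * b ^ K < 1); [|lra].
  change (b ^ S K < 1). assert (Hp : 0 <= b ^ K <= 1) by (split; [apply pow_le; lra|rewrite <- (pow1 K); apply pow_incr; lra]).
  simpl. nra.
Qed.

(* The sign [(-1) ^ k] comes from rewriting [1 / (1 - z)] as [- 1 / (z - 1)]; the power
   [b ^ (- k (k - 1) / 2)] of the formula is absorbed by [pair_prod_eq]. *)
Definition coef (b : R) (N m k : nat) : R :=
  if (Nat.leb m k && Nat.leb k N)%bool then
    (-1) ^ (m - 1) * b ^ (m * (m - 1) / 2) * / b ^ (m * k) * qbinom (k - 1) (m - 1) b * (-1) ^ k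
  else 0.

Lemma coef_S (b : R) (N m j : nat) : 0 < b < 1 -> (1 <= m)%nat -> (S j <= N)%nat ->
  coef b N m (S j) =
  - ((-1) ^ (m - 1) * b ^ (m * (m - 1) / 2) * / b ^ m * / qpoch b b (m - 1)) *
  ((-1) ^ j * / b ^ (m * j) * fold_right (fun c p => (1 - c * b ^ j) * p) 1 (falling_roots b (m - 1))).
Proof.
  intros Hb Hm Hj. unfold coef.
  destruct (Nat.leb_spec (S j) N); [|lia]. rewrite Bool.andb_true_r.
  destruct (Nat.leb_spec m (S j)).
  - unfold qbinom. replace (S j - 1)%nat with j by lia. rewrite qpoch_falling by (auto; lia).
    rewrite Nat.mul_succ_r, pow_add, Rinv_mult. simpl. unfold Rdiv. ring.
  - rewrite falling_zero by (auto; lia). ring.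
Qed.

Lemma index_sum_1 (n : nat) : forall s, (2 * index_sum s n = n * (2 * s + n - 1))%nat.
Proof.
  induction n as [|n IH]; intros s; [reflexivity|]. cbn [index_sum].
  specialize (IH (S s)). nia.
Qed.

(** If the distinguished particle is the m-th, only the full set of its predecessors reaches size
    [m]. If it comes later, the sum is [subset_sum_vanish] with [s = m] and [m - 1] roots. If it
    comes earlier, all subsets are too small. *)
Lemma subset_sum_coef (b : R) (N m : nat) (pre : list nat) : 0 < b < 1 -> (1 <= m)%nat ->
  (length pre < N)%nat ->
  b ^ (1 + length pre) * subset_sum b 1 pre (fun z => coef b N m (S (length z)))
  = if Nat.eq_dec (S (length pre)) m then -1 else 0.
Proof.
  intros Hb Hm HN.
  assert (Hnz : forall n, b ^ n <> 0) by (intros; apply pow_nonzero; lra).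
  destruct (Nat.eq_dec (S (length pre)) m) as [E|E].
  - rewrite subset_sum_top.
    + unfold coef. rewrite E, Nat.leb_refl. destruct (Nat.leb_spec m N); [|lia]. cbn [andb].
      unfold qbinom. rewrite Nat.sub_diag. simpl (0 + 1)%nat. rewrite pow_1.
      assert (Hsq : (-1) ^ (m - 1) * (-1) ^ m = -1).
      { rewrite <- pow_add. replace (m - 1 + m)%nat with (S (2 * (m - 1))) by lia.
        apply pow_1_odd. }
      (* With [length pre = m - 1] the sum is [m + m * (m - 1) / 2 + m * (m - 1) / 2], which
         balances [b ^ (m * k)] at [k = m]. *)
      assert (Hexp : (1 + length pre + index_sum 1 (length pre) + m * (m - 1) / 2 = m * m)%nat).
      { pose proof (index_sum_1 (length pre) 1) as E1.
        assert (E2 : (m * (m - 1) / 2 = index_sum 1 (length pre))%nat).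
        { symmetry. apply Nat.div_unique_exact; [lia|]. rewrite E1. subst m. nia. }
        rewrite E2. subst m. nia. }
      pose proof (qpoch_neq_0 b (m - 1) Hb) as Hq.
      transitivity ((b ^ (1 + length pre + index_sum 1 (length pre) + m * (m - 1) / 2) * / b ^ (m * m)) *
         (qpoch b b (m - 1) / qpoch b b (m - 1)) * ((-1) ^ (m - 1) * (-1) ^ m)).
      * rewrite !pow_add. ring.
      * rewrite Hexp, Hsq, Rinv_r by auto. field. auto.
    + intros z Hz. unfold coef. destruct (Nat.leb_spec m (S (length z))); [lia|reflexivity].
  - rewrite (subset_sum_ext_sub b pre 1 _ (fun z =>
      - ((-1) ^ (m - 1) * b ^ (m * (m - 1) / 2) * / b ^ m * / qpoch b b (m - 1)) *
      ((-1) ^ length z * / b ^ (m * length z) * fold_right (fun c p => (1 - c * b ^ length z) * p) 1 (falling_roots b (m - 1))))).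
    + rewrite subset_sum_scal.
      destruct (le_lt_dec m (length pre)) as [Hle|Hlt].
      * rewrite subset_sum_vanish; auto; [ring|].
        unfold falling_roots. rewrite length_map, length_seq. lia.
      * rewrite subset_sum_zero; [ring|]. intros z Hz. apply sublist_length in Hz.
        rewrite falling_zero by (auto; lia). ring.
    + intros z Hz. apply sublist_length in Hz. apply coef_S; auto. lia.
Qed.

Lemma initial_value (r b : R) (N : nat) (x : Z) (m : nat) (ell : C -> R) (y : list nat) :
  4 <= r -> 0 < b < 1 -> (forall (a : R) u, ell (RtoC a * u)%C = a * ell u) ->
  (1 <= m <= N)%nat -> config N y ->
  subset_sum b 1 y (wave_obs r b N x ell (coef b N m) 0) = ell 1%C * at_site m x y.
Proof.
  intros Hr Hb Hell Hm [Hl Hs].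
  assert (Hc0 : coef b N m 0 = 0) by (unfold coef; destruct (Nat.leb_spec m 0); [lia|reflexivity]).
  (* The guard [0 <= x] is essential: [Z.to_nat] would send a negative [x] to site 0. *)
  assert (Hobs : forall z, sublist z y -> wave_obs r b N x ell (coef b N m) 0 z =
     - ell 1%C * (if Z_le_dec 0 x then last_at (Z.to_nat x) (coef b N m) z else 0)).
  { intros z Hz. unfold wave_obs. destruct (list_eq_dec Nat.eq_dec z []) as [->|Hne].
    - simpl length. rewrite Hc0. simpl. destruct (Z_le_dec 0 x); ring.
    - rewrite mci_wave_0; auto; [|apply (strictly_increasing_sublist z y); auto].
      rewrite <- (Cmult_1_r (RtoC _)), Hell. unfold last_at.
      destruct z as [|c z]; [congruence|].
      destruct (Z_le_dec 0 x), (Z.eq_dec (Z.of_nat (last (c :: z) 0%nat)) x); try lia; try ring;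
        destruct (Nat.eq_dec (last (c :: z) 0%nat) (Z.to_nat x)); try lia; ring. }
  rewrite (subset_sum_ext_sub b y 1 _ _ Hobs), subset_sum_scal.
  pose proof (strictly_increasing_NoDup y Hs) as Hnd.
  unfold at_site.
  destruct (Z_le_dec 0 x) as [Hx|Hx].
  - destruct (in_dec Nat.eq_dec (Z.to_nat x) y) as [Hin|Hin].
    + apply in_split in Hin. destruct Hin as [pre [suf ->]].
      assert (Hnpre : ~ In (Z.to_nat x) pre /\ ~ In (Z.to_nat x) suf).
      { apply NoDup_remove_2 in Hnd. split; intros H; apply Hnd, in_or_app; auto. }
      destruct Hnpre as [Hn1 Hn2].
      rewrite (subset_sum_ext b _ 1 _ (last_at (Z.to_nat x) (coef b N m))) by auto.
      rewrite subset_sum_last_at by auto.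
      rewrite length_app in Hl. simpl in Hl.
      rewrite subset_sum_coef by (auto; lia).
      assert (Hiff : S (length pre) = m <-> Z.of_nat (nth (m - 1) (pre ++ Z.to_nat x :: suf) 0%nat) = x).
      { split; intros E.
        - replace (m - 1)%nat with (length pre) by lia. rewrite nth_middle. lia.
        - assert (E1 : nth (m - 1) (pre ++ Z.to_nat x :: suf) 0%nat = nth (length pre) (pre ++ Z.to_nat x :: suf) 0%nat)
            by (rewrite nth_middle; lia).
          apply (proj1 (NoDup_nth _ 0%nat) Hnd) in E1; rewrite ?length_app; simpl; lia. }
      destruct (Nat.eq_dec (S (length pre)) m), (Z.eq_dec _ x); try tauto; ring.
    + rewrite (subset_sum_last_at_notin b (Z.to_nat x) y Hin).
      destruct (Z.eq_dec _ x) as [E|E]; [|ring].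
      exfalso. apply Hin. replace (Z.to_nat x) with (nth (m - 1) y 0%nat) by lia. apply nth_In. lia.
  - rewrite subset_sum_zero by auto. destruct (Z.eq_dec _ x); [lia|ring].
Qed.

(** * The complex exponential series *)

Lemma nonneg_of_derive (h dh : R -> R) (s : R) : 0 <= s -> h 0 = 0 ->
  (forall v, 0 <= v <= s -> is_derive h v (dh v)) -> (forall v, 0 <= v <= s -> 0 <= dh v) -> 0 <= h s.
Proof.
  intros Hs H0 Hd Hp.
  destruct (MVT_gen h 0 s dh) as [c [Hc E]].
  - intros v Hv. rewrite Rmin_left, Rmax_right in Hv by auto. apply Hd. lra.
  - intros v Hv. rewrite Rmin_left, Rmax_right in Hv by auto.
    apply continuity_pt_filterlim. apply (ex_derive_continuous (V := R_NormedModule)).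
    exists (dh v). apply Hd. lra.
  - rewrite Rmin_left, Rmax_right in Hc by auto.
    rewrite H0, !Rminus_0_r in E. rewrite E. apply Rmult_le_pos; auto.
Qed.

Lemma Rabs_le_of_derive (f df : R -> R) (D : R) (n : nat) : f 0 = 0 ->
  (forall v, 0 <= v <= 1 -> is_derive f v (df v)) ->
  (forall v, 0 <= v <= 1 -> Rabs (df v) <= D * v ^ n) ->
  forall s, 0 <= s <= 1 -> Rabs (f s) <= D * (s ^ S n / INR (S n)).
Proof.
  intros H0 Hd Hb s Hs.
  assert (Hn : INR (S n) <> 0) by (apply not_0_INR; lia).
  assert (Hp : forall v, is_derive (fun v => D * (v ^ S n / INR (S n))) v (D * v ^ n)).
  { intros v. auto_derive; auto. change (match n with O => 1 | S _ => INR n + 1 end) with (INR (S n)). field. auto. }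
  assert (Hpow : 0 ^ S n = 0) by (simpl; ring).
  apply Rabs_le. split.
  - assert (H : 0 <= (fun v => D * (v ^ S n / INR (S n)) + f v) s).
    { apply (nonneg_of_derive (fun v => D * (v ^ S n / INR (S n)) + f v) (fun v => D * v ^ n + df v) s); [lra| | |].
      - rewrite Hpow, H0. unfold Rdiv; ring.
      - intros v Hv. apply (is_derive_plus (V := R_NormedModule)); [apply Hp|apply Hd; lra].
      - intros v Hv. assert (Hv' : 0 <= v <= 1) by lra. specialize (Hb v Hv').
        apply Rabs_le_between in Hb. lra. }
    simpl in H |- *. lra.
  - assert (H : 0 <= (fun v => D * (v ^ S n / INR (S n)) - f v) s).
    { apply (nonneg_of_derive (fun v => D * (v ^ S n / INR (S n)) - f v) (fun v => D * v ^ n - df v) s); [lra| | |].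
      - rewrite Hpow, H0. unfold Rdiv; ring.
      - intros v Hv. apply (is_derive_minus (V := R_NormedModule)); [apply Hp|apply Hd; lra].
      - intros v Hv. assert (Hv' : 0 <= v <= 1) by lra. specialize (Hb v Hv').
        apply Rabs_le_between in Hb. lra. }
    simpl in H |- *. lra.
Qed.

Section CexpSeries.

Context (a c : R).

(** The Taylor coefficients of [exp ((a + i c) s)] as pairs of reals: [Cexp] is built from real
    functions, and remainders are estimated by real calculus. *)
Fixpoint ecoef (n : nat) : R * R :=
  match n with
  | O => (1, 0)
  | S n' => ((a * fst (ecoef n') - c * snd (ecoef n')) / INR (S n'),
             (a * snd (ecoef n') + c * fst (ecoef n')) / INR (S n'))
  end.

Fixpoint taylor (f : R * R -> R) (n : nat) (s : R) : R :=
  match n with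
  | O => 0
  | S n' => taylor f n' s + s ^ n' * f (ecoef n')
  end.

Lemma taylor_derive (n : nat) (s : R) :
  is_derive (taylor fst (S n)) s (a * taylor fst n s - c * taylor snd n s) /\
  is_derive (taylor snd (S n)) s (a * taylor snd n s + c * taylor fst n s).
Proof.
  induction n as [|n [IH1 IH2]].
  - simpl. split; auto_derive; auto; ring.
  - assert (Hn : INR (S n) <> 0) by (apply not_0_INR; lia).
    assert (Hm : forall k, is_derive (fun s => s ^ S n * k) s (INR (S n) * s ^ n * k)).
    { intros k. auto_derive; auto. change (match n with O => 1 | S _ => INR n + 1 end) with (INR (S n)). ring. }
    split.
    + apply (is_derive_ext (fun s => taylor fst (S n) s + s ^ S n * fst (ecoef (S n)))); [reflexivity|].
      replace (a * taylor fst (S n) s - c * taylor snd (S n) s) with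
        ((a * taylor fst n s - c * taylor snd n s) + INR (S n) * s ^ n * fst (ecoef (S n))).
      * apply (is_derive_plus (V := R_NormedModule)); auto.
      * cbn [taylor ecoef fst snd]. field. auto.
    + apply (is_derive_ext (fun s => taylor snd (S n) s + s ^ S n * snd (ecoef (S n)))); [reflexivity|].
      replace (a * taylor snd (S n) s + c * taylor fst (S n) s) with
        ((a * taylor snd n s + c * taylor fst n s) + INR (S n) * s ^ n * snd (ecoef (S n))).
      * apply (is_derive_plus (V := R_NormedModule)); auto.
      * cbn [taylor ecoef fst snd]. field. auto.
Qed.

Lemma taylor_0 (n : nat) : taylor fst (S n) 0 = 1 /\ taylor snd (S n) 0 = 0.
Proof.
  induction n as [|n [IH1 IH2]].
  - simpl. split; ring.
  - change (taylor fst (S (S n)) 0) with (taylor fst (S n) 0 + 0 ^ S n * fst (ecoef (S n))).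
    change (taylor snd (S (S n)) 0) with (taylor snd (S n) 0 + 0 ^ S n * snd (ecoef (S n))).
    rewrite IH1, IH2. split; simpl; ring.
Qed.

(** The derivative of a remainder of order [n + 1] is a combination, with coefficients [a] and [c]
    up to sign, of the remainders of order [n]; each integration thus brings a factor [2 * B] and a
    division by [n + 1]. *)
Lemma exp_remainder (B : R) : Rabs a <= B -> Rabs c <= B -> forall n s, 0 <= s <= 1 ->
  Rabs (exp (a * s) * cos (c * s) - taylor fst n s) <= exp B * (2 * B) ^ n * s ^ n / INR (fact n) /\
  Rabs (exp (a * s) * sin (c * s) - taylor snd n s) <= exp B * (2 * B) ^ n * s ^ n / INR (fact n).
Proof.
  intros Ha Hc. assert (HB : 0 <= B) by (eapply Rle_trans; [apply Rabs_pos|apply Ha]).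
  induction n as [|n IH]; intros s Hs.
  - assert (He : exp (a * s) <= exp B).
    { destruct (Rle_lt_or_eq_dec (a * s) B) as [H|H].
      - apply Rabs_le_between in Ha. nra.
      - apply Rlt_le, exp_increasing; auto.
      - rewrite H; lra. }
    pose proof (exp_pos (a * s)).
    simpl. rewrite !Rminus_0_r, !Rmult_1_r, Rdiv_1_r, !Rabs_mult, (Rabs_right (exp _)) by lra.
    assert (Rabs (cos (c * s)) <= 1) by (apply Rabs_le, COS_bound).
    assert (Rabs (sin (c * s)) <= 1) by (apply Rabs_le, SIN_bound).
    pose proof (Rabs_pos (cos (c * s))). pose proof (Rabs_pos (sin (c * s))).
    split; (apply Rle_trans with (exp (a * s) * 1); [apply Rmult_le_compat_l; lra|lra]).
  - set (D := exp B * (2 * B) ^ S n / INR (fact n)).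
    assert (Hf : INR (fact n) <> 0) by apply INR_fact_neq_0.
    assert (Hn : INR (S n) <> 0) by (apply not_0_INR; lia).
    assert (Heq : forall s, exp B * (2 * B) ^ S n * s ^ S n / INR (fact (S n)) = D * (s ^ S n / INR (S n))).
    { intros v. unfold D. rewrite fact_simpl, mult_INR. field. auto. }
    destruct (taylor_0 n) as [T1 T2].
    assert (Hbnd : forall p q v, 0 <= v <= 1 ->
       Rabs p <= exp B * (2 * B) ^ n * v ^ n / INR (fact n) ->
       Rabs q <= exp B * (2 * B) ^ n * v ^ n / INR (fact n) ->
       Rabs (a * p) + Rabs (c * q) <= D * v ^ n).
    { intros p q v Hv Hp Hq. rewrite !Rabs_mult.
      set (X := exp B * (2 * B) ^ n * v ^ n / INR (fact n)) in *.
      assert (HX : D * v ^ n = B * X + B * X) by (unfold D, X; simpl; field; auto).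
      rewrite HX. apply Rplus_le_compat; apply Rmult_le_compat; auto using Rabs_pos. }
    rewrite !Heq. split.
    + apply (Rabs_le_of_derive (fun s => exp (a * s) * cos (c * s) - taylor fst (S n) s)
        (fun s => a * (exp (a * s) * cos (c * s) - taylor fst n s) - c * (exp (a * s) * sin (c * s) - taylor snd n s))); auto.
      * rewrite !Rmult_0_r, exp_0, cos_0, T1. ring.
      * intros v Hv. destruct (taylor_derive n v) as [D1 _].
        replace (a * (exp (a * v) * cos (c * v) - taylor fst n v) - c * (exp (a * v) * sin (c * v) - taylor snd n v))
          with ((a * (exp (a * v) * cos (c * v)) - c * (exp (a * v) * sin (c * v))) - (a * taylor fst n v - c * taylor snd n v)) by ring.
        apply (is_derive_minus (V := R_NormedModule)); auto. auto_derive; auto. ring.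
      * intros v Hv. destruct (IH v Hv) as [I1 I2].
        unfold Rminus at 1. eapply Rle_trans; [apply Rabs_triang|]. rewrite Rabs_Ropp. apply Hbnd; auto.
    + apply (Rabs_le_of_derive (fun s => exp (a * s) * sin (c * s) - taylor snd (S n) s)
        (fun s => a * (exp (a * s) * sin (c * s) - taylor snd n s) + c * (exp (a * s) * cos (c * s) - taylor fst n s))); auto.
      * rewrite !Rmult_0_r, sin_0, T2. ring.
      * intros v Hv. destruct (taylor_derive n v) as [_ D2].
        replace (a * (exp (a * v) * sin (c * v) - taylor snd n v) + c * (exp (a * v) * cos (c * v) - taylor fst n v))
          with ((a * (exp (a * v) * sin (c * v)) + c * (exp (a * v) * cos (c * v))) - (a * taylor snd n v + c * taylor fst n v)) by ring.
        apply (is_derive_minus (V := R_NormedModule)); auto. auto_derive; auto. ring.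
      * intros v Hv. destruct (IH v Hv) as [I1 I2].
        eapply Rle_trans; [apply Rabs_triang|]. apply Hbnd; auto.
Qed.

Lemma ecoef_spec (n : nat) : (ecoef n : C) = (RtoC (/ INR (fact n)) * Cpow (a, c) n)%C.
Proof.
  induction n as [|n IH].
  - simpl. rewrite Rinv_1. unfold RtoC, Cmult; simpl. f_equal; ring.
  - assert (Hf : INR (fact n) <> 0) by apply INR_fact_neq_0.
    assert (Hn : INR (S n) <> 0) by (apply not_0_INR; lia).
    cbn [ecoef]. rewrite IH, Cpow_S, fact_simpl, mult_INR.
    destruct (Cpow (a, c) n) as [p q]. unfold RtoC, Cmult; cbn [fst snd]. f_equal; field; auto.
Qed.

End CexpSeries.

Definition exp_partial (n : nat) (u : C) : C :=
  sumC (fun j => (RtoC (/ INR (fact j)) * Cpow u j)%C) (seq 0 n).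

Lemma sumC_seq_last (f : nat -> C) (n : nat) : sumC f (seq 0 (S n)) = (sumC f (seq 0 n) + f n)%C.
Proof.
  rewrite seq_S. simpl. generalize (seq 0 n). intros l.
  induction l as [|d l IH]; simpl; [ring|]. rewrite IH. ring.
Qed.

Lemma exp_partial_taylor (a c : R) (n : nat) : exp_partial n (a, c) = (taylor a c fst n 1, taylor a c snd n 1).
Proof.
  induction n as [|n IH]; [reflexivity|].
  unfold exp_partial in *. rewrite sumC_seq_last, IH, <- ecoef_spec.
  cbn [taylor]. rewrite pow1. unfold Cplus; cbn [fst snd]. f_equal; ring.
Qed.

Lemma Cexp_approx (B eps : R) : 0 <= B -> 0 < eps -> exists n0, forall n u, (n0 <= n)%nat -> Cmod u <= B ->
  Cmod (Cexp u - exp_partial n u) <= eps.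
Proof.
  intros HB Heps.
  destruct (cv_speed_pow_fact (2 * B) (eps / (2 * exp B))) as [n0 Hn0].
  { apply Rdiv_lt_0_compat; auto. pose proof (exp_pos B); lra. }
  exists n0. intros n [a c] Hn Hu.
  assert (Ha : Rabs a <= B /\ Rabs c <= B).
  { pose proof (Rmax_Cmod (a, c)) as H. simpl in H.
    pose proof (Rmax_l (Rabs a) (Rabs c)). pose proof (Rmax_r (Rabs a) (Rabs c)). lra. }
  destruct Ha as [Ha Hc].
  destruct (exp_remainder a c B Ha Hc n 1) as [E1 E2]; [lra|].
  specialize (Hn0 n Hn). unfold R_dist in Hn0. rewrite Rminus_0_r in Hn0.
  assert (Hb : exp B * (2 * B) ^ n * 1 ^ n / INR (fact n) <= eps / 2).
  { rewrite pow1, Rmult_1_r. apply Rle_trans with (exp B * (eps / (2 * exp B))).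
    - unfold Rdiv at 1. rewrite Rmult_assoc. apply Rmult_le_compat_l; [apply Rlt_le, exp_pos|].
      apply Rlt_le. eapply Rle_lt_trans; [apply Rle_abs|exact Hn0].
    - right. pose proof (exp_pos B). field. lra. }
  rewrite !Rmult_1_r in E1, E2. rewrite exp_partial_taylor.
  set (p := exp a * cos c - taylor a c fst n 1) in *. set (q := exp a * sin c - taylor a c snd n 1) in *.
  replace (Cexp (a, c) - (taylor a c fst n 1, taylor a c snd n 1))%C with (RtoC p + Ci * RtoC q)%C.
  - eapply Rle_trans; [apply Cmod_triangle|]. rewrite Cmod_mult, Cmod_Ci, !Cmod_R. lra.
  - unfold Cexp, p, q. apply injective_projections; simpl; ring.
Qed.

(** * Summation over the number of jumps *)

Lemma choose_2_succ (k : nat) : (S k * (S k - 1) / 2 = k + k * (k - 1) / 2)%nat.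
Proof.
  replace (S k * (S k - 1))%nat with (k * 2 + k * (k - 1))%nat by (destruct k; nia).
  rewrite Nat.div_add_l; lia.
Qed.

Lemma prodC_const_mult {A : Type} (c : C) (f : A -> C) (l : list A) :
  prodC (fun a => (c * f a)%C) l = (Cpow c (length l) * prodC f l)%C.
Proof. induction l as [|a l IH]; simpl; [ring|]. rewrite IH. ring. Qed.

Lemma pair_prod_eq (b : R) (zs : list C) : b <> 0 ->
  (forall u v, In u zs -> In v zs -> den b u v <> 0%C) ->
  pair_prod b zs = (RtoC (b ^ (length zs * (length zs - 1) / 2)) * pairs_AD b zs)%C.
Proof.
  intros Hb. assert (Hbc : RtoC b <> 0%C) by (intros E; injection E; auto).
  induction zs as [|u l IH]; intros H.
  - simpl. ring.
  - cbn [pair_prod pairs_AD]. simpl length. rewrite choose_2_succ, pow_add, RtoC_mult.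
    rewrite IH by (intros; apply H; right; auto).
    rewrite (prodC_ext _ (fun v => (RtoC b * ((v - u) / den b u v))%C)).
    + rewrite prodC_const_mult, <- RtoC_pow. ring.
    + intros v Hv. assert (Hd : den b u v <> 0%C) by (apply H; [left|right]; auto).
      replace (1 - RtoC (1 + / b) * u + RtoC (/ b) * (u * v))%C with (den b u v / RtoC b)%C.
      * field. auto.
      * unfold den. rewrite RtoC_plus, RtoC_inv by auto. field. auto.
Qed.

Definition evolved (b : R) (N : nat) (x : Z) (t : R) (ys : list nat) (zs : list C) : C :=
  (amplitude b zs * (zpow x ys zs * Cexp (RtoC (INR N * t) * (rate_symbol b N zs - 1))))%C.

Lemma Cexp_0 : Cexp 0 = 1%C.
Proof. unfold Cexp; simpl. rewrite exp_0, cos_0, sin_0. unfold RtoC. f_equal; ring. Qed.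

Lemma prodC_minus_one (zs : list C) : Forall (fun z : C => z <> 1%C) zs ->
  (/ prodC (fun z => 1 - z) zs = RtoC ((-1) ^ length zs) * prodC (fun z => / (z - 1)) zs)%C /\
  prodC (fun z => 1 - z)%C zs <> 0%C.
Proof.
  intros H. induction H as [|z t Hz _ [IH1 IH2]]; simpl.
  - split; [field|apply C1_nz].
  - assert (H1 : (1 - z)%C <> 0%C).
    { intros E. apply Hz. replace z with (1 - (1 - z))%C by ring. rewrite E. ring. }
    assert (H2 : (z - 1)%C <> 0%C).
    { intros E. apply Hz. replace z with (z - 1 + 1)%C by ring. rewrite E. ring. }
    split; [|apply Cmult_neq_0; auto].
    replace (/ ((1 - z) * prodC (fun z0 => 1 - z0) t))%C with (/ (1 - z) * / prodC (fun z0 => 1 - z0) t)%C by (field; auto).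
    rewrite IH1, RtoC_mult. replace (RtoC (-1)) with (- (1))%C by (apply injective_projections; simpl; ring).
    set (P := prodC _ t). set (s := RtoC ((-1) ^ length t)). field. auto.
Qed.

(** The exponent of the theorem is [t * (jump_symbol b z - 1)], because [jump_symbol b z - 1] equals
    [- (1 - / z) / (1 - b * / z)]. *)
Lemma combine_factor (b t : R) (y : list nat) (x : Z) (S : list nat) : forall zs, length S = length zs ->
  Forall (fun z : C => z <> 0%C) zs -> Forall (fun z : C => (1 - b * / z)%C <> 0%C) zs ->
  prodC (fun p : nat * C =>
     let (s, z) := p in
     Cmult (Cpowz z (x - Z.of_nat (nth (s - 1) y 0%nat) - 1)%Z)
       (Cexp (Cmult (RtoC (- t)) (Cdiv (Cminus 1%C (Cinv z)) (Cminus 1%C (Cmult (RtoC b) (Cinv z)))))))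
    (combine S zs) =
  (zpow x (map (fun s => nth (s - 1) y 0%nat) S) zs *
   Cexp (RtoC t * (sumC (jump_symbol b) zs - RtoC (INR (length zs)))))%C.
Proof.
  induction S as [|s S IH]; intros [|z zs] Hl Hz Hg; try discriminate.
  - simpl. replace (RtoC t * (0 - 0))%C with (RtoC 0) by ring. rewrite Cexp_0. ring.
  - inversion Hz as [|? ? Hz1 Hz2]; subst. inversion Hg as [|? ? Hg1 Hg2]; subst.
    cbn [combine map zpow]. simpl prodC at 1.
    match goal with |- (_ * ?X = _)%C => change X with (prodC (fun p : nat * C =>
     let (s, z) := p in
     Cmult (Cpowz z (x - Z.of_nat (nth (s - 1) y 0%nat) - 1)%Z)
       (Cexp (Cmult (RtoC (- t)) (Cdiv (Cminus 1%C (Cinv z)) (Cminus 1%C (Cmult (RtoC b) (Cinv z)))))))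
      (combine S zs)) end.
    rewrite IH; auto.
    replace (RtoC t * (sumC (jump_symbol b) (z :: zs) - RtoC (INR (length (z :: zs)))))%C
      with (RtoC (- t) * ((1 - / z) / (1 - RtoC b * / z)) + RtoC t * (sumC (jump_symbol b) zs - RtoC (INR (length zs))))%C.
    + rewrite Cexp_plus. ring.
    + change (sumC (jump_symbol b) (z :: zs)) with (jump_symbol b z + sumC (jump_symbol b) zs)%C.
      change (length (z :: zs)) with (Datatypes.S (length zs)). rewrite S_INR, RtoC_plus, RtoC_opp.
      unfold jump_symbol. set (w := (/ z)%C) in *. set (X := sumC _ _).
      field. auto.
Qed.

Lemma integrand_eq (r b t : R) (N : nat) (y : list nat) (x : Z) (S : list nat) (zs : list C) :
  4 <= r -> 0 < b < 1 -> (0 < N)%nat -> torus r (length S) zs ->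
  integrand b t y x S zs =
  (RtoC (b ^ (length S * (length S - 1) / 2) * (-1) ^ length S) *
   evolved b N x t (map (fun s => nth (s - 1) y 0%nat) S) zs)%C.
Proof.
  intros Hr Hb HN Hz. assert (Hr0 : 0 < r) by lra.
  assert (Hin : forall u, In u zs -> exists i, (i < length S)%nat /\ coord i zs = u).
  { intros u Hu. apply (In_nth _ _ (RtoC 0)) in Hu. destruct Hu as [i [Hi E]]. exists i. destruct Hz. split; [lia|auto]. }
  assert (Hlen : length zs = length S) by (destruct Hz; auto).
  unfold integrand. rewrite pair_prod_eq; [|lra|].
  2:{ intros u v Hu Hv. destruct (Hin u Hu) as [i [Hi <-]]. destruct (Hin v Hv) as [j [Hj <-]].
      apply (den_neq_0 r b Hr Hb (length S)); auto. }
  rewrite combine_factor; [|auto|apply (torus_neq_0 r (length S)); auto|].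
  2:{ apply Forall_forall. intros u Hu. destruct (Hin u Hu) as [i [Hi <-]]. apply (geom_symbol_neq r b Hr Hb (length S)); auto. }
  assert (H1 : Forall (fun z : C => z <> 1%C) zs).
  { apply Forall_forall. intros u Hu. destruct (Hin u Hu) as [i [Hi <-]]. apply (torus_coord_neq_1 r Hr (length S)); auto. }
  destruct (prodC_minus_one zs H1) as [E1 E2].
  unfold Cdiv at 1. rewrite E1. unfold evolved, amplitude.
  assert (HN' : INR N <> 0) by (apply not_0_INR; lia).
  assert (HNc : RtoC (INR N) <> 0%C) by (intros E; injection E; auto).
  replace (RtoC (INR N * t) * (rate_symbol b N zs - 1))%C
    with (RtoC t * (sumC (jump_symbol b) zs - RtoC (INR (length zs))))%C.
  - rewrite Hlen, RtoC_mult. ring.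
  - unfold rate_symbol. rewrite RtoC_mult, RtoC_minus, RtoC_inv by auto. field. auto.
Qed.

Definition poisson_weight (N : nat) (t : R) (n : nat) : R :=
  exp (- (INR N * t)) * (INR N * t) ^ n / INR (fact n).

(** The rate symbol is bounded on the torus, so the Poisson sum of its powers converges uniformly to
    the exponential. The same estimate shows that the limit is approximable and that the integrals
    converge. *)
Lemma evolved_series (r b : R) (N : nat) (x : Z) (t : R) (ys : list nat) :
  4 <= r -> 0 < b < 1 -> (0 < N)%nat -> 0 < t ->
  lau r (length ys) (evolved b N x t ys) /\
  forall ell : C -> R, (forall u v, ell (u + v)%C = ell u + ell v) ->
   (forall (a : R) u, ell (RtoC a * u)%C = a * ell u) -> (forall u, Rabs (ell u) <= Cmod u) ->
   is_lim_seq (fun K => sumR (fun n => poisson_weight N t n *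
       ell (multi_circ_int r (length ys) (wave b N x n ys))) (seq 0 K))
     (ell (multi_circ_int r (length ys) (evolved b N x t ys))).
Proof.
  intros Hr Hb HN Ht. assert (Hr0 : 0 < r) by lra. set (k := length ys).
  set (c := INR N * t).
  set (P := fun K zs => sumC (fun n => (RtoC (poisson_weight N t n) * wave b N x n ys zs)%C) (seq 0 K)).
  assert (HwP : forall n, lau r k (fun zs => (RtoC (poisson_weight N t n) * wave b N x n ys zs)%C)).
  { intros n. apply lau_scal; auto. apply lau_wave; auto. }
  assert (HlP : forall K, lau r k (P K)).
  { intros K. apply (apx_sumC r k _ additive_zero 0 (fun n zs => (RtoC (poisson_weight N t n) * wave b N x n ys zs)%C)); [lia|intros; apply HwP]. }
  assert (HPe : forall K zs, P K zs = (amplitude b zs * (zpow x ys zs *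
      (RtoC (exp (- c)) * exp_partial K (RtoC c * rate_symbol b N zs))))%C).
  { intros K zs. unfold P, exp_partial. rewrite <- !sumC_mult_l. apply sumC_ext. intros n _.
    unfold wave, poisson_weight. fold c. unfold Rdiv.
    rewrite !RtoC_mult, RtoC_pow, Cpow_mult_l. ring. }
  assert (Hl0 : lau r k (fun zs => (amplitude b zs * zpow x ys zs)%C)).
  { apply lau_mult; auto; [apply lau_amplitude; auto|apply lau_zpow; auto]. }
  destruct (lau_bounded r Hr k _ Hl0) as [B [HB0 HB]].
  destruct (lau_bounded r Hr k _ (lau_rate_symbol r b N Hr Hb k)) as [B' [HB0' HB']].
  assert (Hc : 0 <= c) by (apply Rmult_le_pos; [apply pos_INR|lra]).
  assert (Happ : forall eps, 0 < eps -> exists K0, forall K, (K0 <= K)%nat -> forall zs, torus r k zs ->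
     Cmod (evolved b N x t ys zs - P K zs) <= eps).
  { intros eps Heps.
    destruct (Cexp_approx (c * B') (eps / (B + 1))) as [K0 HK0].
    - apply Rmult_le_pos; auto.
    - apply Rdiv_lt_0_compat; lra.
    - exists K0. intros K HK zs Hz. rewrite HPe. unfold evolved. fold c.
      replace (RtoC c * (rate_symbol b N zs - 1))%C with (RtoC (- c) + RtoC c * rate_symbol b N zs)%C
        by (rewrite RtoC_opp; ring).
      rewrite Cexp_plus.
      replace (Cexp (RtoC (- c))) with (RtoC (exp (- c))).
      2:{ unfold Cexp, RtoC; simpl. rewrite cos_0, sin_0. f_equal; ring. }
      set (u := (RtoC c * rate_symbol b N zs)%C).
      replace (amplitude b zs * (zpow x ys zs * (RtoC (exp (- c)) * Cexp u)) -
        amplitude b zs * (zpow x ys zs * (RtoC (exp (- c)) * exp_partial K u)))%C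
        with ((amplitude b zs * zpow x ys zs) * (RtoC (exp (- c)) * (Cexp u - exp_partial K u)))%C by ring.
      rewrite !(Cmod_mult (_ * _)%C), (Cmod_mult (RtoC _)), Cmod_R.
      assert (Hu : Cmod u <= c * B').
      { unfold u. rewrite Cmod_mult, Cmod_R, Rabs_right by lra. apply Rmult_le_compat_l; auto. }
      specialize (HK0 K u HK Hu).
      assert (He : Rabs (exp (- c)) <= 1).
      { rewrite Rabs_right by (apply Rle_ge, Rlt_le, exp_pos). rewrite <- exp_0.
        destruct (Rle_lt_or_eq_dec _ _ Hc) as [H|H]; [apply Rlt_le, exp_increasing; lra|rewrite <- H, Ropp_0; lra]. }
      apply Rle_trans with ((B + 1) * (1 * (eps / (B + 1)))).
      + specialize (HB zs Hz).
        apply Rmult_le_compat; [apply Cmod_ge_0| |lra|].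
        * apply Rmult_le_pos; [apply Rabs_pos|apply Cmod_ge_0].
        * apply Rmult_le_compat; auto using Rabs_pos, Cmod_ge_0.
      + right. field. lra. }
  assert (Hlau : lau r k (evolved b N x t ys)).
  { apply apx_lim. intros eps Heps. destruct (Happ eps Heps) as [K0 HK0]. exists (P K0). split; auto. apply HlP. }
  split; auto. intros ell ell_plus ell_scal ell_le.
  assert (Hell0 : ell 0%C = 0).
  { replace (RtoC 0) with (RtoC 0 * 0)%C by ring. rewrite ell_scal. ring. }
  assert (Hs : forall K, ell (multi_circ_int r k (P K)) = sumR (fun n => poisson_weight N t n *
       ell (multi_circ_int r k (wave b N x n ys))) (seq 0 K)).
  { intros K. unfold P. rewrite (mci_sumC r Hr0 k (fun n zs => (RtoC (poisson_weight N t n) * wave b N x n ys zs)%C)) by auto.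
    induction (seq 0 K) as [|n l IH]; [exact Hell0|]. simpl. rewrite ell_plus, IH.
    rewrite mci_scal by (auto; apply lau_wave; auto). rewrite ell_scal. reflexivity. }
  apply (is_lim_seq_ext _ _ _ Hs).
  apply is_lim_seq_spec. intros [eps Heps]. simpl.
  assert (Hrk : 0 < r ^ k) by (apply pow_lt; auto).
  destruct (Happ (eps / (2 * r ^ k))) as [K0 HK0]; [apply Rdiv_lt_0_compat; lra|].
  exists K0. intros K HK. specialize (HK0 K HK).
  rewrite Rabs_minus_sym.
  replace (ell (multi_circ_int r k (evolved b N x t ys)) - ell (multi_circ_int r k (P K)))
    with (ell (multi_circ_int r k (evolved b N x t ys) + RtoC (-1) * multi_circ_int r k (P K))%C)
    by (rewrite ell_plus, ell_scal; ring).
  eapply Rle_lt_trans; [apply ell_le|].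
  rewrite <- (mci_scal r Hr0 k (RtoC (-1)) _ (HlP K)), <- (mci_plus r Hr0 k _ _ Hlau (lau_scal r Hr k _ _ (HlP K))).
  apply Rle_lt_trans with (r ^ k * (eps / (2 * r ^ k))).
  - apply mci_bound; auto.
    + apply lau_plus; auto. apply lau_scal; auto.
    + intros zs Hz. replace (evolved b N x t ys zs + RtoC (-1) * P K zs)%C with (evolved b N x t ys zs - P K zs)%C.
      * auto.
      * apply injective_projections; simpl; ring.
  - replace (r ^ k * (eps / (2 * r ^ k))) with (eps / 2) by (field; lra). lra.
Qed.

Lemma sumR_filter {A : Type} (p : A -> bool) (f : A -> R) (l : list A) :
  sumR f (filter p l) = sumR (fun a => if p a then f a else 0) l.
Proof. induction l as [|a l IH]; simpl; auto. destruct (p a); simpl; rewrite IH; ring. Qed.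

(** Stated for a tail [y'] of [y] that starts at index [s], because elements of the subsets are
    absolute indices into [y]. *)
Lemma sublists_subset_sum (b : R) (y : list nat) (y' : list nat) : forall s g,
  (forall i, (i < length y')%nat -> nth (s + i - 1) y 0%nat = nth i y' 0%nat) ->
  sumR (fun S => b ^ kappa S * g (map (fun i => nth (i - 1) y 0%nat) S)) (sublists (seq s (length y')))
  = subset_sum b s y' g.
Proof.
  induction y' as [|a y' IH]; intros s g H.
  - simpl. ring.
  - cbn [length seq sublists subset_sum]. rewrite sumR_app, sumR_map. f_equal.
    + rewrite <- (IH (S s) (fun z => g (a :: z))).
      * rewrite <- sumR_scal. apply sumR_ext. intros S _. simpl. rewrite pow_add.
        specialize (H 0%nat). simpl in H. rewrite Nat.add_0_r in H. rewrite H by lia. ring.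
      * intros i Hi. replace (S s + i - 1)%nat with (s + S i - 1)%nat by lia. apply (H (S i)). simpl; lia.
    + apply IH. intros i Hi. replace (S s + i - 1)%nat with (s + S i - 1)%nat by lia. apply (H (S i)). simpl; lia.
Qed.

Definition evolved_obs (r b : R) (N : nat) (x : Z) (m : nat) (t : R) (ell : C -> R) (ys : list nat) : R :=
  coef b N m (length ys) * ell (multi_circ_int r (length ys) (evolved b N x t ys)).

Lemma rhs_subset_sum (r b t : R) (N : nat) (y : list nat) (m : nat) (x : Z) (ell : C -> R) :
  4 <= r -> 0 < b < 1 -> (0 < N)%nat -> 0 < t -> length y = N -> (1 <= m <= N)%nat ->
  (forall u v, ell (u + v)%C = ell u + ell v) -> (forall (a : R) u, ell (RtoC a * u)%C = a * ell u) ->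
  ell (rhs b t N y m x r) = subset_sum b 1 y (evolved_obs r b N x m t ell).
Proof.
  intros Hr Hb HN Ht Hl Hm ell_plus ell_scal. assert (Hr0 : 0 < r) by lra.
  assert (Hell0 : ell 0%C = 0).
  { replace (RtoC 0) with (RtoC 0 * 0)%C by ring. rewrite ell_scal. ring. }
  assert (Hsum : forall (A : Type) (f : A -> C) l, ell (sumC f l) = sumR (fun a => ell (f a)) l).
  { intros A f l. induction l as [|a l IH]; [exact Hell0|]. simpl. rewrite ell_plus, IH. reflexivity. }
  unfold rhs. rewrite ell_scal, Hsum, <- sumR_scal.
  set (ysof := map (fun i => nth (i - 1) y 0%nat)).
  set (F := fun S => b ^ kappa S * evolved_obs r b N x m t ell (ysof S)).
  (* After exchanging the sums a subset is seen only by [k = length S]; sizes outside the range from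
     [m] to [N] are matched by zeros of [coef]. *)
  rewrite (sumR_ext _ (fun k => sumR (fun S => if Nat.eqb (length S) k then F S else 0) (sublists (seq 1 N)))).
  - rewrite sumR_exchange.
    rewrite (sumR_ext _ F).
    + pose proof (sublists_subset_sum b y y 1 (evolved_obs r b N x m t ell)) as E. rewrite Hl in E.
      apply E. intros i Hi. replace (1 + i - 1)%nat with i by lia. reflexivity.
    + intros S _. destruct (le_lt_dec m (length S)) as [H1|H1]; [destruct (le_lt_dec (length S) N) as [H2|H2]|].
      * rewrite (sumR_single _ _ (length S)).
        -- rewrite Nat.eqb_refl. reflexivity.
        -- apply seq_NoDup.
        -- apply in_seq. lia.
        -- intros k _ Hk. destruct (Nat.eqb_spec (length S) k); [congruence|reflexivity].
      * rewrite sumR_zero.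
        -- unfold F, evolved_obs, coef, ysof. rewrite length_map.
           destruct (Nat.leb_spec (length S) N); [lia|]. rewrite Bool.andb_false_r. ring.
        -- intros k Hk. apply in_seq in Hk. destruct (Nat.eqb_spec (length S) k); [lia|reflexivity].
      * rewrite sumR_zero.
        -- unfold F, evolved_obs, coef, ysof. rewrite length_map.
           destruct (Nat.leb_spec m (length S)); [lia|]. simpl. ring.
        -- intros k Hk. apply in_seq in Hk. destruct (Nat.eqb_spec (length S) k); [lia|reflexivity].
  - intros k Hk. apply in_seq in Hk. rewrite Hsum. unfold subsets_of_size. rewrite sumR_filter, <- sumR_scal.
    apply sumR_ext. intros S _. destruct (Nat.eqb_spec (length S) k) as [E|E]; [|ring].
    rewrite ell_scal.
    destruct (evolved_series r b N x t (ysof S) Hr Hb HN Ht) as [Hlau _].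
    assert (Hly : length (ysof S) = k) by (unfold ysof; rewrite length_map; auto).
    rewrite (mci_ext r k (Rlt_le _ _ Hr0) _ (fun zs =>
      (RtoC (b ^ (k * (k - 1) / 2) * (-1) ^ k) * evolved b N x t (ysof S) zs)%C)).
    2:{ intros zs Hz. subst k. apply (integrand_eq r); auto. }
    rewrite Hly in Hlau.
    rewrite mci_scal, ell_scal by auto.
    unfold F, evolved_obs, coef. rewrite Hly.
    destruct (Nat.leb_spec m k); [|lia]. destruct (Nat.leb_spec k N); [|lia]. cbn [andb].
    assert (Hp : powerRZ b (Z.of_nat (kappa S) - Z.of_nat (m * k) - Z.of_nat (k * (k - 1) / 2)) =
       b ^ kappa S * / b ^ (m * k) * / b ^ (k * (k - 1) / 2)).
    { unfold Z.sub. rewrite !powerRZ_add, !powerRZ_neg', <- !pow_powerRZ by lra. reflexivity. }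
    rewrite Hp. set (I := ell _). field.
    split; apply pow_nonzero; lra.
Qed.

Lemma subset_sum_lim (b : R) (y : list nat) : forall s (g : nat -> list nat -> R) (h : list nat -> R),
  (forall z, is_lim_seq (fun K => g K z) (h z)) ->
  is_lim_seq (fun K => subset_sum b s y (g K)) (subset_sum b s y h).
Proof.
  induction y as [|a y IH]; intros s g h H; simpl; auto.
  apply is_lim_seq_plus'.
  - assert (E : is_lim_seq (fun K => subset_sum b (S s) y (fun z => g K (a :: z))) (subset_sum b (S s) y (fun z => h (a :: z))))
      by (apply (IH (S s) (fun K z => g K (a :: z))); auto).
    apply (is_lim_seq_scal_l _ (b ^ s)) in E. exact E.
  - apply IH; auto.
Qed.

Lemma rhs_lim (r b t : R) (N : nat) (y : list nat) (m : nat) (x : Z) (ell : C -> R) :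
  4 <= r -> 0 < b < 1 -> (0 < N)%nat -> 0 < t -> length y = N -> (1 <= m <= N)%nat ->
  (forall u v, ell (u + v)%C = ell u + ell v) -> (forall (a : R) u, ell (RtoC a * u)%C = a * ell u) ->
  (forall u, Rabs (ell u) <= Cmod u) ->
  is_lim_seq (fun K => sumR (fun n => poisson_weight N t n *
      subset_sum b 1 y (wave_obs r b N x ell (coef b N m) n)) (seq 0 K)) (ell (rhs b t N y m x r)).
Proof.
  intros Hr Hb HN Ht Hl Hm ell_plus ell_scal ell_le.
  rewrite (rhs_subset_sum r b t N y m x ell) by auto.
  apply (is_lim_seq_ext (fun K => subset_sum b 1 y (fun ys =>
     coef b N m (length ys) * sumR (fun n => poisson_weight N t n *
       ell (multi_circ_int r (length ys) (wave b N x n ys))) (seq 0 K)))).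
  - intros K. induction (seq 0 K) as [|n l IH].
    + rewrite subset_sum_zero; [reflexivity|]. intros; simpl; ring.
    + simpl. rewrite <- IH, <- subset_sum_scal, <- subset_sum_plus. apply subset_sum_ext.
      intros z. unfold wave_obs. ring.
  - apply subset_sum_lim. intros ys. unfold evolved_obs.
    destruct (evolved_series r b N x t ys Hr Hb HN Ht) as [_ H].
    specialize (H ell ell_plus ell_scal ell_le).
    apply (is_lim_seq_scal_l _ (coef b N m (length ys))) in H. exact H.
Qed.

Lemma poisson_weight_nonneg (N : nat) (t : R) (n : nat) : 0 < t -> 0 <= poisson_weight N t n.
Proof.
  intros Ht. unfold poisson_weight. apply Rmult_le_pos.
  - apply Rmult_le_pos; [apply Rlt_le, exp_pos|]. apply pow_le, Rmult_le_pos; [apply pos_INR|lra].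
  - apply Rlt_le, Rinv_0_lt_compat, lt_0_INR, lt_O_fact.
Qed.

Lemma ex_series_poisson (N : nat) (t : R) : ex_series (poisson_weight N t).
Proof.
  apply (ex_series_ext (fun n => exp (- (INR N * t)) * ((INR N * t) ^ n * / INR (fact n)))).
  - intros n. unfold poisson_weight, Rdiv. simpl. ring.
  - apply (ex_series_scal (K := R_AbsRing) (V := R_NormedModule)).
    exists (exp (INR N * t)). pose proof (is_exp_Reals (INR N * t)) as H.
    eapply is_series_ext; [|exact H]. intros n. simpl. rewrite pow_n_pow. reflexivity.
Qed.

Lemma ex_series_dominated (p a : nat -> R) : (forall n, 0 <= p n) -> ex_series p ->
  (forall n, Rabs (a n) <= 1) -> ex_series (fun n => p n * a n).
Proof.
  intros Hp He Ha. apply (ex_series_le (K := R_AbsRing) (V := R_CompleteNormedModule) _ p); auto.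
  intros n. change (Rabs (p n * a n) <= p n). rewrite Rabs_mult, (Rabs_right (p n)) by (apply Rle_ge; auto).
  rewrite <- (Rmult_1_r (p n)) at 2. apply Rmult_le_compat_l; auto.
Qed.

(** Tannery's theorem with dominating series [p]; the bound 1 passes to the limits [l n] and is
    returned for later use. *)
Lemma Series_dominated_lim (p : nat -> R) (a : nat -> nat -> R) (l : nat -> R) :
  (forall n, 0 <= p n) -> ex_series p -> (forall L n, Rabs (a L n) <= 1) ->
  (forall n, is_lim_seq (fun L => a L n) (l n)) ->
  (forall n, Rabs (l n) <= 1) /\
  is_lim_seq (fun L => Series (fun n => p n * a L n)) (Series (fun n => p n * l n)).
Proof.
  intros Hp He Ha Hl.
  assert (Hl1 : forall n, Rabs (l n) <= 1).
  { intros n. pose proof (is_lim_seq_abs _ _ (Hl n)) as H.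
    apply (is_lim_seq_le (fun L => Rabs (a L n)) (fun _ => 1) (Rabs (l n)) 1); auto. apply is_lim_seq_const. }
  split; auto.
  apply is_lim_seq_spec. intros [eps Heps]. simpl.
  pose proof (Series_correct _ He) as Hs.
  change (is_lim_seq (sum_n p) (Finite (Series p))) in Hs. apply is_lim_seq_spec in Hs.
  (* One quarter for the finitely many initial terms and two for the tail, where the difference is
     at most [2 * p n]. *)
  assert (He4 : 0 < eps / 4) by lra.
  destruct (Hs (mkposreal _ He4)) as [K HK]. specialize (HK K (Nat.le_refl K)). simpl in HK.
  assert (Hfin : is_lim_seq (fun L => sumR (fun n => p n * (a L n - l n)) (seq 0 (S K))) 0).
  { generalize (seq 0 (S K)). intros q. induction q as [|n q IH]; simpl; [apply is_lim_seq_const|].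
    replace 0 with (p n * 0 + 0) by ring. apply is_lim_seq_plus'; auto.
    apply (is_lim_seq_scal_l _ (p n) 0). replace 0 with (l n - l n) by ring.
    apply is_lim_seq_minus'; [auto|apply is_lim_seq_const]. }
  apply is_lim_seq_spec in Hfin. destruct (Hfin (mkposreal _ He4)) as [L0 HL0]. cbn [pos] in HL0.
  exists L0. intros L HL. specialize (HL0 L HL). rewrite Rminus_0_r in HL0.
  (* Halving brings the difference within the bound 1 asked by [ex_series_dominated]. *)
  assert (Hd : forall n, Rabs ((a L n - l n) / 2) <= 1).
  { intros n. unfold Rdiv, Rminus. rewrite Rabs_mult, (Rabs_right (/ 2)) by lra.
    pose proof (Rabs_triang (a L n) (- l n)). rewrite Rabs_Ropp in H. specialize (Ha L n). specialize (Hl1 n). lra. }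
  assert (Hex : ex_series (fun n => p n * (a L n - l n))).
  { apply (ex_series_ext (fun n => 2 * (p n * ((a L n - l n) / 2)))); [intros; simpl; field|].
    apply (ex_series_scal (K := R_AbsRing) (V := R_NormedModule)). apply ex_series_dominated; auto. }
  rewrite <- Series_minus by (apply ex_series_dominated; auto).
  rewrite (Series_ext _ (fun n => p n * (a L n - l n))) by (intros; ring).
  rewrite (Series_incr_n _ (S K)) by (auto; lia). simpl Nat.pred. rewrite sum_f_R0_sumR.
  eapply Rle_lt_trans; [apply Rabs_triang|].
  assert (Hptail : Series (fun n => p (S K + n)%nat) < eps / 4).
  { rewrite (Series_incr_n p (S K)) in HK by (auto; lia). simpl Nat.pred in HK.
    rewrite sum_f_R0_sumR, <- sumR_seq_sum_n in HK.
    set (X := sumR p (seq 0 (S K))) in *. apply Rabs_def2 in HK. lra. }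
  assert (Htail : Rabs (Series (fun n => p (S K + n)%nat * (a L (S K + n)%nat - l (S K + n)%nat))) <= 2 * Series (fun n => p (S K + n)%nat)).
  { assert (Hex' : ex_series (fun n => 2 * p (S K + n)%nat)).
    { apply (ex_series_scal (K := R_AbsRing) (V := R_NormedModule)). apply ex_series_incr_n; auto. }
    assert (Hle : forall n, 0 <= Rabs (p (S K + n)%nat * (a L (S K + n)%nat - l (S K + n)%nat)) <= 2 * p (S K + n)%nat).
    { intros n. split; [apply Rabs_pos|]. rewrite Rabs_mult, (Rabs_right (p _)) by (apply Rle_ge; auto).
      specialize (Hd (S K + n)%nat). unfold Rdiv in Hd. rewrite Rabs_mult, (Rabs_right (/ 2)) in Hd by lra.
      specialize (Hp (S K + n)%nat). nra. }
    rewrite <- Series_scal_l. eapply Rle_trans; [apply Series_Rabs|apply Series_le; auto].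
    apply (ex_series_le (K := R_AbsRing) (V := R_CompleteNormedModule) _ (fun n => 2 * p (S K + n)%nat)); auto.
    intros n. change (Rabs (Rabs (p (S K + n)%nat * (a L (S K + n)%nat - l (S K + n)%nat))) <= 2 * p (S K + n)%nat).
    rewrite Rabs_Rabsolu. apply Hle. }
  lra.
Qed.

(** The event that the first particle sits where [z] has it contains [z], and [truncated] bounds its
    probability by 1. *)
Lemma kern_pow_le_1 (b : R) (N n : nat) (y z : list nat) : 0 < b < 1 -> (0 < N)%nat -> config N y ->
  length z = N -> kern_pow b N n y z <= 1.
Proof.
  intros Hb HN Hy Hz. set (x := Z.of_nat (nth (1 - 1) z 0%nat)).
  destruct (truncated_range b N Hb HN 1 x (list_max z) n y Hy) as [_ H].
  eapply Rle_trans; [|exact H]. unfold truncated.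
  transitivity (sumR (fun w => if positions_eq_dec w z then kern_pow b N n y w else 0) (cube (list_max z) N)).
  - rewrite (sumR_single _ _ z).
    + destruct (positions_eq_dec z z); [right; reflexivity|congruence].
    + apply NoDup_box.
    + rewrite <- Hz. apply in_cube_max; auto.
    + intros w _ Hw. destruct (positions_eq_dec w z); [congruence|reflexivity].
  - apply sumR_le. intros w _. destruct (positions_eq_dec w z) as [->|].
    + right. unfold at_site, x. destruct (Z.eq_dec _ _); [ring|congruence].
    + apply Rmult_le_pos; [apply at_site_range|apply kern_pow_nonneg; auto].
Qed.

Lemma sumR_Series {A : Type} (f : A -> nat -> R) (l : list A) : (forall a, In a l -> ex_series (f a)) ->
  ex_series (fun n => sumR (fun a => f a n) l) /\
  sumR (fun a => Series (f a)) l = Series (fun n => sumR (fun a => f a n) l).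
Proof.
  induction l as [|a l IH]; intros H.
  - simpl. split.
    + apply (ex_series_ext (fun n => 0 * (/ 2) ^ n)); [intros; simpl; ring|].
      apply (ex_series_scal (K := R_AbsRing) (V := R_NormedModule)).
      exists (/ (1 - / 2)). apply is_series_geom. rewrite Rabs_right; lra.
    + symmetry. rewrite (Series_ext _ (fun n => 0 * 1)) by (intros; ring). rewrite Series_scal_l. ring.
  - destruct IH as [I1 I2]; [intros; apply H; right; auto|]. simpl. split.
    + apply (ex_series_plus (K := R_AbsRing) (V := R_NormedModule)); auto. apply H; left; auto.
    + rewrite Series_plus; auto; [rewrite I2; auto|]. apply H; left; auto.
Qed.

(** In [prob_pos] the limit over cubes stands outside the Poisson series. On one cube the finite sum
    moves inside and becomes [truncated]; dominated convergence then moves the limit inside. *)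
Lemma prob_pos_lim (b t : R) (N : nat) (y : list nat) (m : nat) (x : Z) (f : nat -> R) :
  0 < b < 1 -> (0 < N)%nat -> 0 < t -> config N y ->
  (forall n, is_lim_seq (fun L => truncated b N m x L n y) (f n)) ->
  is_lim_seq (fun K => sumR (fun n => poisson_weight N t n * f n) (seq 0 K)) (prob_pos b N t y m x).
Proof.
  intros Hb HN Ht Hy Hf.
  assert (Hp : forall n, 0 <= poisson_weight N t n) by (intros; apply poisson_weight_nonneg; auto).
  assert (Htr : forall L n, Rabs (truncated b N m x L n y) <= 1).
  { intros L n. destruct (truncated_range b N Hb HN m x L n y Hy). rewrite Rabs_right; lra. }
  destruct (Series_dominated_lim (poisson_weight N t) (fun L n => truncated b N m x L n y) f Hp (ex_series_poisson N t) Htr Hf) as [Hf1 Hlim].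
  assert (E : prob_pos b N t y m x = Series (fun n => poisson_weight N t n * f n)).
  { unfold prob_pos.
    rewrite (Lim_seq_ext _ (fun L => Series (fun n => poisson_weight N t n * truncated b N m x L n y))).
    - rewrite (is_lim_seq_unique _ _ Hlim). reflexivity.
    - intros L. change (box (repeat L N)) with (cube L N).
      rewrite (sumR_ext _ (fun z => Series (fun n => poisson_weight N t n * (at_site m x z * kern_pow b N n y z)))).
      + destruct (sumR_Series (fun z n => poisson_weight N t n * (at_site m x z * kern_pow b N n y z)) (cube L N)) as [_ E1].
        * intros z Hz. apply in_cube in Hz. destruct Hz as [Hz _].
          apply ex_series_dominated; auto; [apply ex_series_poisson|]. intros n.
          pose proof (kern_pow_le_1 b N n y z Hb HN Hy Hz). pose proof (kern_pow_nonneg b N Hb HN n y z).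
          destruct (at_site_range m x z). rewrite Rabs_right; nra.
        * rewrite E1. apply Series_ext. intros n. unfold truncated. rewrite sumR_scal. reflexivity.
      + intros z _. unfold at_site, trans_prob. destruct (Z.eq_dec _ _).
        * apply Series_ext. intros n. unfold poisson_weight. ring.
        * symmetry. rewrite (Series_ext _ (fun n => 0 * 1)) by (intros; ring). rewrite Series_scal_l. ring. }
  rewrite E.
  assert (Hex : ex_series (fun n => poisson_weight N t n * f n)) by (apply ex_series_dominated; auto; apply ex_series_poisson).
  apply Series_correct in Hex.
  change (is_lim_seq (sum_n (fun n => poisson_weight N t n * f n)) (Finite (Series (fun n => poisson_weight N t n * f n)))) in Hex.
  apply is_lim_seq_incr_1.
  eapply is_lim_seq_ext; [|exact Hex]. intros n. symmetry. apply sumR_seq_sum_n.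
Qed.

Theorem theorem3p3 (b : R) (N : nat) (t : R) (y : list nat) (m : nat) (x : Z) :
  0 < b < 1 -> (0 < N)%nat -> 0 < t ->
  length y = N -> strictly_increasing y ->
  (1 <= m <= N)%nat ->
  exists R0 : R, forall r : R, R0 < r ->
    RtoC (prob_pos b N t y m x) = rhs b t N y m x r.
Proof.
  (* The radius 4 comes from [den_small] and is independent of all parameters. *)
  intros Hb HN Ht Hl Hs Hm. exists 4. intros r Hr4. assert (Hr : 4 <= r) by lra.
  assert (Hy : config N y) by (split; auto).
  assert (Hcf : forall k, (N < k)%nat -> coef b N m k = 0).
  { intros k Hk. unfold coef. destruct (Nat.leb_spec k N); [lia|]. rewrite Bool.andb_false_r. reflexivity. }
  assert (Hmain : forall ell : C -> R, (forall u v, ell (u + v)%C = ell u + ell v) ->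
     (forall (a : R) u, ell (RtoC a * u)%C = a * ell u) -> (forall u, Rabs (ell u) <= Cmod u) ->
     forall n z, config N z -> is_lim_seq (fun L => ell 1%C * truncated b N m x L n z)
       (subset_sum b 1 z (wave_obs r b N x ell (coef b N m) n))).
  { intros ell ell_plus ell_scal ell_le.
    apply (truncated_lim b N Hb HN m x (ell 1%C) (fun n z => subset_sum b 1 z (wave_obs r b N x ell (coef b N m) n))).
    - intros n. apply subset_sum_bounded; auto. apply wave_obs_bounded; auto.
    - intros n. apply subset_sum_boundary; auto; [apply wave_obs_bounded; auto|apply wave_obs_boundary; auto].
    - intros n z [Hz _]. rewrite free_gen_subset_sum by (auto; apply wave_obs_bounded; auto).
      rewrite <- subset_sum_scal. apply subset_sum_ext. intros w. rewrite Hz. apply free_gen_wave; auto.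
    - intros z Hz. apply initial_value; auto. }
  assert (Hre : Re (rhs b t N y m x r) = prob_pos b N t y m x).
  { assert (R1 : forall u v, Re (u + v)%C = Re u + Re v) by reflexivity.
    assert (R2 : forall (a : R) u, Re (RtoC a * u)%C = a * Re u) by (intros a [p q]; unfold Re, RtoC, Cmult; simpl; ring).
    pose proof (rhs_lim r b t N y m x Re Hr Hb HN Ht Hl Hm R1 R2 re_le_Cmod) as H1.
    pose proof (prob_pos_lim b t N y m x (fun n => subset_sum b 1 y (wave_obs r b N x Re (coef b N m) n)) Hb HN Ht Hy) as H2.
    assert (H3 : forall n, is_lim_seq (fun L => truncated b N m x L n y) (subset_sum b 1 y (wave_obs r b N x Re (coef b N m) n))).
    { intros n. eapply is_lim_seq_ext; [|apply (Hmain Re R1 R2 re_le_Cmod n y Hy)]. intros; simpl; ring. }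
    specialize (H2 H3). apply is_lim_seq_unique in H1. apply is_lim_seq_unique in H2.
    rewrite H1 in H2. injection H2; auto. }
  assert (Him : Im (rhs b t N y m x r) = 0).
  { assert (R1 : forall u v, Im (u + v)%C = Im u + Im v) by reflexivity.
    assert (R2 : forall (a : R) u, Im (RtoC a * u)%C = a * Im u) by (intros a [p q]; unfold Im, RtoC, Cmult; simpl; ring).
    assert (R3 : forall u, Rabs (Im u) <= Cmod u).
    { intros u. eapply Rle_trans; [apply Rmax_r|apply Rmax_Cmod]. }
    pose proof (rhs_lim r b t N y m x Im Hr Hb HN Ht Hl Hm R1 R2 R3) as H1.
    (* Since [Im 1 = 0], the sequence whose limit is this value is identically zero. *)
    assert (H0 : forall n, subset_sum b 1 y (wave_obs r b N x Im (coef b N m) n) = 0).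
    { intros n. pose proof (Hmain Im R1 R2 R3 n y Hy) as H.
      apply (is_lim_seq_ext _ (fun _ => 0)) in H; [|intros; simpl; ring].
      apply is_lim_seq_unique in H. rewrite Lim_seq_const in H. injection H; auto. }
    apply (is_lim_seq_ext _ (fun _ => 0)) in H1.
    - apply is_lim_seq_unique in H1. rewrite Lim_seq_const in H1. injection H1; auto.
    - intros K. apply sumR_zero. intros n _. rewrite H0. ring. }
  apply injective_projections; simpl; [symmetry; exact Hre|symmetry; exact Him].
Qed.
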